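(* Let $L$ be a geometric lattice of rank $r$ with a fixed linear ordering $a_1,a_2,\dots,a_\ell$ of its atoms, viewed as the lattice of flats of a simple matroid $M$, and let $S\subseteq[r-1]$. Let $B_1,\dots,B_t$ be the nbc-bases of $M$ in lexicographic order, and for each $i$ write $B_i=\{a_{i_1},\dots,a_{i_r}\}$ with $i_1<\dots<i_r$. For $\sigma\in S_r$ let $\mathbf c^i_\sigma$ be the maximal chain $\hat 0<a_{i_{\sigma(1)}}<a_{i_{\sigma(1)}}\vee a_{i_{\sigma(2)}}<\dots<a_{i_{\sigma(1)}}\vee\dots\vee a_{i_{\sigma(r)}}=\hat 1$, with basis labeling $\nu_i(\mathbf c^i_\sigma)=i_{\sigma(1)}i_{\sigma(2)}\cdots i_{\sigma(r)}$, and let $\Delta_i=\{\mathbf c^i_\sigma:\sigma\in S_r\}$. For each $i$ let $\mathbf c_i^1,\dots,\mathbf c_i^k$ be all chains in $\Delta_i$ whose $\nu_i$-label has descent set $S$, listed in lexicographic order of their $\nu_i$-labels. For each $i,j$, writing $\mathbf c_i^j:\hat 0=x_0<x_1<\dots<x_r=\hat 1$, let $C_i^j$ be the set of chains $\hat 0=y_0<y_1<\dots<y_r=\hat 1$ in $\Delta_i$ with $y_n=x_n$ for all $n\notin S$; let $L_i^j=\{z\in L_S: z\in\mathbf d\text{ for some }\mathbf d\in C_i^j\}$; let $E_i^j$ be the set of maximal chains of $L_i^j$ that are not maximal chains of $L_i^n$ for any $n<j$ nor of $L_n^m$ for any $n<i$ and any $m$; and let $\Sigma_i^j$ be the simplicial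 complex whose facets are the chains in $E_i^j$ (with $\Sigma_i^j=\emptyset$ if $E_i^j=\emptyset$). Then the sequence $$\Sigma_1^1,\Sigma_1^2,\dots,\Sigma_1^k,\Sigma_2^1,\dots,\Sigma_2^k,\dots,\Sigma_t^k,$$ once all $\Sigma_i^j$ with $\Sigma_i^j=\emptyset$ are eliminated, is a convex-ear decomposition of the order complex $\Delta(L_S)$.
   Context: $[n]=\{1,\dots,n\}$, and $L_S=\{x\in L:\operatorname{rank}(x)\in S\}$ with the induced order. The order complex $\Delta(P)$ of a poset $P$ is the simplicial complex whose simplices are the chains of $P$. The ground set of $M$ is the set of atoms of $L$. A broken circuit is a circuit of $M$ with its smallest element (in the fixed ordering) removed; an nbc-basis is a basis of $M$ containing no broken circuit. Lexicographic order of bases compares the increasing index sequences $(i_1,\dots,i_r)$. The descent set of a word $w_1w_2\cdots w_m$ is $\{p:w_p>w_{p+1}\}$. A sequence of subcomplexes $\Sigma_1,\dots,\Sigma_n$ of a $(d-1)$-dimensional simplicial complex $\Delta$ is a convex-ear decomposition of $\Delta$ if: (i) $\bigcup_{i=1}^n\Sigma_i=\Delta$; (ii) $\Sigma_1$ is the boundary complex of a simplicial $d$-polytope, and for $i>1$, $\Sigma_i$ is a full-dimensional (i.e. $(d-1)$-dimensional) proper subcomplex of the boundary complex of some simplicial $d$-polytope; (iii) for $i>1$, $\Sigma_i$ is a simplicial ball; (iv) for $i>1$, $\left(\bigcup_{j=1}^{i-1}\Sigma_j\right)\cap\Sigma_i=\partial\Sigma_i$. (Being a boundary complex, or subcomplex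 thereof, is meant up to isomorphism.) *)

(* Defs.v *)
From HB Require Import structures.
From mathcomp Require Import all_boot all_order all_fingroup all_algebra finmap.
From mathcomp Require Import all_classical all_reals all_analysis.

Set Implicit Arguments.
Unset Strict Implicit.
Unset Printing Implicit Defensive.

Import Order.TTheory GRing.Theory Num.Theory.
Import numFieldNormedType.Exports.

(* The finite sets of [finset] are shadowed by those of [classical_sets]. *)
Local Notation fin0 := finset.set0.

(* A complex on (a subset of) [V] is the set of its faces. Nonempty complexes
   contain the empty face; [finset.set0] is the void complex. *)
Section Complexes.
Variable V : finType.
Implicit Types (K : {set {set V}}) (F G H : {set V}).

Definition simplicial_complex K : Prop :=
  forall F G, F \in K -> G \subset F -> G \in K.

(* The dimension plus one. *)
Definition cdim K : nat := \max_(F in K) #|F|.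

Definition generated_complex (E : {set {set V}}) : {set {set V}} :=
  finset (fun F => [exists G in E, F \subset G]).

(* The boundary of a pseudomanifold: it is generated by the codimension one
   faces that lie in exactly one facet. *)
Definition cboundary K : {set {set V}} :=
  generated_complex
    (finset (fun G => [&& G \in K, #|G|.+1 == cdim K &
       #|finset (fun H => (H \in K) && (G \proper H))| == 1])).

End Complexes.

Section Polytopes.
Local Open Scope ring_scope.
Local Open Scope classical_set_scope.
Variables (R : realType) (d : nat).
Implicit Types (P F : set 'rV[R]_d) (s : seq 'rV[R]_d) (x c : 'rV[R]_d).

Definition convex_hull s : set 'rV[R]_d :=
  [set x | exists w : 'I_(size s) -> R,
     [/\ forall i, 0 <= w i, \sum_i w i = 1 & x = \sum_i w i *: s`_i]].

Definition affinely_independent s : bool :=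
  if s is x :: t then free [seq y - x | y <- t] else true.

Definition dotp c x : R := \sum_i c ord0 i * x ord0 i.

(* A polytope in R^d of dimension d. *)
Definition full_polytope P : Prop :=
  (exists s, P = convex_hull s) /\
  (exists s, [/\ affinely_independent s, size s = d.+1 & [set` s] `<=` P]).

(* Taking [c = 0] shows that the empty set and [P] itself are faces. *)
Definition face P F : Prop :=
  exists c (b : R), (forall x, P x -> dotp c x <= b) /\
                    F = [set x | P x /\ dotp c x = b].

Definition vertices P : set 'rV[R]_d := [set x | face P [set x]].

Definition simplex F : Prop :=
  exists s, affinely_independent s /\ F = convex_hull s.

Definition simplicial_polytope P : Prop :=
  full_polytope P /\ forall F, face P F -> F <> P -> simplex F.

Definition boundary_complex P : set (set 'rV[R]_d) :=
  [set A | exists F, [/\ face P F, F <> P & A = vertices F]].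

End Polytopes.

Section Ears.
Local Open Scope ring_scope.
Local Open Scope classical_set_scope.
Variables (R : realType) (V : finType).
Implicit Types (K D : {set {set V}}) (F : {set V}).

Definition complex_image (T : Type) (f : V -> T) K : set (set T) :=
  [set A | exists2 F, F \in K & A = f @` [set` F]].

Definition is_polytope_boundary (d : nat) K : Prop :=
  exists (P : set 'rV[R]_d) (f : V -> 'rV[R]_d),
    [/\ simplicial_polytope P, {in finset.cover K &, injective f} &
        complex_image f K = boundary_complex P].

Definition is_proper_sub_polytope_boundary (d : nat) K : Prop :=
  exists (P : set 'rV[R]_d) (f : V -> 'rV[R]_d),
    [/\ simplicial_polytope P, {in finset.cover K &, injective f},
        complex_image f K `<=` boundary_complex P &
        complex_image f K <> boundary_complex P].

Definition homeomorphic (X Y : topologicalType) (A : set X) (B : set Y) : Prop :=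
  exists (f : X -> Y) (g : Y -> X),
    [/\ {within A, continuous f} /\ {within B, continuous g},
        f @` A `<=` B /\ g @` B `<=` A,
        (forall x, A x -> g (f x) = x) &
        (forall y, B y -> f (g y) = y)].

(* The vertex [v] is realized as the basis vector of index [enum_rank v]. *)
Definition realization K : set 'rV[R]_#|V| :=
  [set x | [/\ forall i, 0 <= x ord0 i, \sum_i x ord0 i = 1 &
     exists2 F, F \in K & forall v, v \notin F -> x ord0 (enum_rank v) = 0]].

Definition closed_ball_euclid (n : nat) : set 'rV[R]_n :=
  [set x | \sum_i x ord0 i ^+ 2 <= 1].

Definition simplicial_ball K : Prop :=
  homeomorphic (realization K) (@closed_ball_euclid (cdim K).-1).

Definition convex_ear_decomposition D (Sigma : seq {set {set V}}) : Prop :=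
  let d := cdim D in
  let K i := nth fin0 Sigma i in
  let previous i := \big[@finset.setU _/fin0]_(j < i) K j in
  [/\ forall i, (i < size Sigma)%N -> simplicial_complex (K i) /\ K i \subset D,
      previous (size Sigma) = D,
      is_polytope_boundary d (K 0%N) /\
        (forall i, (0 < i < size Sigma)%N ->
           cdim (K i) = d /\ is_proper_sub_polytope_boundary d (K i)),
      (forall i, (0 < i < size Sigma)%N -> simplicial_ball (K i)) &
      (forall i, (0 < i < size Sigma)%N ->
         finset.setI (previous i) (K i) = cboundary (K i))].

End Ears.

Section Lattice.
Local Open Scope order_scope.
Context {disp : Order.disp_t} {L : finTBLatticeType disp}.
Implicit Types (x y z : L) (X C D : {set L}).

Definition order_complex X : {set {set L}} :=
  finset (fun C => (C \subset X) && [forall x in C, forall y in C, x >=< y]).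

Definition maximal_chains X : {set {set L}} :=
  finset (fun C => maxset (fun D => D \in order_complex X) C).

(* The length of the longest chain with top element [x]. *)
Definition rank x : nat :=
  \max_(C in order_complex (finset (fun y => y <= x))) #|C|.-1.

Definition covers x y : bool := (x < y) && ~~ [exists z, x < z < y].

Definition atom x : bool := covers \bot x.

Definition graded : Prop := forall x y, covers x y -> rank y = (rank x).+1.

Definition semimodular : Prop :=
  graded /\ forall x y, (rank (x `&` y) + rank (x `|` y) <= rank x + rank y)%N.

Definition atomistic : Prop :=
  forall x, x = \join_(y | atom y && (y <= x)) y.

Definition geometric_lattice : Prop := semimodular /\ atomistic.

Definition rank_selection (S : {fset nat}) : {set L} :=
  finset (fun x => rank x \in S).

End Lattice.

Arguments geometric_lattice {disp} L.
Arguments rank_selection {disp} L S.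

Section Matroid.
Local Open Scope order_scope.
Context {disp : Order.disp_t} {L : finTBLatticeType disp} {l : nat}.
(* [a] lists the atoms in their fixed order, and the atom [a i] is identified
   with the index [i]. *)
Variable a : 'I_l -> L.
Implicit Types (A B : {set 'I_l}) (w : seq 'I_l) (S : {fset nat}).

Definition lexle w w' : bool :=
  (w : seqlexi_with (Order.seqlexi_display Order.default_display) 'I_l) <= w'.

Definition matroid_rank A : nat := rank (\join_(i in A) a i).

Definition independent A : bool := matroid_rank A == #|A|.

Definition basis B : bool := maxset independent B.

Definition circuit A : bool := minset (fun A' => ~~ independent A') A.

Definition broken_circuit A : bool :=
  [exists C : {set 'I_l}, exists i : 'I_l,
     [&& circuit C, i \in C, [forall j in C, (i <= j)%N] & A == (C :\ i)%SET]].

Definition nbc_basis B : bool :=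
  basis B && ~~ [exists A, broken_circuit A && (A \subset B)].

(* [enum B] lists [B] in increasing order, and so does [enum_val]. *)
Definition nbc_bases : seq {set 'I_l} :=
  sort (fun B B' => lexle (enum B) (enum B')) [seq B <- enum {set 'I_l} | nbc_basis B].

(* The word i_{s 1} i_{s 2} ... for B = {i_1 < i_2 < ...}. *)
Definition basis_word B (s : {perm 'I_#|B|}) : seq 'I_l :=
  [seq enum_val (s p) | p <- enum 'I_#|B|].

(* The element of rank [n] of the chain labeled by [w]. *)
Definition word_chain w (n : nat) : L := \join_(i <- take n w) a i.

(* Positions are counted from 1. *)
Definition descent_set w : {fset nat} :=
  [fset p in [seq p <- iota 1 (size w).-1 |
     (nth 0 (map val w) p < nth 0 (map val w) p.-1)%N]]%fset.

(* The labels of the chains c_i^1, c_i^2, ... for the basis [B] = B_i. *)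
Definition descent_words S B : seq (seq 'I_l) :=
  sort lexle [seq w <- [seq basis_word s | s <- enum {perm 'I_#|B|}] | descent_set w == S].

(* The permutations that index the chains in C_i^j, [w] being the label of
   c_i^j. *)
Definition agreeing_chains S B w : {set {perm 'I_#|B|}} :=
  finset (fun s => [forall n : 'I_#|B|.+1, (val n \notin S) ==>
    (word_chain (basis_word s) n == word_chain w n)]).

Definition ear_poset_of S B w : {set L} :=
  finset (fun z => (z \in rank_selection L S) &&
    [exists s in agreeing_chains S B w,
       [exists n : 'I_#|B|.+1, z == word_chain (basis_word s) n]]).

(* B_i and the number of chains c_i^j; indices [i], [j] are counted from 0. *)
Definition nbcB (i : nat) : {set 'I_l} := nth fin0 nbc_bases i.

Definition nchains S (i : nat) : nat := size (descent_words S (nbcB i)).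

Definition ear_poset S (i j : nat) : {set L} :=
  ear_poset_of S (nbcB i) (nth [::] (descent_words S (nbcB i)) j).

Definition ear_facets S (i j : nat) : {set {set L}} :=
  finset (fun C => [&& C \in maximal_chains (ear_poset S i j),
    [forall n : 'I_j, C \notin maximal_chains (ear_poset S i n)] &
    [forall n : 'I_i, forall m : 'I_(nchains S n),
       C \notin maximal_chains (ear_poset S n m)]]).

Definition ear S (i j : nat) : {set {set L}} := generated_complex (ear_facets S i j).

Definition ears S : seq {set {set L}} :=
  [seq ear S i j | i <- iota 0 (size nbc_bases), j <- iota 0 (nchains S i)].

Definition nonempty_ears S : seq {set {set L}} := [seq K <- ears S | K != fin0].

End Matroid.

(* Main.v *)
Require Import Defs.
From mathcomp Require Import all_boot all_order all_algebra perm finmap reals.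
From mathcomp Require Import ring lra.
From mathcomp Require boolp classical_sets all_classical all_reals all_analysis.

(** Complete a chain [G] of [L_S] to a maximal chain of [L] by always adding the
    smallest possible atom towards the next element of [G].  The resulting
    "canonical" word orders an nbc-basis, and its blocks, sorted decreasingly,
    give a pair [(i, j)].  An exchange argument shows that [(i, j)] is the
    lexicographically first pair for which [G] is a face of the order complex of
    [L_i^j].  So a facet of that complex is new exactly when the word it
    determines is its own canonical word, which makes the covering and the
    boundary conditions combinatorial: a face of an ear is old iff some adjacent
    descent outside of it can be swapped so as to leave the set of new facets.

    [L_i^j] is the poset of prefixes of the block permutations of a word, a join
    of boundaries of barycentrically subdivided simplices.  It bounds the
    polytope spanned by the indicator vectors divided by their cut functions;
    the faces are chains because the cut function is strictly submodular.

    The new facets form an order ideal, hence their cone in the fan over this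
    polytope is star-shaped with respect to a generic interior point.  It is
    therefore the epigraph of a positively homogeneous piecewise linear function,
    whose link is a ball by an explicit radial projection. *)

Set Implicit Arguments.
Unset Strict Implicit.
Unset Printing Implicit Defensive.

Import Order.TTheory GRing.Theory Num.Theory.

(** * Words and lexicographic order *)

(** The polytope is the polar dual of a product of centered permutohedra, one for each block:
    maximal chains are the vertices of the product, block prefixes [A] its facet normals, and the
    number of cut pairs of [A] is the right-hand side of the facet inequality. Division by this
    number therefore puts the vertices of a chain on a common hyperplane.

    The obstacle is that an ear must be homeomorphic to a Euclidean ball. The word of an ear
    decreases in each block, so decreasing pairs of letters correspond to naturally ordered pairs of
    positions. A word that only gains such pairs keeps its minimal labels and its ascents at block
    ends; this closes the set of new facets under gaining natural pairs. Moving a point along the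
    vector with coordinate [- p] at position [p] also creates natural pairs and never destroys one,
    so every line in that direction meets the cone in a ray. The end points of these rays give the
    piecewise linear function from which the homeomorphism is built. *)

Section Sequences.
Implicit Types (T : eqType) (S : pred nat).

(** The hypothesis says that [P] holds on an initial segment of [w]: a letter before one in [P] is
    itself in [P]. *)
Lemma pairwise_filter_cat T (P : pred T) (w : seq T) :
  pairwise (fun c b => P b ==> P c) w ->
  w = [seq b <- w | P b] ++ [seq b <- w | ~~ P b].
Proof.
elim: w => //= x w IH /andP[hx /IH {}IH].
case: (boolP (P x)) hx => [Px _ | nPx hx] /=; first by rewrite -IH.
have h : all (fun b => ~~ P b) w by apply: sub_all hx => b; rewrite implybF.
rewrite (_ : [seq b <- w | P b] = [::]) /=; first by move/all_filterP: h => ->.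
by apply/eqP; rewrite -[_ == _]negbK -has_filter -all_predC.
Qed.

Lemma take_pairwise T (P : pred T) (w : seq T) :
  pairwise (fun c b => P b ==> P c) w -> take (count P w) w = [seq b <- w | P b].
Proof.
by move/pairwise_filter_cat => {2}->; rewrite take_size_cat // size_filter.
Qed.

Lemma count_mem_takel T (s : seq T) n : uniq s -> n <= size s ->
  count (mem (take n s)) s = n.
Proof.
move=> us hn; rewrite -{2}(cat_take_drop n s) count_cat.
have -> : count (mem (take n s)) (drop n s) = 0.
  apply/eqP; rewrite -leqn0 leqNgt -has_count.
  by move: us; rewrite -{1}(cat_take_drop n s) cat_uniq => /and3P[].
have : all (mem (take n s)) (take n s) by apply/allP.
by rewrite all_count => /eqP ->; rewrite size_takel // addn0.
Qed.

Lemma sorted_pairwise_closed T (leT : rel T) (P : pred T) (w : seq T) :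
  transitive leT -> sorted leT w ->
  (forall b c, b \in w -> c \in w -> leT c b -> P b -> P c) ->
  pairwise (fun c b => P b ==> P c) w.
Proof.
move=> tr; rewrite sorted_pairwise // => pw h.
apply: (sub_in_pairwise (P := mem w)) pw; last exact/allP.
by move=> c b cw bw /= cb; apply/implyP; apply: h.
Qed.

(* The positions outside [S] separate the blocks of a word, so two positions lie
   in the same block iff they have the same index. *)
Definition block_index S n := count (predC S) (iota 1 n).

Lemma block_indexS S n : block_index S n.+1 = block_index S n + ~~ S n.+1.
Proof.
have e : iota 1 n.+1 = iota 1 n ++ [:: n.+1] by rewrite -{1}[n.+1]addn1 iotaD add1n.
by rewrite /block_index e count_cat /= addn0.
Qed.

Lemma block_index_le S m n : m <= n -> block_index S m <= block_index S n.
Proof.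
move=> /subnK <-; elim: (n - m) => // k IH.
by rewrite addSn block_indexS; apply: leq_trans IH (leq_addr _ _).
Qed.

Lemma block_index_lt S m j n : ~~ S j -> m < j -> j <= n ->
  block_index S m < block_index S n.
Proof.
move=> Sj; case: j Sj => // j Sj mj jn; apply: leq_trans (block_index_le S jn).
by rewrite block_indexS Sj addn1 ltnS block_index_le.
Qed.

Lemma block_index_ltP S m n : block_index S m < block_index S n ->
  exists j, [/\ ~~ S j, m < j & j <= n].
Proof.
elim: n => [|n IH]; first by rewrite /block_index.
rewrite block_indexS; case: (boolP (S n.+1)) => [_|Sn h].
  by rewrite addn0 => /IH[j [j1 j2 j3]]; exists j; split=> //; apply: leqW.
exists n.+1; split=> //; rewrite ltnNge; apply/negP => mn.
by have := block_index_le S mn; rewrite leqNgt block_indexS Sn h.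
Qed.

(** The letter at position [n] is the only new member of the prefix of length [n.+1]. *)
Lemma eq_mem_take_inj T (u v : seq T) : uniq u -> uniq v -> size u = size v ->
  (forall n, take n u =i take n v) -> u = v.
Proof.
move=> uu uv s h.
suff H n : n <= size u -> take n u = take n v.
  by rewrite -(take_size u) H // s take_size.
elim: n => [|n IH] hn; first by rewrite !take0.
case: u uu s h IH hn => // x0 u uu s h IH hn.
rewrite !(take_nth x0) -?s // IH ?(ltnW hn) //; congr rcons.
have := h n.+1 (nth x0 (x0 :: u) n); rewrite !(take_nth x0) -?s // !mem_rcons.
rewrite !inE eqxx /= -IH ?(ltnW hn) // => /esym/predU1P[] // h2.
have := h2; rewrite in_take ?mem_nth // index_uniq // ltnn //.
Qed.

End Sequences.

Section Lexicographic.
Variable l : nat.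
Implicit Types (s t p : seq 'I_l) (x y : 'I_l).

Lemma lexle_total : total (@lexle l).
Proof. by move=> s t; apply: le_total. Qed.

Lemma lexle_trans : transitive (@lexle l).
Proof. by move=> s t u; apply: le_trans. Qed.

Lemma lexle_anti : antisymmetric (@lexle l).
Proof. by move=> s t; apply: le_anti. Qed.

Lemma lexle_cat p s t x y : (x < y)%N -> lexle (p ++ x :: s) (p ++ y :: t).
Proof.
move=> xy; elim: p => [|z p IH] /=.
  by rewrite /lexle lexi_cons !leEord (ltnW xy) leqNgt xy.
by rewrite /lexle lexi_cons lexx; apply: IH.
Qed.

Lemma first_difference s t : size s = size t -> s != t ->
  exists p x y s' t', [/\ s = p ++ x :: s', t = p ++ y :: t' & x != y].
Proof.
elim: s t => [|x s IH] [|y t] // [e] h.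
case: (eqVneq x y) h => [-> |xy _]; last by exists [::], x, y, s, t.
rewrite eqseq_cons eqxx => /(IH _ e)[p [x' [y' [s' [t' [-> -> h]]]]]].
by exists (y :: p), x', y', s', t'.
Qed.

Lemma lexle_first_difference s t : size s = size t ->
  (forall p x y s' t', s = p ++ x :: s' -> t = p ++ y :: t' -> x != y -> (x < y)%N) ->
  lexle s t.
Proof.
move=> e h; case: (eqVneq s t) => [-> |st]; first by case/orP: (lexle_total t t).
have [p [x [y [s' [t' [es et xy]]]]]] := first_difference e st.
by rewrite es et; apply: lexle_cat; apply: h es et xy.
Qed.

Lemma sorted_lexle_index (T : eqType) (f : T -> seq 'I_l) (x0 : T) (s : seq T) i j :
  {in s &, injective f} -> uniq s -> sorted (relpre f (@lexle l)) s ->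
  i < size s -> j < size s -> lexle (f (nth x0 s i)) (f (nth x0 s j)) -> i <= j.
Proof.
move=> fi us ss hi hj h; rewrite leqNgt; apply/negP => ji.
have tr : transitive (relpre f (@lexle l)) by move=> b c d; apply: lexle_trans.
have /= h2 := sorted_ltn_nth tr x0 ss j i hj hi ji.
have e : f (nth x0 s i) = f (nth x0 s j) by apply: lexle_anti; rewrite h.
by move/eqP: (fi _ _ (mem_nth x0 hi) (mem_nth x0 hj) e); rewrite nth_uniq // gtn_eqF.
Qed.

Lemma enum_ord_sorted (B : {set 'I_l}) : sorted ltn (map val (enum B)).
Proof.
rewrite /enum_mem -enumT sorted_map; apply: sorted_filter.
  by move=> x y z; apply: ltn_trans.
by rewrite -sorted_map val_enum_ord iota_ltn_sorted.
Qed.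

(** At a first difference where [C] has the smaller letter [y], this letter is missing from [B],
    while all letters of [B] below [y] lie in the common prefix and hence in [C]. The hypothesis
    forbids exactly this. *)
Lemma lexle_enum (B C : {set 'I_l}) : #|B| = #|C| ->
  (forall c, c \in C -> c \notin B -> (forall i : 'I_l, (i < c)%N -> i \in B -> i \in C) -> False) ->
  lexle (enum B) (enum C).
Proof.
move=> e h; apply: lexle_first_difference; first by rewrite -!cardE.
move=> p x y s t eB eC xy; rewrite ltnNge leq_eqVlt eq_sym (inj_eq val_inj) (negbTE xy).
apply/negP => /= yx.
have := enum_ord_sorted B; rewrite sorted_map eB => /= sB.
have tr : transitive (relpre (@nat_of_ord l) ltn) by move=> ? ? ?; apply: ltn_trans.
move: sB; rewrite sorted_pairwise // pairwise_cat /= => /and4P[pB _ xB _].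
have yp : y \notin p.
  have := enum_uniq C; rewrite eC cat_uniq => /and3P[_ /hasPn/(_ y) /= hh _].
  by apply: hh; rewrite mem_head.
have yC : y \in C by rewrite -mem_enum eC mem_cat mem_head orbT.
have low i : i \in B -> (i < x)%N -> i \in p.
  rewrite -mem_enum eB mem_cat inE => /or3P[//|/eqP ->|]; first by rewrite ltnn.
  by move/(allP xB) => /= xi ix; have := ltn_trans xi ix; rewrite ltnn.
apply: (h y yC) => [|i iy iB]; first by apply: contra yp => yB; apply: low.
by rewrite -mem_enum eC mem_cat low // (ltn_trans iy).
Qed.

End Lexicographic.

(** * Chains of block prefixes *)

Section BlockModel.
Variables (V : finType) (r : nat) (blk : 'I_r -> nat).
Variables (supp : V -> {set 'I_r}) (X : {set V}).
Implicit Types (A B : {set 'I_r}) (G : {set V}) (p q : 'I_r) (v : V).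

(** The number of these pairs is the cut function of the disjoint union of the complete graphs on
    the blocks. *)
Definition cut_pairs A : {set 'I_r * 'I_r} :=
  [set pq | [&& blk pq.1 == blk pq.2, pq.1 \in A & pq.2 \notin A]].

Definition down_closed A := [forall p in A, forall q, (blk q < blk p) ==> (q \in A)].

(** Such a set consists of all blocks before some block and a nonempty proper subset of that
    block. *)
Definition admissible A := (cut_pairs A != finset.set0) && down_closed A.

Definition supp_chain G :=
  (G \subset X) && [forall v in G, forall w in G, (supp v \subset supp w) || (supp w \subset supp v)].

Definition separates G p q := [exists v in G, (p \in supp v) && (q \notin supp v)].

Hypothesis supp_adm : forall v, v \in X -> admissible (supp v).
Hypothesis supp_inj : {in X &, injective supp}.
Hypothesis supp_surj : forall A, admissible A -> exists2 v, v \in X & supp v = A.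

Lemma cutP A p q : ((p, q) \in cut_pairs A) = [&& blk p == blk q, p \in A & q \notin A].
Proof. by rewrite inE. Qed.

Lemma supp_chainP G : reflect (G \subset X /\ forall v w, v \in G -> w \in G ->
  (supp v \subset supp w) || (supp w \subset supp v)) (supp_chain G).
Proof.
apply: (iffP andP) => -[GX h]; split=> //.
  by move=> v w vG wG; move/forall_inP: h => /(_ v vG)/forall_inP/(_ w wG).
by apply/forall_inP => v vG; apply/forall_inP => w wG; apply: h.
Qed.

Lemma separatesP G p q :
  reflect (exists2 v, v \in G & (p \in supp v) && (q \notin supp v)) (separates G p q).
Proof. exact: exists_inP. Qed.

Lemma supp_down v p q : v \in X -> p \in supp v -> (blk q < blk p)%N -> q \in supp v.
Proof.
by move=> /supp_adm/andP[_ /forall_inP h] /h/forallP/(_ q)/implyP.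
Qed.

Lemma mem_supp_block v p0 q0 q : v \in X -> (p0, q0) \in cut_pairs (supp v) ->
  (q \in supp v) = if blk q == blk p0 then q \in supp v else (blk q < blk p0)%N.
Proof.
move=> vX; rewrite cutP => /and3P[/eqP b0 pv qv].
case: ltngtP => // bq; first exact: (supp_down vX pv).
by apply/negP => h2; have := supp_down vX h2 (q := q0); rewrite -b0 bq (negbTE qv) => /(_ isT).
Qed.

Lemma separates_asym G p q : supp_chain G -> separates G p q -> ~~ separates G q p.
Proof.
move=> /supp_chainP[_ ch] /separatesP[v vG /andP[pv qv]].
apply/negP => /separatesP[w wG /andP[qw pw]].
case/orP: (ch v w vG wG) => /subsetP h; first by rewrite h in pw.
by rewrite h in qv.
Qed.

(** The chain must contain a set with the same trace as [supp v] on the cut block, and the trace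
    determines an admissible set. This is the equality case for the supporting functionals and the
    source of uniqueness for the decomposition of points. *)
Lemma mem_of_separates G v : supp_chain G -> v \in X ->
  (forall p q, (p, q) \in cut_pairs (supp v) -> separates G p q) -> v \in G.
Proof.
move=> /supp_chainP[GX ch] vX h.
have /andP[/set0Pn[[p0 q0] h0] _] := supp_adm vX.
have := h0; rewrite cutP => /and3P[/eqP b0 p0v q0v].
pose P g := [forall p, ((blk p == blk p0) && (p \in supp v)) ==> (p \in supp g)].
have PP g p : P g -> blk p = blk p0 -> p \in supp v -> p \in supp g.
  by move/forallP/(_ p)/implyP => hh e pv; apply: hh; rewrite e eqxx.
(* For fixed [q], the largest member of [G] that omits [q] contains every member that separates some
   [p] from [q], hence the whole trace of [supp v]. *)
have step q : blk q = blk q0 -> q \notin supp v ->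
    exists2 g, g \in G & P g && (q \notin supp g).
  move=> bq qv.
  have /separatesP[g0 g0G /andP[_ qg0]] : separates G p0 q.
    by apply: h; rewrite cutP b0 bq eqxx p0v.
  have Q0 : (g0 \in G) && (q \notin supp g0) by rewrite g0G.
  case: (@arg_maxnP _ g0 (fun g => (g \in G) && (q \notin supp g)) (fun g => #|supp g|) Q0).
  move=> g /andP[gG qg] gmax; exists g; rewrite ?qg ?andbT //.
  apply/forallP => p; apply/implyP => /andP[/eqP bp pv].
  have /separatesP[k kG /andP[pk qk]] : separates G p q.
    by apply: h; rewrite cutP bp b0 bq eqxx pv.
  have := gmax k; rewrite kG qk => /(_ isT) le.
  case/orP: (ch g k gG kG) => [gk|/subsetP kg]; last exact: kg.
  have /eqP -> // : supp g == supp k by rewrite eqEcard gk.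
have [g1 g1G /andP[Pg1 _]] := step q0 (erefl _) q0v.
have Q1 : (g1 \in G) && P g1 by rewrite g1G.
(* Dually, the smallest member that contains the trace omits every such [q]. *)
case: (@arg_minnP _ g1 (fun g => (g \in G) && P g) (fun g => #|supp g|) Q1).
move=> g /andP[gG Pg] gmin.
have notin q : blk q = blk q0 -> q \notin supp v -> q \notin supp g.
  move=> bq qv; have [k kG /andP[Pk qk]] := step q bq qv.
  have := gmin k; rewrite kG Pk => /(_ isT) le.
  case/orP: (ch g k gG kG) => [/subsetP gk|kg]; first by apply: contra qk => /gk.
  by have /eqP <- : supp k == supp g by rewrite eqEcard kg.
have gX : g \in X by apply: (subsetP GX).
suff e : supp g = supp v by rewrite -(supp_inj gX vX e).
have hg : (p0, q0) \in cut_pairs (supp g) by rewrite cutP b0 eqxx (PP g p0) ?notin.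
apply/setP => q; rewrite (mem_supp_block q gX hg) (mem_supp_block q vX h0).
case: eqP => // bq; case: (boolP (q \in supp v)) => qv; first exact: PP.
by apply/negbTE/notin; rewrite // bq.
Qed.

(** The pair [(p, q)] crosses [A] but neither the intersection nor the union, which makes the
    inequality strict. *)
Lemma cut_submodular A B p q : blk p = blk q -> p \in A -> p \notin B -> q \in B -> q \notin A ->
  (#|cut_pairs (A :&: B)| + #|cut_pairs (A :|: B)| < #|cut_pairs A| + #|cut_pairs B|)%N.
Proof.
move=> bpq pA pB qB qA; rewrite -(cardsUI (cut_pairs A)) -(cardsUI (cut_pairs (A :&: B))).
rewrite -addSn leq_add //; last first.
  apply/subset_leq_card/subsetP => -[x y]; rewrite !(inE, cutP) /=.
  by case: (x \in A); case: (x \in B); case: (y \in A); case: (y \in B); case: (_ == _).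
apply: proper_card; apply/properP; split.
  apply/subsetP => -[x y]; rewrite !(inE, cutP) /=.
  by case: (x \in A); case: (x \in B); case: (y \in A); case: (y \in B); case: (_ == _).
exists (p, q); first by rewrite inE cutP bpq eqxx pA qA.
by rewrite in_setU !cutP !inE (negbTE pB) (negbTE qA) qB !andbF.
Qed.

(** Witnesses of incomparability in different blocks would contradict down-closedness. *)
Lemma incomparable_block A B : down_closed A -> down_closed B ->
  ~~ (A \subset B) -> ~~ (B \subset A) ->
  exists p q, [/\ blk p = blk q, p \in A, p \notin B, q \in B & q \notin A].
Proof.
move=> /forall_inP dA /forall_inP dB /subsetPn[p pA pB] /subsetPn[q qB qA].
exists p, q; split=> //; case: (ltngtP (blk p) (blk q)) => // h.
  by have := dB q qB => /forallP/(_ p)/implyP/(_ h); rewrite (negbTE pB).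
by have := dA p pA => /forallP/(_ q)/implyP/(_ h); rewrite (negbTE qA).
Qed.

Lemma down_closedI A B : down_closed A -> down_closed B -> down_closed (A :&: B).
Proof.
move=> /forall_inP dA /forall_inP dB; apply/forall_inP => p /setIP[pA pB].
apply/forallP => q; apply/implyP => h; rewrite inE.
by rewrite (implyP (forallP (dA p pA) q) h) (implyP (forallP (dB p pB) q) h).
Qed.

Lemma down_closedU A B : down_closed A -> down_closed B -> down_closed (A :|: B).
Proof.
move=> /forall_inP dA /forall_inP dB; apply/forall_inP => p /setUP[pA|pA];
apply/forallP => q; apply/implyP => h; rewrite inE.
  by rewrite (implyP (forallP (dA p pA) q) h).
by rewrite (implyP (forallP (dB p pA) q) h) orbT.
Qed.

(* The last element of each block serves as the origin of the coordinates that
   the other elements of the block define. *)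
Definition nonlast : {set 'I_r} := [set p | [exists q, (blk q == blk p) && (p < q)%N]].

Definition block_last p : 'I_r := [arg max_(q > p | blk q == blk p) q].

Lemma block_lastP p : blk (block_last p) = blk p /\ forall q, blk q = blk p -> (q <= block_last p)%N.
Proof.
rewrite /block_last; case: arg_maxnP => // q /eqP bq h; split=> // q' bq'.
by apply: h; rewrite bq'.
Qed.

Lemma blk_last p : blk (block_last p) = blk p.
Proof. by case: (block_lastP p). Qed.

Lemma block_last_eq p q : blk p = blk q -> block_last p = block_last q.
Proof.
move=> e; have [b1 h1] := block_lastP p; have [b2 h2] := block_lastP q.
by apply/val_inj/eqP; rewrite eqn_leq h2 ?h1 // ?b1 ?b2 ?e.
Qed.

Lemma nonlastP p : (p \in nonlast) = (block_last p != p).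
Proof.
rewrite inE; apply/existsP/idP => [[q /andP[/eqP bq pq]]|h].
  apply/eqP => e; have [_ /(_ q bq)] := block_lastP p.
  by rewrite e leqNgt pq.
exists (block_last p); rewrite blk_last eqxx /= ltn_neqAle.
have [_ h2] := block_lastP p; rewrite h2 // andbT.
by apply: contra h => /eqP/val_inj <-.
Qed.

Lemma block_last_nonlast p : block_last p \notin nonlast.
Proof. by rewrite nonlastP negbK; apply/eqP/block_last_eq/blk_last. Qed.

Lemma block_lastK p : p \notin nonlast -> block_last p = p.
Proof. by rewrite nonlastP negbK => /eqP. Qed.

(** * The polytope *)

Section Geometry.
Import boolp classical_sets reals.
Local Open Scope ring_scope.
Variable R : realType.

(** * Convex hulls and dual systems of functionals *)

Section Convexity.
Variable d : nat.
Implicit Types (c x y : 'rV[R]_d).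

Lemma dotpD c x y : dotp c (x + y) = dotp c x + dotp c y.
Proof. by rewrite /dotp -big_split; apply: eq_bigr => i _; rewrite mxE mulrDr. Qed.

Lemma dotpZ c k x : dotp c (k *: x) = k * dotp c x.
Proof. by rewrite /dotp mulr_sumr; apply: eq_bigr => i _; rewrite mxE mulrCA. Qed.

Lemma dotp0 c : dotp c 0 = 0.
Proof. by rewrite -(scale0r (0 : 'rV[R]_d)) dotpZ mul0r. Qed.

Lemma dotp_sum c (I : Type) (s : seq I) (P : pred I) (F : I -> 'rV[R]_d) :
  dotp c (\sum_(i <- s | P i) F i) = \sum_(i <- s | P i) dotp c (F i).
Proof.
elim: s => [|i s IH]; first by rewrite !big_nil dotp0.
by rewrite !big_cons; case: (P i); rewrite // dotpD IH.
Qed.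

Lemma dotpBl c c' x : dotp (c - c') x = dotp c x - dotp c' x.
Proof. by rewrite /dotp -sumrB; apply: eq_bigr => i _; rewrite !mxE mulrBl. Qed.

Lemma convex_hull_mapP (I : eqType) (s : seq I) (g : I -> 'rV[R]_d) x : uniq s ->
  convex_hull [seq g i | i <- s] x <->
  exists mu : I -> R, [/\ forall i, 0 <= mu i, \sum_(i <- s) mu i = 1 &
    x = \sum_(i <- s) mu i *: g i].
Proof.
move=> us; split=> [[w [w0 w1 ->]]|[mu [m0 m1 ->]]]; last first.
  case: s us m1 => [|i0 s] us m1.
    by exists (fun=> 0); split=> //; rewrite ?big_ord0 -?m1 ?big_nil // big_ord0.
  exists (fun k => mu (nth i0 (i0 :: s) k)); split=> //.
    by rewrite -m1 (big_nth i0) big_mkord size_map.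
  rewrite (big_nth i0) big_mkord size_map; apply: eq_bigr => k _.
  by rewrite (nth_map i0).
case: s us w w0 w1 => [|i0 s] us w w0 w1.
  by exists (fun=> 0); split=> //; rewrite -?w1 !(big_nil, big_ord0).
set t := i0 :: s in us w w0 w1 *.
pose mu i := \sum_(k < size [seq g i | i <- t] | nth i0 t k == i) w k.
have key (U : lmodType R) (F : I -> U) :
    \sum_(i <- t) mu i *: F i = \sum_k w k *: F (nth i0 t k).
  transitivity (\sum_(i <- t) \sum_(k < size [seq g i | i <- t] | nth i0 t k == i) w k *: F i).
    by apply: eq_bigr => i _; rewrite scaler_suml.
  rewrite (exchange_big_dep xpredT) //=; apply: eq_bigr => k _.
  have kt : nth i0 t k \in t by apply: mem_nth; rewrite -(size_map g).
  rewrite big_mkcond (bigD1_seq (nth i0 t k)) //= eqxx big1 ?addr0 // => i h.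
  by rewrite eq_sym (negbTE h).
exists mu; split.
- by move=> i; apply: sumr_ge0.
- have e : \sum_(i <- t) mu i * 1 = \sum_k w k * 1 := key R^o (fun=> 1).
  by move: e; rewrite -!mulr_suml !mulr1 w1.
- rewrite key; apply: eq_bigr => k _; rewrite (nth_map i0) //.
  by rewrite -(size_map g).
Qed.

Lemma free_dual (I : eqType) (s : seq I) (g c : I -> 'rV[R]_d) : uniq s ->
  (forall i j, i \in s -> j \in s -> i != j -> dotp (c i) (g j) = 0) ->
  (forall i, i \in s -> dotp (c i) (g i) != 0) -> free [seq g i | i <- s].
Proof.
move=> us h0 h1; apply/(freeP (X := in_tuple [seq g i | i <- s])) => k /= e i.
have i0 : I by case: s i {us h0 h1 k e} => [|x s] i; [case: i|exact: x].
have hs (j : 'I_(size [seq g i | i <- s])) : (j < size s)%N by rewrite -(size_map g).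
have := congr1 (dotp (c (nth i0 s i))) e; rewrite dotp0 dotp_sum (bigD1 i) //= big1 ?addr0.
  rewrite (nth_map i0) // dotpZ => /eqP; rewrite mulf_eq0 (negbTE (h1 _ _)) ?orbF ?mem_nth //.
  by move/eqP.
move=> j ji; rewrite (nth_map i0) // dotpZ h0 ?mulr0 ?mem_nth // nth_uniq //.
by rewrite eq_sym; apply: contra ji.
Qed.

(** The functionals vanish at the base point, so subtracting it preserves the dual system. *)
Lemma affinely_independent_dual (I : eqType) x (s : seq I) (g c : I -> 'rV[R]_d) : uniq s ->
  (forall i, i \in s -> dotp (c i) x = 0) ->
  (forall i j, i \in s -> j \in s -> i != j -> dotp (c i) (g j) = 0) ->
  (forall i, i \in s -> dotp (c i) (g i) != 0) ->
  affinely_independent (x :: [seq g i | i <- s]).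
Proof.
move=> us hx h0 h1; rewrite /affinely_independent -map_comp.
have hB i y : i \in s -> dotp (c i) (y - x) = dotp (c i) y.
  by move=> si; rewrite -scaleN1r dotpD dotpZ hx // mulr0 addr0.
apply: (@free_dual _ _ (fun i => g i - x) c) => //.
  by move=> i j si sj ij; rewrite hB // h0.
by move=> i si; rewrite hB // h1.
Qed.

Lemma affinely_independent_dual_map (I : eqType) (s : seq I) (g c : I -> 'rV[R]_d) : uniq s ->
  (forall i j, i \in s -> j \in s -> i != j -> dotp (c i) (g j) = 0) ->
  (forall i, i \in s -> dotp (c i) (g i) != 0) ->
  affinely_independent [seq g i | i <- s].
Proof.
case: s => [|x s] //= /andP[xs us] h0 h1; apply: (affinely_independent_dual (c := c) us).
- move=> i si; apply: h0; rewrite ?mem_head ?inE ?si ?orbT //.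
  by apply: contraNneq xs => <-.
- by move=> i j si sj; apply: h0; rewrite inE ?si ?sj orbT.
- by move=> i si; apply: h1; rewrite inE si orbT.
Qed.

End Convexity.

Local Notation d := #|nonlast|.

Definition coords (x : 'I_r -> R) : 'rV[R]_d :=
  \row_k (x (enum_val k) - x (block_last (enum_val k))).

Definition indicator A p : R := (p \in A)%:R.

(** These functionals vanish on block-constant functions, so they descend to the quotient on which
    [coords] gives coordinates. *)
Definition block_null (c : 'I_r -> R) := forall p, \sum_(q | blk q == blk p) c q = 0.

Lemma dot_coords (c x : 'I_r -> R) : block_null c ->
  dotp (\row_k c (enum_val k)) (coords x) = \sum_p c p * x p.
Proof.
move=> c0; rewrite /dotp.
transitivity (\sum_(p in nonlast) c p * (x p - x (block_last p))).
  by rewrite [RHS]big_enum_val; apply: eq_bigr => k _; rewrite !mxE.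
transitivity (\sum_p c p * (x p - x (block_last p))).
  rewrite [RHS](bigID (mem nonlast)) /= [X in _ = _ + X]big1 ?addr0 // => p hp.
  by rewrite block_lastK // subrr mulr0.
under eq_bigr => p _ do rewrite mulrBr.
rewrite sumrB [X in _ - X](_ : _ = 0) ?subr0 //.
rewrite (partition_big block_last xpredT) //= big1 // => q _.
rewrite (eq_bigr (fun p => c p * x q)) => [|p /eqP -> //].
rewrite -mulr_suml; case: (pickP (fun p => block_last p == q)) => [p0 /eqP e0|h].
  rewrite (eq_bigl (fun p => blk p == blk p0)) ?c0 ?mul0r // => p.
  apply/eqP/eqP => [e|/block_last_eq ->//].
  by rewrite -(blk_last p) e -e0 blk_last.
by rewrite big_pred0 // mul0r.
Qed.

Lemma coordsD x y : coords (fun p => x p + y p) = coords x + coords y.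
Proof. by apply/rowP => k; rewrite !mxE; ring. Qed.

Lemma eq_coords x y : x =1 y -> coords x = coords y.
Proof. by move=> h; apply/rowP => k; rewrite !mxE !h. Qed.

Lemma coords_indicator0 A : cut_pairs A = finset.set0 -> coords (indicator A) = 0.
Proof.
move=> cA; apply/rowP => k; rewrite !mxE /indicator; set p := enum_val k.
have h p' q' : blk p' = blk q' -> p' \in A -> q' \in A.
  move=> e pA; apply/negPn/negP => qA; have := finset.in_set0 (p', q').
  by rewrite -cA cutP e eqxx pA qA.
suff -> : (p \in A) = (block_last p \in A) by rewrite subrr.
by apply/idP/idP; apply: h; rewrite blk_last.
Qed.

Lemma coords_indicatorIU A B :
  coords (indicator (A :&: B)) + coords (indicator (A :|: B)) =
  coords (indicator A) + coords (indicator B).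
Proof.
rewrite -!coordsD; apply: eq_coords => p; rewrite /indicator !inE.
by case: (p \in A); case: (p \in B); rewrite /= ?addr0 ?add0r.
Qed.

Definition chain_sign G p q : R := (separates G p q)%:R - (separates G q p)%:R.

(** The number of elements of the block that [G] puts after [p] minus the number that it puts before
    [p]. For a maximal chain these are the coordinates of a vertex of the centered permutohedron of
    the block. *)
Definition chain_weight G p : R := \sum_(q | blk q == blk p) chain_sign G p q.

Definition chain_functional G : 'rV[R]_d := \row_k chain_weight G (enum_val k).

Lemma chain_sign_sum_block G A p0 :
  \sum_(p in A | blk p == blk p0) \sum_(q in A | blk q == blk p0) chain_sign G p q = 0.
Proof.
set s := LHS; have : s = - s.
  rewrite {1}/s exchange_big /= /s -sumrN; apply: eq_bigr => p _.
  by rewrite -sumrN; apply: eq_bigr => q _; rewrite /chain_sign opprB.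
by move/eqP; rewrite -addr_eq0 -mulr2n mulrn_eq0 => /eqP.
Qed.

Lemma chain_weight_null G : block_null (chain_weight G).
Proof.
move=> p; rewrite -[RHS](chain_sign_sum_block G finset.setT p).
apply: eq_big => [q|q /eqP bq]; first by rewrite inE.
by apply: eq_big => // q'; rewrite inE bq.
Qed.

(* The pairs inside [A] cancel by antisymmetry, so that the functional of a chain
   counts the cut pairs that the chain separates. *)
Lemma chain_functional_coords G A :
  dotp (chain_functional G) (coords (indicator A)) =
  \sum_(pq in cut_pairs A) chain_sign G pq.1 pq.2.
Proof.
rewrite dot_coords; last exact: chain_weight_null.
transitivity (\sum_(p in A) chain_weight G p).
  rewrite [RHS]big_mkcond; apply: eq_bigr => p _; rewrite /indicator.
  by case: (p \in A); rewrite ?mulr1 ?mulr0.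
transitivity (\sum_(p in A) \sum_(q | (blk q == blk p) && (q \notin A)) chain_sign G p q +
  \sum_(p in A) \sum_(q | (blk q == blk p) && (q \in A)) chain_sign G p q).
  rewrite -big_split; apply: eq_bigr => p _ /=.
  by rewrite addrC /chain_weight (bigID (mem A)).
rewrite [X in _ + X](_ : _ = 0) ?addr0; last first.
  rewrite (partition_big block_last xpredT) //= big1 // => q0 _.
  case: (pickP (fun p => block_last p == q0)) => [p0 /eqP e0|h]; last first.
    by rewrite big_pred0 // => p; rewrite h andbF.
  rewrite -[RHS](chain_sign_sum_block G A p0).
  have eb p : (block_last p == q0) = (blk p == blk p0).
    apply/eqP/eqP => [e|/block_last_eq ->//].
    by rewrite -(blk_last p) e -e0 blk_last.
  apply: eq_big => [p|p /andP[_ hp]]; first by rewrite eb.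
  by apply: eq_bigl => q; rewrite andbC; move: hp; rewrite eb => /eqP ->.
rewrite pair_big_dep /=; apply: eq_bigl => -[p q]; rewrite cutP /=.
by rewrite eq_sym; case: (p \in A); rewrite ?andbF.
Qed.

Definition vertex v : 'rV[R]_d := (#|cut_pairs (supp v)|%:R)^-1 *: coords (indicator (supp v)).

Lemma card_cut_gt0 v : v \in X -> 0 < #|cut_pairs (supp v)|%:R :> R.
Proof. by move/supp_adm/andP => [h _]; rewrite ltr0n card_gt0. Qed.

Lemma chain_functional_vertex G v : supp_chain G -> v \in G ->
  dotp (chain_functional G) (vertex v) = 1.
Proof.
move=> cG vG; have /supp_chainP[/fintype.subsetP GX _] := cG.
have C0 := card_cut_gt0 (GX v vG).
rewrite dotpZ chain_functional_coords (eq_bigr (fun=> 1)) => [|[p q] /=].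
  by rewrite sumr_const -mulr_natl mulr1 mulVf // gt_eqF.
rewrite cutP => /and3P[_ pv qv].
have s : separates G p q by apply/separatesP; exists v; rewrite ?pv.
by rewrite /chain_sign s (negbTE (separates_asym cG s)) subr0.
Qed.

(** By [mem_of_separates] some cut pair of [supp v] is not separated by [G], so the count stays
    below the number by which the vertex is divided. *)
Lemma chain_functional_vertex_lt G v : supp_chain G -> v \in X -> v \notin G ->
  dotp (chain_functional G) (vertex v) < 1.
Proof.
move=> cG vX vG; have C0 := card_cut_gt0 vX.
rewrite dotpZ chain_functional_coords mulrC ltr_pdivrMr // mul1r.
apply: (@le_lt_trans _ _ (\sum_(pq in cut_pairs (supp v)) (separates G pq.1 pq.2)%:R)).
  by apply: ler_sum => pq _; rewrite /chain_sign lerBlDr lerDl ler0n.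
rewrite -natr_sum ltr_nat -big_mkcondr /= sum1_card.
have [/existsP[[p q] /andP[h1 h2]]|h] :=
    boolP [exists pq, (pq \in cut_pairs (supp v)) && ~~ separates G pq.1 pq.2].
  apply: proper_card; apply/properP; split.
    by apply/fintype.subsetP => x /andP[].
  exists (p, q) => //; apply/negP => /andP[_ h3]; by rewrite h3 in h2.
case/negP: vG; apply: (mem_of_separates cG vX) => p q pq.
move/existsPn: h => /(_ (p, q)); by rewrite pq negbK.
Qed.

Lemma chain_functional_vertex_le G v : supp_chain G -> v \in X ->
  dotp (chain_functional G) (vertex v) <= 1.
Proof.
move=> cG vX; have [vG|vG] := boolP (v \in G); first by rewrite chain_functional_vertex.
exact/ltW/chain_functional_vertex_lt.
Qed.

(** At the vertices of [G] other than [v] both functionals equal 1, and at [v] only the first does;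
    this gives a dual system for the vertices of [G]. *)
Definition dual_functional G v : 'rV[R]_d :=
  chain_functional G - chain_functional (G :\ v).

Lemma supp_chain_sub G G' : G' \subset G -> supp_chain G -> supp_chain G'.
Proof.
move=> /[dup] G'G /fintype.subsetP sub /supp_chainP[GX ch]; apply/supp_chainP; split.
  exact: fintype.subset_trans GX.
by move=> v w /sub vG /sub; apply: ch.
Qed.

Lemma dual_functional0 G v w : supp_chain G -> v \in G -> w \in G -> v != w ->
  dotp (dual_functional G v) (vertex w) = 0.
Proof.
move=> cG vG wG vw; have cG' := supp_chain_sub (subsetDl G [set v]%SET) cG.
rewrite dotpBl !chain_functional_vertex ?subrr //.
by rewrite in_setD1 eq_sym vw.
Qed.

Lemma dual_functional_gt0 G v : supp_chain G -> v \in G ->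
  0 < dotp (dual_functional G v) (vertex v).
Proof.
move=> cG vG; have cG' := supp_chain_sub (subsetDl G [set v]%SET) cG.
have /supp_chainP[/fintype.subsetP GX _] := cG.
rewrite dotpBl chain_functional_vertex // subr_gt0.
by apply: chain_functional_vertex_lt; rewrite ?GX // in_setD1 eqxx.
Qed.

Lemma vertex_inj : {in X &, injective vertex}.
Proof.
move=> v w vX wX e; apply/eqP; apply/negPn/negP => vw.
have cv : supp_chain [set v]%SET.
  apply/supp_chainP; split; first by rewrite finset.sub1set.
  by move=> x y /set1P -> /set1P ->; rewrite subxx.
have := chain_functional_vertex cv (set11 v); rewrite e => h.
have wv : w \notin [set v]%SET by rewrite finset.in_set1 eq_sym.
by have := chain_functional_vertex_lt cv wX wv; rewrite h ltxx.
Qed.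

(** With the origin in the list, membership asks only for coefficients of sum at most 1, and the
    hull is a point when [X] is empty. *)
Definition polytope : set 'rV[R]_d := convex_hull (0 :: [seq vertex v | v <- enum X]).

Definition hull G : set 'rV[R]_d := convex_hull [seq vertex v | v <- enum G].

Lemma hullP G x : hull G x <-> exists mu : V -> R,
  [/\ forall v, 0 <= mu v, \sum_(v in G) mu v = 1 & x = \sum_(v in G) mu v *: vertex v].
Proof.
split.
  case/(convex_hull_mapP _ _ (enum_uniq _)) => mu [m0 m1 ->].
  by exists mu; split=> //; rewrite -?m1 big_enum.
case=> mu [m0 m1 ->]; apply/convex_hull_mapP; first exact: enum_uniq.
by exists mu; split=> //; rewrite ?big_enum.
Qed.

Lemma polytopeP x : polytope x <-> exists mu : V -> R,
  [/\ forall v, 0 <= mu v, \sum_(v in X) mu v <= 1 & x = \sum_(v in X) mu v *: vertex v].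
Proof.
pose g o := if o is Some v then vertex v else 0.
pose s := None :: map Some (enum X).
have us : uniq s.
  rewrite /= map_inj_uniq ?enum_uniq ?andbT //; last by move=> ? ? [].
  by apply/mapP => -[].
have e : 0 :: [seq vertex v | v <- enum X] = [seq g i | i <- s] by rewrite /= -map_comp.
rewrite /polytope e; split.
  case/(convex_hull_mapP _ _ us) => mu [m0]; rewrite /s !big_cons !big_map !big_enum /= => m1 ->.
  exists (mu \o Some); split=> [v|/=|]; [exact: m0| |by rewrite scaler0 add0r].
  by rewrite -m1 lerDr.
case=> mu [m0 m1 ->]; apply/convex_hull_mapP => //.
exists (fun o => if o is Some v then mu v else 1 - \sum_(v in X) mu v).
split.
- by case=> [v|]; [exact: m0|rewrite subr_ge0].
- by rewrite /s big_cons big_map big_enum /= subrK.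
- by rewrite /s big_cons big_map big_enum /= scaler0 add0r.
Qed.

Lemma polytope0 : polytope 0.
Proof.
apply/polytopeP; exists (fun=> 0); split=> //; first by rewrite big1 // ler01.
by rewrite big1 // => v _; rewrite scale0r.
Qed.

Lemma polytope_vertex v : v \in X -> polytope (vertex v).
Proof.
move=> vX; apply/polytopeP; exists (fun w => (w == v)%:R); split=> //.
- by rewrite (bigD1 v) //= eqxx big1 ?addr0 // => w /andP[_ /negbTE ->].
- rewrite (bigD1 v) //= eqxx scale1r big1 ?addr0 // => w /andP[_ /negbTE ->].
  by rewrite scale0r.
Qed.

Lemma hull_vertex G v : v \in G -> hull G (vertex v).
Proof.
move=> vG; apply/hullP; exists (fun w => (w == v)%:R); split=> //.
- by rewrite (bigD1 v) //= eqxx big1 ?addr0 // => w /andP[_ /negbTE ->].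
- rewrite (bigD1 v) //= eqxx scale1r big1 ?addr0 // => w /andP[_ /negbTE ->].
  by rewrite scale0r.
Qed.

(** Complementing [supp v] inside the cut block negates the indicator modulo block-constant
    functions. It follows that no proper face passes through the origin. *)
Lemma opposite_vertex v : v \in X -> exists2 w, w \in X & exists2 k : R, 0 < k & vertex w = - k *: vertex v.
Proof.
move=> vX; have /andP[/finset.set0Pn[[p q] pq] _] := supp_adm vX.
have hb := mem_supp_block _ vX pq; move: pq; rewrite cutP => /and3P[/eqP bpq pv qv].
pose A : {set 'I_r} := [set x | if blk x == blk p then x \notin supp v else (blk x < blk p)%N]%SET.
have aA : admissible A.
  apply/andP; split.
    by apply/finset.set0Pn; exists (q, p); rewrite cutP !inE -bpq eqxx qv /= pv.
  apply/forall_inP => x; rewrite inE => hx; apply/forallP => y; apply/implyP => yx.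
  rewrite inE; have : (blk y < blk p)%N.
    by move: hx; case: eqP => [<-//|_]; apply: ltn_trans.
  by move=> yp; rewrite (ltn_eqF yp).
have [w wX ew] := supp_surj aA; exists w => //.
exists (#|cut_pairs (supp v)|%:R / #|cut_pairs (supp w)|%:R); first by rewrite divr_gt0 ?card_cut_gt0.
suff e : coords (indicator (supp w)) = - coords (indicator (supp v)).
  rewrite /vertex e scalerN scaleNr scalerA mulrAC divff ?mul1r //.
  by rewrite gt_eqF // card_cut_gt0.
apply/eqP; rewrite -addr_eq0 -coordsD; apply/eqP/rowP => k; rewrite !mxE /indicator ew !inE.
set x := enum_val k; rewrite (hb x) (hb (block_last x)) blk_last.
case: eqP => // _; last by rewrite subrr.
by case: (x \in supp v); case: (block_last x \in supp v); rewrite /= ?(addr0, add0r, subrr).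
Qed.

Lemma full_polytope_polytope : full_polytope polytope.
Proof.
split; first by exists (0 :: [seq vertex v | v <- enum X]).
(* The position [enum_val k] with all earlier blocks. As the last element of its block is missing,
   the only nonzero coordinate is the one at [k], so the vertex is a positive multiple of a basis
   vector. *)
pose A (k : 'I_d) : {set 'I_r} := [set q | (q == enum_val k) || (blk q < blk (enum_val k))%N]%SET.
have aA k : admissible (A k).
  set p := enum_val k.
  have pN : p != block_last p.
    by rewrite eq_sym -nonlastP; apply: enum_valP.
  apply/andP; split.
    apply/finset.set0Pn; exists (p, block_last p); rewrite cutP !inE blk_last eqxx /= -/p eqxx /=.
    by rewrite ltnn orbF eq_sym.
  apply/forall_inP => x; rewrite inE => hx; apply/forallP => y; apply/implyP => yx.
  rewrite inE; apply/orP; right; case/predU1P: hx => [<-//|].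
  exact: ltn_trans.
have hA k : exists v, v \in X /\ supp v = A k by have [v] := supp_surj (aA k); exists v.
have [g hg] := choice hA.
have vk k : vertex (g k) = (#|cut_pairs (A k)|%:R)^-1 *: delta_mx ord0 k.
  rewrite /vertex (hg k).2; congr (_ *: _); apply/rowP => j; rewrite !mxE /indicator !inE eqxx /=.
  rewrite blk_last; set p := enum_val k; set q := enum_val j.
  have -> : (j == k) = (q == p) by rewrite (inj_eq enum_val_inj).
  have hp : p \in nonlast by apply: enum_valP.
  have -> : block_last q == p = false.
    by apply: contraTF hp => /eqP <-; apply: block_last_nonlast.
  case: eqP => [->|_] /=; first by rewrite ltnn subr0.
  by rewrite subrr.
exists (0 :: [seq vertex (g k) | k <- enum 'I_d]); split.
- apply: (affinely_independent_dual (c := fun k => delta_mx ord0 k)); first exact: enum_uniq.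
  + by move=> k _; rewrite dotp0.
  + move=> i j _ _ ij; rewrite vk dotpZ /dotp big1 ?mulr0 // => x _; rewrite !mxE !eqxx /=.
    by case: (eqVneq x i) => [->|_]; rewrite ?mul0r // (negbTE ij) mulr0.
  + move=> i _; rewrite vk dotpZ /dotp (bigD1 i) //= big1 ?addr0 => [|x /negbTE xi].
      rewrite !mxE !eqxx !mulr1 invr_eq0 gt_eqF // -(hg i).2.
      exact: card_cut_gt0 (hg i).1.
    by rewrite !mxE xi mul0r.
- by rewrite /= size_map size_enum_ord.
- move=> x /=; rewrite inE => /predU1P[->|/mapP[k _ ->]]; first exact: polytope0.
  exact: polytope_vertex (hg k).1.
Qed.

(** Complementary slackness: a point that attains the bound has no weight on vertices below the
    bound and, as [0 < b], none on the origin. *)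
Lemma face_sub_hull (c : 'rV[R]_d) b : (forall x, polytope x -> dotp c x <= b) -> 0 < b ->
  [set x | polytope x /\ dotp c x = b]%classic =
  hull [set v in X | dotp c (vertex v) == b]%SET.
Proof.
move=> hb b0; apply/seteqP; split=> [x [/polytopeP[mu [m0 m1 ->]]]|x].
  rewrite dotp_sum => e.
  have hv v : v \in X -> 0 <= mu v * (b - dotp c (vertex v)).
    by move=> vX; rewrite mulr_ge0 // subr_ge0; apply/hb/polytope_vertex.
  have e2 : \sum_(v in X) mu v * (b - dotp c (vertex v)) + b * (1 - \sum_(v in X) mu v) = 0.
    under eq_bigr => v _ do rewrite mulrBr -dotpZ.
    by rewrite sumrB e -mulr_suml; ring.
  have s0 : 0 <= \sum_(v in X) mu v * (b - dotp c (vertex v)) by apply: sumr_ge0.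
  have s1 : 0 <= b * (1 - \sum_(v in X) mu v) by rewrite mulr_ge0 ?(ltW b0) ?subr_ge0.
  move/eqP: e2; rewrite paddr_eq0 // psumr_eq0 // => /andP[/allP h1].
  rewrite mulf_eq0 (gt_eqF b0) /= subr_eq0 => /eqP h2.
  have z v : v \in X -> dotp c (vertex v) != b -> mu v = 0.
    move=> vX nb; have := h1 v (mem_index_enum v); rewrite vX mulf_eq0 subr_eq0 [b == _]eq_sym (negbTE nb) orbF.
    by move/eqP.
  have red (U : zmodType) (F : V -> U) : (forall v, mu v = 0 -> F v = 0) ->
      \sum_(v in X) F v = \sum_(v in [set v in X | dotp c (vertex v) == b]%SET) F v.
    move=> F0; rewrite (bigID (fun v => dotp c (vertex v) == b)) /= [X in _ + X]big1 ?addr0.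
      by apply: eq_bigl => v; rewrite inE.
    by move=> v /andP[vX nb]; apply/F0/z.
  apply/hullP; exists mu; split=> //; first by rewrite -red // h2.
  by rewrite -red // => v ->; rewrite scale0r.
case/hullP => mu [m0 m1 ->]; split.
  apply/polytopeP; exists (fun v => if dotp c (vertex v) == b then mu v else 0); split.
  - by move=> v; case: ifP.
  - rewrite -big_mkcondr /= -m1 le_eqVlt; apply/orP; left; apply/eqP.
    by apply: eq_bigl => v; rewrite inE.
  - rewrite [RHS](bigID (fun v => dotp c (vertex v) == b)) /= [X in _ + X]big1 ?addr0.
      by apply: eq_big => [v|v]; rewrite ?inE // => /andP[_ ->].
    by move=> v /andP[_ /negbTE ->]; rewrite scale0r.
rewrite dotp_sum (eq_bigr (fun v => mu v * b)) => [|v]; first by rewrite -mulr_suml m1 mul1r.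
by rewrite inE => /andP[_ /eqP <-]; rewrite dotpZ.
Qed.

Lemma face_chain F : face polytope F -> F <> polytope -> exists2 G, supp_chain G & F = hull G.
Proof.
case=> c [b [hb ->]] nP.
have b0 : 0 <= b by have := hb _ polytope0; rewrite dotp0.
have {}b0 : 0 < b.
  (* A functional with bound 0 is nonpositive at a vertex and at its opposite, so it vanishes on the
     whole polytope. *)
  rewrite lt_def b0 andbT; apply/eqP => eb; apply: nP; subst b.
  apply/seteqP; split=> [x []//|x Px]; split=> //.
  move/polytopeP: Px => [mu [_ _ ->]]; rewrite dotp_sum big1 // => v vX.
  have [w wX [k k0 ew]] := opposite_vertex vX.
  have := hb _ (polytope_vertex wX); rewrite ew (dotpZ _ (- k)) mulNr oppr_le0 pmulr_rge0 // => h.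
  by rewrite dotpZ (_ : dotp c (vertex v) = 0) ?mulr0 //; apply/eqP; rewrite eq_le h hb //; apply: polytope_vertex.
rewrite (face_sub_hull hb b0); exists [set v in X | dotp c (vertex v) == b]%SET => //.
(* [phi] satisfies the modular equality and, on down-closed sets, is at most [b] times the cut
   function, with equality at the vertices of the face. Two incomparable supports there would
   contradict strict submodularity. *)
pose phi A := dotp c (coords (indicator A)).
have phi_le A : down_closed A -> phi A <= b * #|cut_pairs A|%:R.
  move=> dA; case: (eqVneq (cut_pairs A) finset.set0) => cA.
    by rewrite /phi coords_indicator0 // dotp0 cA cards0 mulr0.
  have [v vX ev] : exists2 v, v \in X & supp v = A by apply: supp_surj; rewrite /admissible cA.
  have := hb _ (polytope_vertex vX); rewrite dotpZ mulrC ler_pdivrMr ?card_cut_gt0 //.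
  by rewrite ev.
have phi_eq v : v \in X -> dotp c (vertex v) == b -> phi (supp v) = b * #|cut_pairs (supp v)|%:R.
  move=> vX /eqP <-; rewrite dotpZ mulrAC mulVf ?mul1r // gt_eqF //; exact: card_cut_gt0.
apply/supp_chainP; split; first by apply/fintype.subsetP => v; rewrite inE => /andP[].
move=> v w; rewrite !inE => /andP[vX ev] /andP[wX ew].
apply/negPn/negP; rewrite negb_or => /andP[h1 h2].
have /andP[_ dv] := supp_adm vX; have /andP[_ dw] := supp_adm wX.
have [p [q [bpq pv pw qw qv]]] := incomparable_block dv dw h1 h2.
have := cut_submodular bpq pv pw qw qv; rewrite -(ltr_nat R) !natrD => lt.
have e : phi (supp v :&: supp w) + phi (supp v :|: supp w) = phi (supp v) + phi (supp w).
  by rewrite /phi -!dotpD coords_indicatorIU.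
have := lerD (phi_le _ (down_closedI dv dw)) (phi_le _ (down_closedU dv dw)).
by rewrite e phi_eq // phi_eq // -!mulrDr ler_pM2l // leNgt lt.
Qed.

Lemma chain_face G : supp_chain G -> face polytope (hull G) /\ hull G <> polytope.
Proof.
move=> cG; have /supp_chainP[/fintype.subsetP GX _] := cG.
have le1 x : polytope x -> dotp (chain_functional G) x <= 1.
  case/polytopeP => mu [m0 m1 ->]; apply: le_trans m1; rewrite dotp_sum.
  apply: ler_sum => v vX; rewrite dotpZ -[leRHS]mulr1 ler_wpM2l //.
  exact: chain_functional_vertex_le.
have eG : [set v in X | dotp (chain_functional G) (vertex v) == 1]%SET = G.
  apply/setP => v; rewrite inE; have [vG|vG] := boolP (v \in G).
    by rewrite GX // chain_functional_vertex // eqxx.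
  have [vX|//] := boolP (v \in X).
  by rewrite lt_eqF // chain_functional_vertex_lt.
split.
  exists (chain_functional G), 1; split=> //.
  by rewrite (face_sub_hull le1) // eG.
move=> e; have : hull G 0 by rewrite e; apply: polytope0.
rewrite -{1}eG -(face_sub_hull le1) // => -[_].
by rewrite dotp0 => /eqP; rewrite eq_sym oner_eq0.
Qed.

Lemma simplex_hull G : supp_chain G -> simplex (hull G).
Proof.
move=> cG; exists [seq vertex v | v <- enum G]; split=> //.
apply: (affinely_independent_dual_map (c := dual_functional G)); first exact: enum_uniq.
  by move=> v w; rewrite !mem_enum; apply: dual_functional0.
by move=> v; rewrite mem_enum => vG; rewrite gt_eqF // dual_functional_gt0.
Qed.

Lemma vertices_hull G : supp_chain G -> vertices (hull G) = (vertex @` [set` G])%classic.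
Proof.
move=> cG; apply/seteqP; split=> x.
  case=> c [b [hb e]].
  have /hullP[mu [m0 m1 ex]] : hull G x by have : [set x]%classic x by []; rewrite e => -[].
  have ecx : dotp c x = b by have : [set x]%classic x by []; rewrite e => -[].
  have [v vG mv] : exists2 v, v \in G & mu v != 0.
    apply/exists_inP; apply: contraT => /exists_inPn h.
    have : \sum_(v in G) mu v = 0 by apply: big1 => v /h; rewrite negbK => /eqP.
    by rewrite m1 => /eqP; rewrite oner_eq0.
  exists v => //; suff : [set x]%classic (vertex v) by [].
  rewrite e; split; first exact: hull_vertex.
  have hz : \sum_(v in G) mu v * (b - dotp c (vertex v)) = 0.
    under eq_bigr => w _ do rewrite mulrBr -dotpZ.
    by rewrite sumrB -dotp_sum -ex ecx -mulr_suml m1 mul1r subrr.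
  have hp w : w \in G -> 0 <= mu w * (b - dotp c (vertex w)).
    by move=> wG; rewrite mulr_ge0 // subr_ge0; apply/hb/hull_vertex.
  have /eqP := hz; rewrite psumr_eq0 // => /allP/(_ v (mem_index_enum v)).
  by rewrite vG mulf_eq0 (negbTE mv) subr_eq0 => /eqP.
(* The functional is positive at [v] and zero at the other vertices of [G], so it exposes
   [vertex v]. *)
case=> v /= vG <-; exists (dual_functional G v), (dotp (dual_functional G v) (vertex v)).
have val mu : \sum_(w in G) mu w = 1 ->
    dotp (dual_functional G v) (\sum_(w in G) mu w *: vertex w) =
    mu v * dotp (dual_functional G v) (vertex v).
  move=> _; rewrite dotp_sum (bigD1 v) //= big1 ?addr0 ?dotpZ // => w /andP[wG wv].
  by rewrite dotpZ dual_functional0 ?mulr0 // eq_sym.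
have pos := dual_functional_gt0 cG vG.
split.
  move=> y /hullP[mu [m0 m1 ->]]; rewrite val // ger_pMl //.
  by rewrite -m1 (bigD1 v) //= lerDl sumr_ge0.
apply/seteqP; split=> [y ->|y]; first by split=> //; apply: hull_vertex.
case=> /hullP[mu [m0 m1 ->]]; rewrite val // => /eqP.
rewrite -subr_eq0 -{2}[dotp _ _]mul1r -mulrBl mulf_eq0 (gt_eqF pos) orbF subr_eq0 => /eqP e.
have z w : w \in G -> w != v -> mu w = 0.
  move=> wG wv; move: m1; rewrite (bigD1 v) //= e => /eqP; rewrite -subr_eq0 addrAC subrr add0r.
  by rewrite psumr_eq0 // => /allP/(_ w (mem_index_enum w)); rewrite wG wv => /eqP.
rewrite /= (bigD1 v) //= e scale1r big1 ?addr0 // => w /andP[wG wv].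
by rewrite z // scale0r.
Qed.

Lemma simplicial_polytope_polytope : simplicial_polytope polytope.
Proof.
split; first exact: full_polytope_polytope.
by move=> F fF nF; have [G cG ->] := face_chain fF nF; apply: simplex_hull.
Qed.

Lemma complex_image_chains :
  complex_image vertex [set G | supp_chain G]%SET = boundary_complex polytope.
Proof.
apply/seteqP; split=> A.
  case=> G; rewrite inE => cG ->; have [fG nG] := chain_face cG.
  by exists (hull G); split=> //; rewrite vertices_hull.
case=> F [fF nF ->]; have [G cG ->] := face_chain fF nF.
by exists G; rewrite ?inE // vertices_hull.
Qed.
(** * The ball *)

Section Ball.
Import all_classical all_reals all_analysis.
Import numFieldNormedType.Exports.

(** * Pointwise continuity *)

Section Continuity.
Variables (T : topologicalType) (t : T).
Implicit Types (f g : T -> R).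

Lemma continuous_at_row n (f : T -> 'rV[R]_n) :
  (forall k, {for t, continuous (fun y => f y ord0 k)}) -> {for t, continuous f}.
Proof.
move=> h A [P PN PA]; rewrite /= /nbhs /=.
apply: (@filterS _ _ _ (fun y => forall k, P ord0 k (f y ord0 k))).
  by move=> y hy; apply: PA => i j; rewrite ord1.
by apply: filter_forall => k; apply: h; apply: PN.
Qed.

Lemma continuous_at_add f g : {for t, continuous f} -> {for t, continuous g} ->
  {for t, continuous (fun y => f y + g y)}.
Proof. by move=> hf hg; apply: cvgD. Qed.

Lemma continuous_at_sub f g : {for t, continuous f} -> {for t, continuous g} ->
  {for t, continuous (fun y => f y - g y)}.
Proof. by move=> hf hg; apply: cvgB. Qed.

Lemma continuous_at_mul f g : {for t, continuous f} -> {for t, continuous g} ->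
  {for t, continuous (fun y => f y * g y)}.
Proof. by move=> hf hg; apply: cvgM. Qed.

Lemma continuous_at_cst (c : R) : {for t, continuous (fun _ : T => c)}.
Proof. exact: cvg_cst. Qed.

Lemma continuous_at_div f g : {for t, continuous f} -> {for t, continuous g} ->
  g t != 0 -> {for t, continuous (fun y => f y / g y)}.
Proof. by move=> hf hg g0; apply: cvgM => //; apply: cvgV. Qed.

Lemma continuous_at_norm f : {for t, continuous f} -> {for t, continuous (fun y => `|f y|)}.
Proof. by move=> hf; apply: cvg_norm. Qed.

Lemma continuous_at_sqrt f : {for t, continuous f} -> {for t, continuous (fun y => Num.sqrt (f y))}.
Proof. by move=> hf; apply: continuous_comp => //; apply: sqrt_continuous. Qed.

Lemma continuous_at_max f g : {for t, continuous f} -> {for t, continuous g} ->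
  {for t, continuous (fun y => Num.max (f y) (g y))}.
Proof. by move=> hf hg; apply: continuous_max. Qed.

Lemma continuous_at_min f g : {for t, continuous f} -> {for t, continuous g} ->
  {for t, continuous (fun y => Num.min (f y) (g y))}.
Proof. by move=> hf hg; apply: continuous_min. Qed.

Lemma continuous_at_big (op : R -> R -> R) (x0 : T -> R) (I : Type) (s : seq I) (P : pred I)
    (F : I -> T -> R) :
  (forall f g, {for t, continuous f} -> {for t, continuous g} ->
    {for t, continuous (fun y => op (f y) (g y))}) ->
  {for t, continuous x0} -> (forall i, P i -> {for t, continuous (F i)}) ->
  {for t, continuous (fun y => \big[op/x0 y]_(i <- s | P i) F i y)}.
Proof.
move=> hop h0 hF; elim: s => [|i s IH].
  rewrite (_ : (fun y => _) = x0) //.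
  by apply/funext => y; rewrite big_nil.
case: (boolP (P i)) => Pi.
  rewrite (_ : (fun y => _) = fun y => op (F i y) (\big[op/x0 y]_(i <- s | P i) F i y)).
    by apply: hop => //; apply: hF.
  by apply/funext => y; rewrite big_cons Pi.
rewrite (_ : (fun y => _) = fun y => \big[op/x0 y]_(i <- s | P i) F i y) //.
by apply/funext => y; rewrite big_cons (negbTE Pi).
Qed.

End Continuity.

(** * Coordinates of points along chains *)

Implicit Types (x y : 'I_r -> R) (lam : V -> R).

(* An upper bound of all differences, used as a harmless default value for the
   minima and maxima below. *)
Definition spread x : R := \sum_p \sum_q `|x p - x q|.

Lemma norm_diff_le_spread x p q : `|x p - x q| <= spread x.
Proof.
rewrite /spread (bigD1 p) //= (bigD1 q) //= -addrA lerDl.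
rewrite addr_ge0 // sumr_ge0 // => p' _; exact: sumr_ge0.
Qed.

(** The minimum of [x] on the part of the cut block inside [supp v] minus its maximum on the part
    outside. It is positive exactly when the inside part is a strict upper level set of [x] in the
    block. *)
Definition gap x v : R := \big[Num.min/spread x]_(pq in cut_pairs (supp v)) (x pq.1 - x pq.2).

(* The coefficient of [v] in the decomposition of [x] along a chain. *)
Definition level x v : R := Num.max 0 (gap x v).

Lemma gap_le x v p q : (p, q) \in cut_pairs (supp v) -> gap x v <= x p - x q.
Proof. by move=> pq; apply: (@bigmin_inf _ _ _ _ (p, q)). Qed.

Lemma gap_attained x v : v \in X -> exists p q, (p, q) \in cut_pairs (supp v) /\ gap x v = x p - x q.
Proof.
move=> vX; have /andP[/finset.set0Pn[[p0 q0] h0] _] := supp_adm vX.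
have h (pq : 'I_r * 'I_r) : pq \in cut_pairs (supp v) -> x pq.1 - x pq.2 <= spread x.
  by move=> _; apply: le_trans (norm_diff_le_spread x pq.1 pq.2); apply: ler_norm.
by have [[p q] pq e] := eq_bigmin (p0, q0) _ (fun pq => x pq.1 - x pq.2) h0 h; exists p, q.
Qed.

(** Equality up to the factor [k] modulo block-constant functions; levels depend only on differences
    inside blocks. *)
Definition proportional k x y := forall p q, blk p = blk q -> y p - y q = k * (x p - x q).

Lemma cut_blk A p q : (p, q) \in cut_pairs A -> blk p = blk q.
Proof. by rewrite cutP => /and3P[/eqP]. Qed.

Lemma gap_proportional k x y v : 0 < k -> proportional k x y -> v \in X ->
  gap y v = k * gap x v.
Proof.
move=> k0 h vX; apply/le_anti/andP; split.
  have [p [q [pq ->]]] := gap_attained x vX.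
  by rewrite -h ?(cut_blk pq) //; apply: gap_le.
have [p [q [pq ->]]] := gap_attained y vX.
by rewrite h ?(cut_blk pq) // ler_pM2l //; apply: gap_le.
Qed.

Lemma level_proportional k x y v : 0 < k -> proportional k x y -> v \in X ->
  level y v = k * level x v.
Proof.
by move=> k0 h vX; rewrite /level maxr_pMr ?(ltW k0) // mulr0 (gap_proportional k0 h).
Qed.

Lemma level_ge0 x v : 0 <= level x v.
Proof. by rewrite /level le_max lexx. Qed.

Lemma level_gt0 x v p q : 0 < level x v -> (p, q) \in cut_pairs (supp v) -> x q < x p.
Proof.
rewrite /level lt_max ltxx /= => h pq; rewrite -subr_gt0.
exact: lt_le_trans h (gap_le x pq).
Qed.

Definition point lam p : R := \sum_(v in X) lam v * (p \in supp v)%:R.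

Lemma point_diff lam p q : point lam p - point lam q =
  \sum_(v in X) lam v * ((p \in supp v)%:R - (q \in supp v)%:R).
Proof. by rewrite /point -sumrB; apply: eq_bigr => v _; rewrite mulrBr. Qed.

(** Uniqueness of the coefficients: every cut pair of a member [v] of the chain differs by at least
    [lam v], and a cut pair that no other member separates differs by at most [lam v]. *)
Lemma level_point G lam v : supp_chain G -> (forall w, 0 <= lam w) ->
  (forall w, w \in X -> w \notin G -> lam w = 0) -> v \in X -> level (point lam) v = lam v.
Proof.
move=> cG l0 lG vX; have /supp_chainP[/fintype.subsetP GX ch] := cG.
apply/le_anti/andP; split.
  rewrite /level ge_max l0 /=.
  have cG' : supp_chain (G :\ v) := supp_chain_sub (subsetDl _ _) cG.
  have [/existsP[[p q] /andP[pq npq]]|h] :=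
      boolP [exists pq, (pq \in cut_pairs (supp v)) && ~~ separates (G :\ v) pq.1 pq.2]; last first.
    have : v \in G :\ v.
      apply: mem_of_separates => // p q pq; move/existsPn: h => /(_ (p, q)).
      by rewrite pq negbK.
    by rewrite in_setD1 eqxx.
  apply: le_trans (gap_le _ pq) _; rewrite point_diff (bigD1 v) //=.
  move: (pq); rewrite cutP => /and3P[_ -> /negbTE ->]; rewrite subr0 mulr1 gerDl.
  apply: sumr_le0 => w /andP[wX wv]; case: (boolP (w \in G)) => wG; last by rewrite lG // mul0r.
  rewrite mulr_ge0_le0 // subr_le0 ler_nat.
  case: (boolP (p \in supp w)) => //= pw; rewrite lt0b; apply/negPn/negP => qw.
  by case/negP: npq; apply/separatesP; exists w; rewrite ?in_setD1 ?wv //= pw.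
have [vG|vG] := boolP (v \in G); last by rewrite lG // level_ge0.
rewrite /level le_max; apply/orP; right.
have [p [q [pq ->]]] := gap_attained (point lam) vX.
move: pq; rewrite cutP => /and3P[_ pv qv].
rewrite point_diff (bigD1 v) //= pv (negbTE qv) subr0 mulr1 lerDl.
apply: sumr_ge0 => w /andP[wX wv]; case: (boolP (w \in G)) => wG; last by rewrite lG // mul0r.
rewrite mulr_ge0 // subr_ge0 ler_nat.
case/orP: (ch v w vG wG) => /fintype.subsetP h; first by rewrite (h p pv) leq_b1.
by case: (boolP (q \in supp w)) => //= /h; rewrite (negbTE qv).
Qed.

(* Ties are broken in favour of the natural order of positions, which makes the
   set of chambers below a weak order ideal. *)
Definition earlier x p q := (blk p < blk q)%N ||
  ((blk p == blk q) && ((x q < x p) || ((x p == x q) && (p <= q)%N))).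

Lemma earlier_trans x : transitive (earlier x).
Proof.
move=> q p s /orP[h1|/andP[/eqP e1 h1]] /orP[h2|/andP[/eqP e2 h2]]; rewrite /earlier.
- by rewrite (ltn_trans h1 h2).
- by rewrite -e2 h1.
- by rewrite e1 h2.
rewrite e1 e2 eqxx ltnn /=.
case/orP: h1 => [h1|/andP[/eqP x1 h1]]; case/orP: h2 => [h2|/andP[/eqP x2 h2]].
- by rewrite (lt_trans h2 h1).
- by rewrite -x2 h1.
- by rewrite x1 h2.
- by rewrite x1 x2 eqxx (leq_trans h1 h2) orbT.
Qed.

Lemma earlier_total x : total (earlier x).
Proof.
move=> p q; rewrite /earlier; case: (ltngtP (blk p) (blk q)) => //= _.
by case: (ltgtP (x p) (x q)) => //= _; apply: leq_total.
Qed.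

Lemma earlier_anti x p q : earlier x p q -> earlier x q p -> p = q.
Proof.
rewrite /earlier; case: (ltngtP (blk p) (blk q)) => //= _.
case: (ltgtP (x p) (x q)) => //= _ h1 h2; apply/val_inj/eqP.
by rewrite eqn_leq h1.
Qed.

(** The prefixes of the positions sorted by block and then by decreasing value. They form a maximal
    chain whose cone contains [x]. *)
Definition sorting_chain x : {set V} :=
  [set v in X | [exists c, supp v == [set p | earlier x p c]%SET]]%SET.

Lemma sorting_chain_chain x : supp_chain (sorting_chain x).
Proof.
apply/supp_chainP; split; first by apply/fintype.subsetP => v; rewrite inE => /andP[].
move=> v w; rewrite !inE => /andP[_ /existsP[c /eqP ->]] /andP[_ /existsP[e /eqP ->]].
by case/orP: (earlier_total x c e) => h; apply/orP; [left|right];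
  apply/fintype.subsetP => p; rewrite !inE => /earlier_trans; apply.
Qed.

Lemma sorting_chain_separates x p q : blk p = blk q -> p != q -> earlier x p q ->
  separates (sorting_chain x) p q.
Proof.
move=> bpq pq epq; pose A : {set 'I_r} := [set b | earlier x b p]%SET.
have pA : p \in A by rewrite inE; case/orP: (earlier_total x p p).
have qA : q \notin A by rewrite inE; apply: contra pq => /(earlier_anti epq) ->.
have [|v vX ev] := @supp_surj A.
  apply/andP; split; first by apply/finset.set0Pn; exists (p, q); rewrite cutP bpq eqxx pA.
  apply/forall_inP => b; rewrite inE => bp; apply/forallP => c; apply/implyP => cb.
  by rewrite inE; apply: earlier_trans bp; rewrite /earlier cb.
apply/separatesP; exists v; last by rewrite ev pA.
by rewrite inE vX; apply/existsP; exists p; rewrite ev.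
Qed.

Lemma level_sorting_chain x v : v \in X -> 0 < level x v -> v \in sorting_chain x.
Proof.
move=> vX lv; apply: mem_of_separates (sorting_chain_chain x) vX _ => p q pq.
have xqp := level_gt0 lv pq.
apply: sorting_chain_separates; first exact: cut_blk pq.
  by apply: contraTneq xqp => ->; rewrite ltxx.
by rewrite /earlier (cut_blk pq) eqxx xqp orbT.
Qed.

Lemma sorting_chain_max x v : v \in X -> supp_chain (v |: sorting_chain x)%SET ->
  v \in sorting_chain x.
Proof.
move=> vX cv; apply: mem_of_separates (sorting_chain_chain x) vX _ => p q pq.
have pq' : p != q by move: pq; rewrite cutP => /and3P[_ pv qv]; apply: contraNneq qv => <-.
case/orP: (earlier_total x p q) => h.
  by apply: sorting_chain_separates h => //; apply: cut_blk pq.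
have /separatesP[w wF wqp] : separates (sorting_chain x) q p.
  by apply: sorting_chain_separates h; rewrite ?(cut_blk pq) // eq_sym.
have s1 : separates (v |: sorting_chain x)%SET p q.
  by apply/separatesP; exists v; rewrite ?setU11 //; move: pq; rewrite cutP => /and3P[_ ->].
case/negP: (separates_asym cv s1); apply/separatesP; exists w => //.
by apply/finset.setU1P; right.
Qed.

(** Existence of the decomposition. Differences add up along intermediate positions, so induction on
    the number of positions of the block with values strictly between reduces to neighbouring
    values. *)
Lemma point_level x p q : blk p = blk q ->
  point (level x) p - point (level x) q = x p - x q.
Proof.
wlog pq : p q / x q <= x p.
  move=> wl bpq; case: (leP (x q) (x p)) => h; first exact: wl.
  by apply: oppr_inj; rewrite !opprB wl // ltW.
move e : #|[set c | (blk c == blk p) && (x q < x c < x p)]%SET| => m.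
elim/ltn_ind: m p q pq e => m IH p q pq em bpq.
have contra_sep v a b : v \in X -> 0 < level x v -> blk a = blk b -> x a <= x b ->
    a \in supp v -> b \in supp v.
  move=> vX lv bab ab av; apply/negPn/negP => bv.
  have : (a, b) \in cut_pairs (supp v) by rewrite cutP bab eqxx av.
  by move/(level_gt0 lv); rewrite ltNge ab.
have [/existsP[c /andP[/eqP bc /andP[qc cp]]]|nc] :=
    boolP [exists c, (blk c == blk p) && (x q < x c < x p)].
  rewrite -(subrKA (point (level x) c)) -[RHS](subrKA (x c)); congr (_ + _).
  - apply: (IH _ _ p c _ (erefl _)); [|exact: ltW|by rewrite bc].
    rewrite -em; apply: proper_card; apply/properP; split.
      apply/fintype.subsetP => b; rewrite !inE => /and3P[-> cb ->].
      by rewrite (lt_trans qc cb).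
    by exists c; rewrite !inE bc eqxx ?qc ?cp // ltxx.
  - apply: (IH _ _ c q _ (erefl _)); [|exact: ltW|by rewrite bc].
    rewrite -em; apply: proper_card; apply/properP; split.
      apply/fintype.subsetP => b; rewrite !inE bc => /and3P[-> -> bc'].
      by rewrite (lt_trans bc' cp).
    by exists c; rewrite !inE bc eqxx ?qc ?cp // ltxx andbF.
rewrite point_diff; move: pq; rewrite le_eqVlt => /predU1P[xpq|xqp].
  rewrite xpq subrr big1 // => v vX.
  have := level_ge0 x v; rewrite le_eqVlt => /predU1P[<-|lv]; first by rewrite mul0r.
  suff -> : (p \in supp v) = (q \in supp v) by rewrite subrr mulr0.
  by apply/idP/idP; apply: contra_sep; rewrite ?xpq.
have gapc c : blk c = blk p -> x c < x p -> x c <= x q.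
  move=> bc cp; rewrite leNgt; apply: contra nc => qc.
  by apply/existsP; exists c; rewrite bc eqxx qc.
(* The upper level set at [x p]. As no value of the block lies strictly between, it is the only
   support of positive level that separates [p] from [q], and its level is the whole difference. *)
pose A : {set 'I_r} := [set b | (blk b < blk p)%N || ((blk b == blk p) && (x p <= x b))]%SET.
have pA : p \in A by rewrite inE eqxx lexx orbT.
have qA : q \notin A by rewrite inE -bpq ltnn eqxx /= -ltNge.
have cA : (p, q) \in cut_pairs A by rewrite cutP bpq eqxx pA.
have [|v0 v0X ev0] := @supp_surj A.
  apply/andP; split; first by apply/finset.set0Pn; exists (p, q).
  apply/forall_inP => b; rewrite inE => hb; apply/forallP => c; apply/implyP => cb.
  rewrite inE; apply/orP; left; case/orP: hb => [|/andP[/eqP <- _]//].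
  exact: ltn_trans.
have lv0 : level x v0 = x p - x q.
  have h : gap x v0 = x p - x q.
    apply/le_anti/andP; split; first by apply: gap_le; rewrite ev0.
    have [b [c [bc ->]]] := gap_attained x v0X.
    have := bc; rewrite ev0 cutP !inE => /and3P[/eqP bbc /orP[hb|/andP[/eqP hb xb]]].
      by rewrite -bbc hb.
    rewrite -bbc hb ltnn eqxx /= -ltNge => xc.
    by apply: lerB => //; apply: gapc; rewrite // -bbc.
  by rewrite /level h; apply/max_idPr; rewrite subr_ge0 ltW.
rewrite (bigD1 v0) //= lv0 ev0 pA (negbTE qA) subr0 mulr1 big1 ?addr0 // => v /andP[vX vv0].
have := level_ge0 x v; rewrite le_eqVlt => /predU1P[<-|lv]; first by rewrite mul0r.
have qp : q \in supp v -> p \in supp v by apply: contra_sep => //; exact: ltW.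
case: (boolP (p \in supp v)) => pv; last first.
  by case: (boolP (q \in supp v)) => [/qp|]; [rewrite (negbTE pv)|rewrite subrr mulr0].
case: (boolP (q \in supp v)) => qv; first by rewrite subrr mulr0.
case/eqP: vv0; apply: supp_inj => //; rewrite ev0.
have pqv : (p, q) \in cut_pairs (supp v) by rewrite cutP bpq eqxx pv.
apply/setP => b; rewrite (mem_supp_block b vX pqv) inE.
case: ltngtP => //= bb; apply/idP/idP.
  move=> bv; rewrite leNgt; apply/negP => bp; case/negP: qv.
  by apply: contra_sep bv => //; [rewrite bb|apply: gapc].
by move=> pb; apply: contra_sep pv.
Qed.

(** * Cones over order ideals of chambers *)

Section Ideal.
Variable E : {set {set V}}.
Hypothesis E_chain : forall F, F \in E -> supp_chain F.
(** The premises say that [F'] is a maximal chain with all naturally ordered pairs of [F]. In terms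
    of inverted pairs, [E] is an order ideal of the weak order. *)
Hypothesis E_closed : forall F F', F \in E -> supp_chain F' ->
  (forall v, v \in X -> supp_chain (v |: F')%SET -> v \in F') ->
  (forall p q, (p < q)%N -> blk p = blk q -> separates F p q -> separates F' p q) -> F' \in E.
Hypothesis E_neq0 : E != finset.set0.

Definition ordered_pairs (F : {set V}) : {set 'I_r * 'I_r} :=
  [set pq : 'I_r * 'I_r | [&& (pq.1 < pq.2)%N, blk pq.1 == blk pq.2 & separates F pq.1 pq.2]]%SET.

(** This excludes the chamber that reverses every block. Were it in [E], closure would put every
    maximal chain into [E], and the complex would be a sphere. *)
Hypothesis E_pairs : forall F, F \in E -> ordered_pairs F != finset.set0.

Lemma ordered_pairsP F p q : ((p, q) \in ordered_pairs F) =
  [&& (p < q)%N, blk p == blk q & separates F p q].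
Proof. by rewrite inE. Qed.

(** The amount of tilt along [- p] after which [x] has equal values at the two positions; any larger
    tilt puts them in natural order. *)
Definition quotient x (pq : 'I_r * 'I_r) : R := (x pq.2 - x pq.1) / (pq.2 - pq.1)%:R.

Definition slope x F : R := \big[Num.max/- spread x]_(pq in ordered_pairs F) quotient x pq.

(* The cone over the complex generated by [E] consists of the points where
   [height] is at most 0; it is an epigraph in the direction of the vector whose
   coordinate at each position [p] is [- p]. *)
Definition height x : R := \big[Num.min/spread x]_(F in E) slope x F.

Lemma quotient_norm x F pq : pq \in ordered_pairs F -> `|quotient x pq| <= spread x.
Proof.
case: pq => p q; rewrite ordered_pairsP => /and3P[pq _ _].
rewrite /quotient normrM /= normfV normr_nat.
apply: le_trans (norm_diff_le_spread x q p); rewrite ler_pdivrMr ?ltr0n ?subn_gt0 //.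
by rewrite ler_peMr // ler1n subn_gt0.
Qed.

Lemma spread_ge0 x : 0 <= spread x.
Proof. by apply: sumr_ge0 => p _; apply: sumr_ge0. Qed.

(** The sets [E] and [ordered_pairs F] are nonempty and [spread] bounds all quotients, so the
    default values never decide the minimum or a maximum. *)
Lemma heightP x c : height x <= c <->
  exists2 F, F \in E & forall pq, pq \in ordered_pairs F -> quotient x pq <= c.
Proof.
have /finset.set0Pn[F0 F0E] := E_neq0.
split=> [h|[F FE hF]].
  have le F : F \in E -> slope x F <= spread x.
    move=> FE; apply/bigmax_leP; split; first by rewrite ge0_cp // spread_ge0.
    by move=> pq pqF; apply: le_trans (ler_norm _) (quotient_norm x pqF).
  have [F FE e] := @eq_bigmin _ _ _ _ F0 _ (slope x) F0E le.
  exists F => // pq pqF; apply: le_trans h; rewrite /height e.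
  exact: le_bigmax_cond.
apply: (@bigmin_inf _ _ _ _ F) => //; apply/bigmax_leP; split=> //.
have /finset.set0Pn[pq pqF] := E_pairs FE; apply: le_trans (hF pq pqF).
by have := quotient_norm x pqF; rewrite ler_norml => /andP[].
Qed.

(** Modulo block-constant functions, [y] is [k] times [x] moved by [h] along the vector with
    coordinate [- p] at [p]. *)
Definition tilted k h x y := forall p q, blk p = blk q ->
  y p - y q = k * (x p - x q) + h * (q%:R - p%:R).

Lemma height_tilted_le k h x y : 0 < k -> tilted k h x y -> height y <= k * height x - h.
Proof.
move=> k0 xy; apply/heightP; have /heightP[F FE hF] := lexx (height x).
exists F => // -[p q] pqF; have := hF _ pqF; rewrite /quotient /=.
move: pqF; rewrite ordered_pairsP => /and3P[pq /eqP bpq _].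
have d0 : 0 < (q - p)%:R :> R by rewrite ltr0n subn_gt0.
rewrite !ler_pdivrMr // => hle; rewrite xy // natrB 1?ltnW // in hle *.
have := ler_wpM2l (ltW k0) hle; lra.
Qed.

(** The inverse of a tilt is again a tilt, so the one-sided estimate applies both ways. *)
Lemma height_tilted k h x y : 0 < k -> tilted k h x y -> height y = k * height x - h.
Proof.
move=> k0 xy; apply/le_anti; rewrite (height_tilted_le k0 xy) /=.
have k0' : 0 < k^-1 by rewrite invr_gt0.
have yx : tilted k^-1 (- (k^-1 * h)) y x.
  by move=> p q bpq; rewrite xy //; field; rewrite gt_eqF.
have := height_tilted_le k0' yx; rewrite opprK -mulrDr => hle.
have := ler_wpM2l (ltW k0) hle; rewrite mulrA divff ?gt_eqF // mul1r.
by rewrite -lerBlDr.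
Qed.

Lemma height_proportional k x y : 0 < k -> proportional k x y -> height y = k * height x.
Proof.
move=> k0 xy; rewrite (@height_tilted k 0 x y k0) ?subr0 // => p q bpq.
by rewrite xy // mul0r addr0.
Qed.

Lemma height0 : height (fun=> 0) = 0.
Proof.
have h : proportional 2 (fun=> 0) (fun=> 0) by move=> p q _; rewrite subrr mulr0.
have := height_proportional (ltr0n R 2) h; lra.
Qed.

(** Some [F] in [E] has [x q <= x p] for each of its natural pairs. The tie-breaking rule turns this
    weak inequality into natural order in the sorting chain, so closure applies. *)
Lemma sorting_chain_in x : height x <= 0 -> sorting_chain x \in E.
Proof.
case/heightP => F FE hF; apply: (E_closed FE (sorting_chain_chain x)).
  exact: sorting_chain_max.
move=> p q pq bpq sF; apply: sorting_chain_separates => //.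
  by apply: contraTneq pq => ->; rewrite ltnn.
have := hF (p, q); rewrite ordered_pairsP pq bpq eqxx sF => /(_ isT).
rewrite ler_pdivrMr ?ltr0n ?subn_gt0 //= mul0r subr_le0 => le.
rewrite /earlier bpq eqxx ltnn /=; move: le; rewrite le_eqVlt => /predU1P[->|->//].
by rewrite eqxx (ltnW pq) orbT.
Qed.

Lemma height_point F lam : F \in E -> (forall v, 0 <= lam v) ->
  (forall v, v \in X -> v \notin F -> lam v = 0) -> height (point lam) <= 0.
Proof.
move=> FE l0 lF; apply/heightP; exists F => // -[p q].
rewrite ordered_pairsP => /and3P[pq _ sF].
rewrite ler_pdivrMr ?ltr0n ?subn_gt0 //= mul0r point_diff.
apply: sumr_le0 => v vX; case: (boolP (v \in F)) => vF; last by rewrite lF // mul0r.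
rewrite mulr_ge0_le0 // subr_le0 ler_nat.
case: (boolP (q \in supp v)) => //= qv; rewrite lt0b; apply/negPn/negP => pv.
case/negP: (separates_asym (E_chain FE) sF).
by apply/separatesP; exists v; rewrite // qv.
Qed.

(** * The chart and the radial projection *)

Section Chart.
Variable b0 : 'I_r.
Hypothesis b0N : b0 \in nonlast.

Local Notation chart_index := (nonlast :\ b0)%SET.
Local Notation n := #|chart_index|.

Definition block_drop p : R := (block_last p)%:R - p%:R.

(** [block_drop p] is the coordinate at [p] of the tilting direction. Subtracting this multiple of
    the direction kills the coordinate at [b0], so [chart] is the projection along the direction. *)
Definition tilt x : R := (x b0 - x (block_last b0)) / block_drop b0.

Definition chart x : 'rV[R]_n := \row_k
  (x (enum_val k) - x (block_last (enum_val k)) - tilt x * block_drop (enum_val k)).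

Definition chart_inv (u : 'rV[R]_n) p : R := \sum_k u ord0 k * (enum_val k == p)%:R.

(** The point with chart [u] and height [- s]; the cone is the part with [0 <= s]. *)
Definition cone_point (u : 'rV[R]_n) (s : R) p : R := chart_inv u p - (s + height (chart_inv u)) * p%:R.

Lemma block_drop_gt0 : 0 < block_drop b0.
Proof.
rewrite subr_gt0 ltr_nat ltn_neqAle; have [_ h] := block_lastP b0.
by rewrite h // andbT; move: b0N; rewrite nonlastP; apply: contra => /eqP/val_inj <-.
Qed.

Lemma chart_inv_enum u k : chart_inv u (enum_val k) = u ord0 k.
Proof.
rewrite /chart_inv (bigD1 k) //= eqxx mulr1 big1 ?addr0 // => j jk.
by rewrite (inj_eq enum_val_inj) (negbTE jk) mulr0.
Qed.

Lemma chart_inv_out u p : p \notin chart_index -> chart_inv u p = 0.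
Proof.
move=> h; apply: big1 => k _; case: eqP => [e|]; last by rewrite mulr0.
by case/negP: h; rewrite -e enum_valP.
Qed.

Lemma chart_inv_last u p : chart_inv u (block_last p) = 0.
Proof. by rewrite chart_inv_out // in_setD1 (negbTE (block_last_nonlast _)) andbF. Qed.

Lemma chart_proportional k x y : proportional k x y -> chart y = k *: chart x.
Proof.
move=> xy; apply/rowP => i; rewrite !mxE /tilt.
by rewrite xy ?blk_last // xy ?blk_last //; ring.
Qed.

Lemma chart_cone_point u s : chart (cone_point u s) = u.
Proof.
apply/rowP => k; rewrite !mxE /cone_point chart_inv_enum chart_inv_last.
have -> : tilt (cone_point u s) = s + height (chart_inv u).
  have e : cone_point u s b0 - cone_point u s (block_last b0) = (s + height (chart_inv u)) * block_drop b0.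
    by rewrite /cone_point chart_inv_last chart_inv_out ?in_setD1 ?eqxx // /block_drop; ring.
  by rewrite /tilt e mulfK // lt0r_neq0 // block_drop_gt0.
rewrite /block_drop; ring.
Qed.

Lemma height_cone_point u s : height (cone_point u s) = - s.
Proof.
rewrite (@height_tilted 1 (s + height (chart_inv u)) (chart_inv u)) ?ltr01 //; first by ring.
by move=> p q _; rewrite /cone_point; ring.
Qed.

Lemma chart_inv_chart x p : x p - x (block_last p) = chart_inv (chart x) p + tilt x * block_drop p.
Proof.
case: (boolP (p \in chart_index)) => hp.
  have [k ->] : exists k : 'I_n, p = enum_val k.
    by exists (enum_rank_in hp p); rewrite enum_rankK_in.
  by rewrite chart_inv_enum mxE subrK.
rewrite chart_inv_out // add0r; move: hp; rewrite in_setD1 negb_and negbK => /predU1P[->|hp].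
  by rewrite /tilt divfK // lt0r_neq0 // block_drop_gt0.
by rewrite /block_drop !block_lastK // !subrr mulr0.
Qed.

(** Chart and height determine a point modulo block-constant functions. The factor [k] provides for
    the rescaling in [to_ball]. *)
Lemma cone_point_chart k x : 0 < k -> proportional k x (cone_point (k *: chart x) (k * - height x)).
Proof.
move=> k0.
have tx : tilted 1 (tilt x) (chart_inv (chart x)) x.
  move=> p q bpq; have e := block_last_eq bpq.
  rewrite -(subrKA (x (block_last p))) chart_inv_chart -[x (block_last p) - _]opprB e chart_inv_chart.
  by rewrite /block_drop e; ring.
have hx := height_tilted ltr01 tx; rewrite mul1r in hx.
have ck p : chart_inv (k *: chart x) p = k * chart_inv (chart x) p.
  by rewrite /chart_inv mulr_sumr; apply: eq_bigr => i _; rewrite mxE mulrA.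
have hk : height (chart_inv (k *: chart x)) = k * height (chart_inv (chart x)).
  by apply: height_proportional => // p q _; rewrite !ck; ring.
by move=> p q bpq; rewrite /cone_point !ck hk (tx p q bpq) hx; ring.
Qed.

Definition norm2 m (u : 'rV[R]_m) : R := Num.sqrt (\sum_i u ord0 i ^+ 2).

Lemma norm2_ge0 m (u : 'rV[R]_m) : 0 <= norm2 u.
Proof. exact: sqrtr_ge0. Qed.

Lemma norm2Z m k (u : 'rV[R]_m) : 0 <= k -> norm2 (k *: u) = k * norm2 u.
Proof.
move=> k0; rewrite /norm2; under eq_bigr => i _ do rewrite mxE exprMn.
by rewrite -mulr_sumr sqrtrM ?sqr_ge0 // sqrtr_sqr ger0_norm.
Qed.

Lemma norm2_eq0 m (u : 'rV[R]_m) : norm2 u = 0 -> u = 0.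
Proof.
move/eqP; rewrite sqrtr_eq0 => h; apply/rowP => i; rewrite mxE.
have s0 : \sum_i u ord0 i ^+ 2 = 0.
  by apply/le_anti; rewrite h sumr_ge0 // => j _; apply: sqr_ge0.
have /eqP := s0; rewrite psumr_eq0 => [|j _]; last exact: sqr_ge0.
by move/allP/(_ i (mem_index_enum i)); rewrite /= sqrf_eq0 => /eqP.
Qed.

Lemma ball_norm2 m (u : 'rV[R]_m) : closed_ball_euclid u <-> norm2 u <= 1.
Proof.
rewrite /closed_ball_euclid /= /norm2 -[X in _ <-> is_true (_ <= X)](sqrtr1 R) ler_sqrt //.
Qed.

Lemma norm20 m : norm2 (0 : 'rV[R]_m) = 0.
Proof. by rewrite /norm2 big1 ?sqrtr0 // => i _; rewrite mxE expr0n. Qed.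

Lemma level_const x v : proportional 0 (fun=> 0) x -> v \in X -> level x v = 0.
Proof.
move=> h vX; have [p [q [pq e]]] := gap_attained x vX.
by rewrite /level e h ?(cut_blk pq) // mul0r maxxx.
Qed.

Lemma const_of_chart x : chart x = 0 -> height x = 0 -> proportional 0 (fun=> 0) x.
Proof.
move=> cx hx p q bpq; have := @cone_point_chart 1 x ltr01 p q bpq.
rewrite cx hx oppr0 mulr0 scaler0 mul1r => <-; rewrite /cone_point.
have c0 i : chart_inv 0 i = 0 by apply: big1 => k _; rewrite mxE mul0r.
have -> : height (chart_inv 0) = 0.
  rewrite -height0; congr height; exact/funext.
by rewrite !c0; ring.
Qed.

Definition total_level x : R := \sum_(v in X) level x v.

Lemma total_level_gt0 x : ~ proportional 0 (fun=> 0) x -> 0 < total_level x.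
Proof.
move=> nc; rewrite lt_def sumr_ge0 ?andbT => [|v _]; last exact: level_ge0.
apply/eqP => t0; apply: nc => p q bpq.
have /eqP := t0; rewrite psumr_eq0 => [/allP h|v _]; last exact: level_ge0.
rewrite -point_level // point_diff subrr mulr0 big1 // => v vX.
by have /implyP/(_ vX)/eqP -> := h v (mem_index_enum v); rewrite mul0r.
Qed.

Local Notation K := (generated_complex E).

Definition weights (z : 'rV[R]_#|V|) v : R := z ord0 (enum_rank v).

(** With [s] the negative of the height and [u] the chart, points of the cone are rescaled to
    [norm2 u + s = 1]. The pairs with [0 <= s] form a graph over the unit ball, so [s] may be
    forgotten; [of_ball] restores it as [1 - norm2 u]. *)
Definition to_ball (z : 'rV[R]_#|V|) : 'rV[R]_n :=
  (norm2 (chart (point (weights z))) - height (point (weights z)))^-1 *: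
  chart (point (weights z)).

Definition of_ball (u : 'rV[R]_n) : 'rV[R]_#|V| := \row_i
  if enum_val i \in X then
    level (cone_point u (1 - norm2 u)) (enum_val i) / total_level (cone_point u (1 - norm2 u))
  else 0.

Lemma realizationP (z : 'rV[R]_#|V|) : realization K z -> exists F,
  [/\ F \in E, forall v, 0 <= weights z v, forall v, v \notin F -> weights z v = 0 &
      \sum_(v in X) weights z v = 1].
Proof.
case=> z0 z1 [G]; rewrite inE => /exists_inP[F FE GF] zG; exists F.
have zF v : v \notin F -> weights z v = 0.
  by move=> vF; apply: zG; apply: contra vF; apply: (fintype.subsetP GF).
split=> //; first by move=> v; apply: z0.
rewrite -z1 (reindex (@enum_rank V)) /=; last first.
  by exists enum_val => i _; rewrite ?enum_rankK ?enum_valK.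
rewrite [RHS](bigID (mem X)) /= [X in _ = _ + X]big1 ?addr0 // => v vX.
apply: zF; apply: contra vX; have /supp_chainP[/fintype.subsetP h _] := E_chain FE.
exact: h.
Qed.

Lemma level_weights z : realization K z -> forall v, v \in X -> level (point (weights z)) v = weights z v.
Proof.
case/realizationP => F [FE z0 zF _] v vX.
by apply: (level_point (E_chain FE)) => // w _; apply: zF.
Qed.

Lemma height_weights z : realization K z -> height (point (weights z)) <= 0.
Proof.
case/realizationP => F [FE z0 zF _].
by apply: (height_point FE) => // w _; apply: zF.
Qed.

(** A zero denominator makes the point block-constant, so all its levels and hence all weights would
    vanish, although they sum to 1. *)
Lemma to_ball_den_gt0 z : realization K z ->
  0 < norm2 (chart (point (weights z))) - height (point (weights z)).
Proof.
move=> Kz; have h0 := height_weights Kz; have n0 := norm2_ge0 (chart (point (weights z))).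
rewrite lt_def subr_ge0 (le_trans h0) // andbT; apply/eqP => e.
have e1 : norm2 (chart (point (weights z))) = 0 by lra.
have e2 : height (point (weights z)) = 0 by lra.
have hc := const_of_chart (norm2_eq0 e1) e2.
have [F [_ _ _ s1]] := realizationP Kz.
have : \sum_(v in X) weights z v = 0.
  by apply: big1 => v vX; rewrite -level_weights // level_const.
by rewrite s1 => /eqP; rewrite oner_eq0.
Qed.

Lemma to_ball_in z : realization K z -> closed_ball_euclid (to_ball z).
Proof.
move=> Kz; apply/ball_norm2; have d0 := to_ball_den_gt0 Kz.
rewrite /to_ball norm2Z ?invr_ge0 ?(ltW d0) // [_^-1 * _]mulrC ler_pdivrMr // mul1r lerDl oppr_ge0.
exact: height_weights.
Qed.

Lemma total_cone_point_gt0 u : norm2 u <= 1 -> 0 < total_level (cone_point u (1 - norm2 u)).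
Proof.
move=> u1; apply: total_level_gt0 => h.
have := chart_proportional h; rewrite chart_cone_point scale0r => u0.
have : height (cone_point u (1 - norm2 u)) = 0.
  have pr : proportional 1 (fun=> 0) (cone_point u (1 - norm2 u)).
    by move=> p q bpq; rewrite h // !subrr !mulr0.
  by rewrite (height_proportional ltr01 pr) height0 mulr0.
by rewrite height_cone_point u0 norm20; lra.
Qed.

Lemma weights_of_ball u v : v \in X ->
  weights (of_ball u) v = level (cone_point u (1 - norm2 u)) v / total_level (cone_point u (1 - norm2 u)).
Proof. by move=> vX; rewrite /weights mxE enum_rankK vX. Qed.

Lemma of_ball_in u : norm2 u <= 1 -> realization K (of_ball u).
Proof.
move=> u1; have t0 := total_cone_point_gt0 u1; split.
- move=> i; rewrite mxE; case: ifP => // _.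
  by rewrite divr_ge0 ?level_ge0 // ltW.
- rewrite (reindex (@enum_rank V)) /=; last first.
    by exists enum_val => i _; rewrite ?enum_rankK ?enum_valK.
  rewrite (bigID (mem X)) /= [X in _ + X]big1 ?addr0 => [|v vX]; last first.
    by rewrite mxE enum_rankK (negbTE vX).
  rewrite (eq_bigr (fun v => level (cone_point u (1 - norm2 u)) v / total_level (cone_point u (1 - norm2 u)))).
    by rewrite -mulr_suml divff // lt0r_neq0.
  by move=> v vX; rewrite mxE enum_rankK vX.
(* The weights are supported on the sorting chain, which belongs to [E] because the height
   [norm2 u - 1] is at most 0. *)
exists (sorting_chain (cone_point u (1 - norm2 u))).
  rewrite inE; apply/exists_inP; exists (sorting_chain (cone_point u (1 - norm2 u))) => //.
  by apply: sorting_chain_in; rewrite height_cone_point oppr_le0 subr_ge0.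
move=> v vF; rewrite mxE enum_rankK; case: ifP => // vX.
have := level_ge0 (cone_point u (1 - norm2 u)) v; rewrite le_eqVlt => /predU1P[<-|lv].
  by rewrite mul0r.
by case/negP: vF; apply: level_sorting_chain.
Qed.

Lemma to_ballK z : realization K z -> of_ball (to_ball z) = z.
Proof.
move=> Kz; set x := point (weights z); have d0 := to_ball_den_gt0 Kz.
have [F [FE z0 zF s1]] := realizationP Kz.
set den := norm2 (chart x) - height x in d0 *.
have i0 : 0 < den^-1 by rewrite invr_gt0.
have eu : to_ball z = den^-1 *: chart x by [].
have es : 1 - norm2 (to_ball z) = den^-1 * - height x.
  rewrite eu norm2Z ?ltW // -[1](mulVf (lt0r_neq0 d0)) -mulrBr /den; congr (_ * _); ring.
have pr := @cone_point_chart den^-1 x i0; rewrite -eu -es in pr.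
have lv v : v \in X -> level (cone_point (to_ball z) (1 - norm2 (to_ball z))) v = den^-1 * weights z v.
  by move=> vX; rewrite (level_proportional i0 pr) // level_weights.
have tt : total_level (cone_point (to_ball z) (1 - norm2 (to_ball z))) = den^-1.
  by rewrite /total_level (eq_bigr _ lv) -mulr_sumr s1 mulr1.
apply/rowP => i; rewrite mxE; have wi : z ord0 i = weights z (enum_val i) by rewrite /weights enum_valK.
case: ifP => iX; first by rewrite lv // tt wi mulrAC divff ?mul1r // lt0r_neq0.
rewrite wi zF //; apply: contraFN iX; have /supp_chainP[/fintype.subsetP h _] := E_chain FE.
exact: h.
Qed.

Lemma of_ballK u : norm2 u <= 1 -> to_ball (of_ball u) = u.
Proof.
move=> u1; have t0 := total_cone_point_gt0 u1; set x := cone_point u (1 - norm2 u) in t0.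
have i0 : 0 < (total_level x)^-1 by rewrite invr_gt0.
have pr : proportional (total_level x)^-1 x (point (weights (of_ball u))).
  move=> p q bpq; rewrite -(point_level x bpq) !point_diff mulr_sumr.
  by apply: eq_bigr => v vX; rewrite weights_of_ball // mulrAC mulrC.
rewrite /to_ball (chart_proportional pr) (height_proportional i0 pr) chart_cone_point height_cone_point.
rewrite norm2Z ?(ltW i0) // -mulrBr opprK [_ + (_ - _)]addrC subrK mulr1 invrK scalerA divff ?scale1r //.
exact: lt0r_neq0.
Qed.

Lemma continuous_big_sum (T : topologicalType) (t : T) (I : Type) (s : seq I) (P : pred I)
    (F : I -> T -> R) : (forall i, P i -> {for t, continuous (F i)}) ->
  {for t, continuous (fun y : T => \sum_(i <- s | P i) F i y)}.
Proof.
apply: (continuous_at_big (x0 := fun=> 0)); last exact: continuous_at_cst.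
exact: continuous_at_add.
Qed.

Section ContinuousFamily.
Variables (T : topologicalType) (t : T) (x : T -> 'I_r -> R).
Hypothesis xc : forall p, {for t, continuous (fun y : T => x y p)}.

Lemma continuous_spread : {for t, continuous (fun y : T => spread (x y))}.
Proof.
apply: continuous_big_sum => p _; apply: continuous_big_sum => q _.
by apply: continuous_at_norm; apply: continuous_at_sub.
Qed.

Lemma continuous_level v : {for t, continuous (fun y : T => level (x y) v)}.
Proof.
apply: continuous_at_max; first exact: continuous_at_cst.
apply: continuous_at_big; first exact: continuous_at_min.
  exact: continuous_spread.
by move=> pq _; apply: continuous_at_sub.
Qed.

Lemma continuous_height : {for t, continuous (fun y : T => height (x y))}.
Proof.
apply: continuous_at_big; first exact: continuous_at_min.
  exact: continuous_spread.
move=> F _; apply: continuous_at_big; first exact: continuous_at_max.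
  rewrite (_ : (fun y : T => _) = fun y : T => 0 - spread (x y)); last by apply/funext => y; rewrite sub0r.
  by apply: continuous_at_sub; [exact: continuous_at_cst|exact: continuous_spread].
move=> pq _; apply: continuous_at_mul; last exact: continuous_at_cst.
exact: continuous_at_sub.
Qed.

Lemma continuous_chart k : {for t, continuous (fun y : T => chart (x y) ord0 k)}.
Proof.
rewrite (_ : (fun y : T => _) = fun y : T => x y (enum_val k) - x y (block_last (enum_val k)) -
  tilt (x y) * block_drop (enum_val k)); last by apply/funext => y; rewrite mxE.
apply: continuous_at_sub; first exact: continuous_at_sub.
apply: continuous_at_mul; last exact: continuous_at_cst.
by apply: continuous_at_mul; [exact: continuous_at_sub|exact: continuous_at_cst].
Qed.

End ContinuousFamily.

Lemma continuous_norm2 (T : topologicalType) (t : T) m (f : T -> 'rV[R]_m) :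
  (forall k, {for t, continuous (fun y : T => f y ord0 k)}) -> {for t, continuous (fun y : T => norm2 (f y))}.
Proof.
move=> fc; apply: continuous_at_sqrt; apply: continuous_big_sum => i _.
by apply: continuous_at_mul.
Qed.

Lemma continuous_to_ball z : realization K z -> {for z, continuous to_ball}.
Proof.
move=> Kz; have d0 := to_ball_den_gt0 Kz; apply: continuous_at_row => k.
have xc p : {for z, continuous (fun y : 'rV[R]_#|V| => point (weights y) p)}.
  apply: continuous_big_sum => v _; apply: continuous_at_mul; last exact: continuous_at_cst.
  exact: coord_continuous.
rewrite (_ : (fun y : 'rV[R]_#|V| => _) = fun y : 'rV[R]_#|V| => chart (point (weights y)) ord0 k /
   (norm2 (chart (point (weights y))) - height (point (weights y)))); last first.
  by apply/funext => y; rewrite mxE mulrC.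
apply: continuous_at_div; last exact: lt0r_neq0; first exact: continuous_chart.
apply: continuous_at_sub; last exact: continuous_height.
by apply: continuous_norm2 => i; apply: continuous_chart.
Qed.

Lemma continuous_of_ball u : norm2 u <= 1 -> {for u, continuous of_ball}.
Proof.
move=> u1; have t0 := total_cone_point_gt0 u1.
have cc p : {for u, continuous (fun y : 'rV[R]_n => chart_inv y p)}.
  apply: continuous_big_sum => k _; apply: continuous_at_mul; last exact: continuous_at_cst.
  exact: coord_continuous.
have xc p : {for u, continuous (fun y : 'rV[R]_n => cone_point y (1 - norm2 y) p)}.
  apply: continuous_at_sub; first exact: cc.
  apply: continuous_at_mul; last exact: continuous_at_cst.
  apply: continuous_at_add; last exact: continuous_height.
  apply: continuous_at_sub; first exact: continuous_at_cst.
  by apply: continuous_norm2 => k; apply: coord_continuous.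
apply: continuous_at_row => i; case: (boolP (enum_val i \in X)) => iX; last first.
  rewrite (_ : (fun y : 'rV[R]_n => _) = fun=> 0); first exact: continuous_at_cst.
  by apply/funext => y; rewrite mxE (negbTE iX).
rewrite (_ : (fun y : 'rV[R]_n => _) = fun y : 'rV[R]_n => level (cone_point y (1 - norm2 y)) (enum_val i) /
   total_level (cone_point y (1 - norm2 y))); last by apply/funext => y; rewrite mxE iX.
apply: continuous_at_div; last exact: lt0r_neq0; first exact: continuous_level.
by apply: continuous_big_sum => v _; apply: continuous_level.
Qed.

Lemma homeomorphic_ball : homeomorphic (realization (R := R) K) (@closed_ball_euclid R n).
Proof.
exists to_ball, of_ball; split.
- split; apply: continuous_in_subspaceT => y; rewrite inE.
    exact: continuous_to_ball.
  by move=> /ball_norm2; apply: continuous_of_ball.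
- split=> [_ [z Kz <-]|_ [u /ball_norm2 u1 <-]]; first exact: to_ball_in.
  exact: of_ball_in.
- exact: to_ballK.
- by move=> u /ball_norm2; apply: of_ballK.
Qed.

End Chart.

(** The first position of any natural pair is nonlast and can serve as [b0]; dropping it leaves one
    coordinate fewer than the polytope has. *)
Lemma simplicial_ball_ideal : cdim (generated_complex E) = #|nonlast| ->
  simplicial_ball R (generated_complex E).
Proof.
move=> dK; have /finset.set0Pn[F FE] := E_neq0.
have /finset.set0Pn[[p q]] := E_pairs FE; rewrite ordered_pairsP => /and3P[pq /eqP bpq _].
have pN : p \in nonlast by rewrite inE; apply/existsP; exists q; rewrite bpq eqxx.
rewrite /simplicial_ball dK (cardsD1 p) pN /=.
exact: homeomorphic_ball.
Qed.

End Ideal.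
End Ball.
End Geometry.
End BlockModel.

(** * Geometric lattices *)

Section Rank.
Local Open Scope order_scope.
Context {disp : Order.disp_t} {L : finTBLatticeType disp}.
Implicit Types (x y z : L) (X C : {set L}).

Lemma order_complexP X C :
  reflect (C \subset X /\ {in C &, forall x y, x >=< y}) (C \in order_complex X).
Proof.
rewrite inE; apply: (iffP andP) => -[CX].
  move=> /forall_inP h; split=> // x y xC yC.
  by move/forall_inP: (h x xC) => /(_ y yC).
move=> h; split=> //; apply/forall_inP => x xC; apply/forall_inP => y yC.
exact: h.
Qed.

Lemma rank_chain x C : C \in order_complex [set y | y <= x] -> (#|C|.-1 <= rank x)%N.
Proof. by move=> hC; rewrite /rank; exact: (@leq_bigmax_cond _ (mem (order_complex [set y | y <= x])) (fun C : {set L} => #|C|.-1)). Qed.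

Lemma rank_ex x : exists2 C : {set L}, x \in C /\ C \in order_complex [set y | y <= x] & #|C|.-1 = rank x.
Proof.
have h0 : [set x] \in order_complex [set y | y <= x].
  apply/order_complexP; split; first by rewrite sub1set inE.
  by move=> y z /set1P -> /set1P ->; rewrite comparablexx.
have [|C hC eC] := @eq_bigmax_cond _ (mem (order_complex [set y | y <= x]))
    (fun C : {set L} => #|C|.-1); first by apply/card_gt0P; exists [set x].
have eR : rank x = #|C|.-1 by rewrite -eC.
(* Adding [x] to a chain below [x] leaves a chain, so a longest one may be taken to contain [x]. *)
have hxC : x |: C \in order_complex [set y | y <= x].
  move/order_complexP: hC => [Cx hC]; apply/order_complexP; split.
    by rewrite subUset Cx sub1set inE lexx.
  have h z : z \in C -> z <= x by move/(subsetP Cx); rewrite inE.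
  move=> y z /setU1P[->|yC] /setU1P[->|zC]; rewrite ?comparablexx //.
  - by rewrite /Order.comparable h ?orbT.
  - by rewrite /Order.comparable h.
  - exact: hC.
exists (x |: C); first by rewrite setU11.
apply/eqP; rewrite eqn_leq rank_chain //= eR -!subn1 leq_sub2r //.
exact/subset_leq_card/subsetUr.
Qed.

Lemma rank_lt x y : x < y -> (rank x < rank y)%N.
Proof.
move=> xy; have [C [xC hC] <-] := rank_ex x.
have C0 : (0 < #|C|)%N by apply/card_gt0P; exists x.
rewrite prednK //.
have /order_complexP[Cx hC'] := hC.
have yC : y \notin C.
  by apply/negP => /(subsetP Cx); rewrite inE => /(lt_le_trans xy); rewrite ltxx.
suff /rank_chain : y |: C \in order_complex [set z | z <= y] by rewrite cardsU1 yC.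
apply/order_complexP; split.
  rewrite subUset sub1set inE lexx; apply/subsetP => z /(subsetP Cx).
  by rewrite !inE => /le_trans; apply; apply: ltW.
have h z : z \in C -> z <= y.
  by move/(subsetP Cx); rewrite inE => /le_trans; apply; apply: ltW.
move=> a b /setU1P[->|aC] /setU1P[->|bC]; rewrite ?comparablexx //.
- by rewrite /Order.comparable h ?orbT.
- by rewrite /Order.comparable h.
- exact: hC'.
Qed.

Lemma rank_le x y : x <= y -> (rank x <= rank y)%N.
Proof. by rewrite le_eqVlt => /predU1P[->|/rank_lt/ltnW]. Qed.

Lemma eq_rank x y : x <= y -> (rank y <= rank x)%N -> x = y.
Proof.
by rewrite le_eqVlt => /predU1P[->//|/rank_lt]; rewrite ltnNge => /negbTE ->.
Qed.

Lemma comparable_rank_le x y : x >=< y -> (rank x <= rank y)%N -> x <= y.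
Proof.
case/orP => // yx xy; have -> // : x = y.
by apply/esym; apply: eq_rank.
Qed.

Lemma rank_bot : rank (\bot : L) = 0.
Proof.
have [C [xC /order_complexP[hC _]] <-] := rank_ex (\bot : L).
suff -> : C = [set \bot] by rewrite cards1.
apply/eqP; rewrite eqEsubset sub1set xC andbT.
by apply/subsetP => z /(subsetP hC); rewrite !inE lex0.
Qed.

Lemma joins_seqP (I : eqType) (s : seq I) (F : I -> L) y :
  reflect (forall i, i \in s -> F i <= y) (\join_(i <- s) F i <= y).
Proof. by apply: (iffP (joinsP_seq _ _ _ _)) => h i; [move/h; apply|move/h]. Qed.

End Rank.

(** * Independent sequences of atoms *)

Section Atoms.
Local Open Scope order_scope.
Context {disp : Order.disp_t} {L : finTBLatticeType disp} {l : nat}.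
Variable a : 'I_l -> L.
Hypothesis geomL : geometric_lattice L.
Hypothesis atomP : forall x : L, atom x <-> exists i, a i = x.
Implicit Types (x y z : L) (s t u : seq 'I_l) (i j : 'I_l).

Definition joins s : L := \join_(i <- s) a i.

Definition indep_seq s := rank (joins s) == size s.

Lemma joins_cons i s : joins (i :: s) = a i `|` joins s.
Proof. by rewrite /joins big_cons. Qed.

Lemma joins_cat s t : joins (s ++ t) = joins s `|` joins t.
Proof. by rewrite /joins big_cat. Qed.

Lemma joins_rcons s i : joins (rcons s i) = joins s `|` a i.
Proof. by rewrite -cats1 joins_cat /joins big_seq1. Qed.

Lemma le_joins s i : i \in s -> a i <= joins s.
Proof. by move=> h; have /joins_seqP := lexx (joins s); apply. Qed.

Lemma joins_subset s t : {subset s <= t} -> joins s <= joins t.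
Proof. by move=> h; apply/joins_seqP => i /h /le_joins. Qed.

Lemma eq_joins s t : s =i t -> joins s = joins t.
Proof. by move=> h; apply/eqP; rewrite eq_le !joins_subset // => i; rewrite h. Qed.

Lemma joins_enum (A : {set 'I_l}) : \join_(i in A) a i = joins (enum A).
Proof. by rewrite /joins big_enum. Qed.

Lemma rank_atom i : rank (a i) = 1%N.
Proof.
have /atomP : exists j, a j = a i by exists i.
by case: geomL => -[gr _] _ /gr ->; rewrite rank_bot.
Qed.

Lemma rank_join_atom_le x i : (rank (x `|` a i) <= (rank x).+1)%N.
Proof.
case: geomL => -[_ sm] _; have := sm x (a i); rewrite rank_atom addn1.
by apply: leq_trans; apply: leq_addl.
Qed.

Lemma rank_join_atom x i : ~~ (a i <= x) -> rank (x `|` a i) = (rank x).+1.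
Proof.
move=> h; apply/eqP; rewrite eqn_leq rank_join_atom_le /=.
apply: rank_lt; rewrite lt_def leUl andbT; apply: contra h => /eqP <-.
exact: leUr.
Qed.

Lemma rank_joins_le x s : (rank (x `|` joins s) <= rank x + size s)%N.
Proof.
elim: s x => [|i s IH] x; first by rewrite /joins big_nil joinx0 addn0.
rewrite joins_cons joinA addnS -addSn; apply: leq_trans (IH _) _.
by rewrite leq_add2r rank_join_atom_le.
Qed.

Lemma rank_joins s : (rank (joins s) <= size s)%N.
Proof. by have := rank_joins_le \bot s; rewrite join0x rank_bot. Qed.

Lemma indep_catl s t : indep_seq (s ++ t) -> indep_seq s.
Proof.
rewrite /indep_seq joins_cat size_cat => /eqP e.
by rewrite eqn_leq rank_joins -(leq_add2r (size t)) -e rank_joins_le.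
Qed.

Lemma indep_perm s t : perm_eq s t -> indep_seq s = indep_seq t.
Proof. by move=> h; rewrite /indep_seq (perm_size h) (eq_joins (perm_mem h)). Qed.

Lemma indep_uniq s : indep_seq s -> uniq s.
Proof.
move=> h; have := rank_joins (undup s).
rewrite (eq_joins (mem_undup s)) (eqP h) => h2.
by apply/negPn; rewrite -ltn_size_undup -leqNgt.
Qed.

Lemma perm_sub_cat s t : uniq s -> uniq t -> {subset t <= s} ->
  perm_eq s (t ++ [seq i <- s | i \notin t]).
Proof.
move=> us ut ts; apply: uniq_perm => //.
  rewrite cat_uniq ut filter_uniq // andbT; apply/hasPn => i.
  by rewrite mem_filter => /andP[].
move=> i; rewrite mem_cat mem_filter; have := ts i.
by case: (i \in t) => //= ->.
Qed.

Lemma indep_sub s t : indep_seq s -> uniq t -> {subset t <= s} -> indep_seq t.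
Proof.
move=> si ut ts; apply: (@indep_catl _ [seq i <- s | i \notin t]).
by rewrite -(indep_perm (perm_sub_cat (indep_uniq si) ut ts)).
Qed.

Lemma indep_mem s t i : indep_seq s -> i \in s -> {subset t <= s} ->
  a i <= joins t -> i \in t.
Proof.
move=> si is_ ts h; apply/negPn/negP => it.
have : indep_seq (i :: undup t).
  apply: (indep_sub si); first by rewrite /= mem_undup it undup_uniq.
  by move=> j; rewrite inE mem_undup => /predU1P[->|/ts].
rewrite /indep_seq joins_cons (eq_joins (mem_undup t)) join_r //.
rewrite -(eq_joins (mem_undup t)) => /eqP e.
by have := rank_joins (undup t); rewrite e ltnn.
Qed.

Lemma atom_separates x y : ~~ (x <= y) -> exists2 i, a i <= x & ~~ (a i <= y).
Proof.
move=> h; case: geomL => _ at_.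
have [/existsP[i /andP[h1 h2]]|/pred0Pn h2] := boolP [exists i, (a i <= x) && ~~ (a i <= y)].
  by exists i.
case/negP: h; rewrite (at_ x); apply/joinsP => z /andP[/atomP[i <-] zx].
by apply/negPn/negP => h3; case: h2; exists i; rewrite /= zx.
Qed.

(** By semimodularity the rank of the meet of the two spans is at most the sum of the two sizes
    minus the size of the union, which is the size of the intersection. The span of the intersection
    lies below the meet and has that rank. *)
Lemma indep_meet s t1 t2 x : indep_seq s -> {subset t1 <= s} -> {subset t2 <= s} ->
  x <= joins t1 -> x <= joins t2 -> x <= joins [seq i <- t1 | i \in t2].
Proof.
move=> si s1 s2 x1 x2.
rewrite -(eq_joins (mem_undup t1)) in x1.
rewrite -(eq_joins (mem_undup t2)) in x2.
set u1 := undup t1 in x1; set u2 := undup t2 in x2.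
have i1 : indep_seq u1.
  by apply: (indep_sub si (undup_uniq _)) => i; rewrite mem_undup => /s1.
have i2 : indep_seq u2.
  by apply: (indep_sub si (undup_uniq _)) => i; rewrite mem_undup => /s2.
have c3 : indep_seq [seq i <- u1 | i \in u2].
  by apply: (indep_sub i1 (filter_uniq _ (undup_uniq _))) => i; rewrite mem_filter => /andP[].
have c4 : indep_seq (u1 ++ [seq i <- u2 | i \notin u1]).
  apply: (indep_sub si).
    rewrite cat_uniq undup_uniq filter_uniq ?undup_uniq // andbT.
    by apply/hasPn => i; rewrite mem_filter => /andP[].
  move=> i; rewrite mem_cat mem_filter !mem_undup => /orP[/s1//|/andP[_ /s2//]].
have -> : joins [seq i <- t1 | i \in t2] = joins [seq i <- u1 | i \in u2].
  by apply: eq_joins => i; rewrite !mem_filter !mem_undup.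
suff -> : joins [seq i <- u1 | i \in u2] = joins u1 `&` joins u2.
  by rewrite lexI x1.
apply: eq_rank.
  by rewrite lexI !joins_subset // => i; rewrite mem_filter => /andP[].
case: geomL => -[_ sm] _; have := sm (joins u1) (joins u2).
have -> : joins u1 `|` joins u2 = joins (u1 ++ [seq i <- u2 | i \notin u1]).
  rewrite -joins_cat; apply: eq_joins => i; rewrite !mem_cat mem_filter.
  by case: (i \in u1).
rewrite (eqP c3) (eqP c4) (eqP i1) (eqP i2) size_cat.
have -> : size u2 = (size [seq i <- u2 | i \notin u1] + size [seq i <- u1 | i \in u2])%N.
  rewrite -(count_predC (fun i => i \notin u1) u2) !size_filter; congr addn.
  rewrite -!size_filter; apply/perm_size/uniq_perm; rewrite ?filter_uniq ?undup_uniq //.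
  by move=> i; rewrite !mem_filter /= negbK andbC.
by rewrite addnC addnA leq_add2l.
Qed.


(** * Canonical words *)

Definition basis_seq u := indep_seq u && (size u == rank (\top : L)).

Definition passes (G : {set L}) u := forall g, g \in G -> exists n, g = word_chain a u n.

(** The letters are the labels of the chain in the standard EL-labeling of a geometric lattice,
    which marks a cover with the smallest atom below its top but not below its bottom. *)
Definition min_labeled u := forall b i, b \in u ->
  a i <= word_chain a u (index b u).+1 -> ~~ (a i <= word_chain a u (index b u)) ->
  (b <= i)%N.

Definition ascends_at (D : pred nat) u := forall b c, b \in u -> c \in u ->
  index c u = (index b u).+1 -> D (index c u) -> (b < c)%N.

(** In the EL-labeling this is the chain through [G] whose labels rise in every interval left
    between consecutive members of [G]. *)
Definition canonical (G : {set L}) u :=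
  [/\ basis_seq u, min_labeled u, passes G u &
      ascends_at (fun n => word_chain a u n \notin G) u].

Lemma basis_seq_uniq u : basis_seq u -> uniq u.
Proof. by case/andP => /indep_uniq. Qed.

Lemma basis_seq_size u : basis_seq u -> size u = rank (\top : L).
Proof. by case/andP => _ /eqP. Qed.

Lemma joins_basis_seq u : basis_seq u -> joins u = \top.
Proof. by case/andP => /eqP h /eqP s; apply: eq_rank; rewrite ?lex1 // h s. Qed.

Lemma basis_seq_perm u v : perm_eq u v -> basis_seq u -> basis_seq v.
Proof. by move=> h; rewrite /basis_seq (indep_perm h) (perm_size h). Qed.

Lemma rank_word_chain u n : basis_seq u -> (n <= size u)%N -> rank (word_chain a u n) = n.
Proof.
case/andP => iu _ hn; rewrite -(cat_take_drop n u) in iu.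
by have /eqP -> := indep_catl iu; rewrite size_takel.
Qed.

Lemma word_chain_le u m n : (m <= n)%N -> word_chain a u m <= word_chain a u n.
Proof.
by move=> h; apply: joins_subset => i; rewrite -(take_takel u h); apply: mem_take.
Qed.

Lemma word_chain_size u n : basis_seq u -> (size u <= n)%N -> word_chain a u n = \top.
Proof. by move=> bu h; rewrite -(joins_basis_seq bu) /word_chain take_oversize. Qed.

Lemma word_chain0 u : word_chain a u 0 = \bot.
Proof. by rewrite /word_chain take0 big_nil. Qed.

Lemma le_word_chain u b n : basis_seq u -> b \in u ->
  (a b <= word_chain a u n) = (index b u < n)%N.
Proof.
move=> bu ub; rewrite -in_take //; apply/idP/idP; last exact: le_joins.
case/andP: bu => iu _; apply: (indep_mem iu) => // i; exact: mem_take.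
Qed.

Lemma introduces u i : basis_seq u -> exists b,
  [/\ b \in u, a i <= word_chain a u (index b u).+1 & ~~ (a i <= word_chain a u (index b u))].
Proof.
move=> bu.
have ex : exists n, a i <= word_chain a u n.
  by exists (size u); rewrite word_chain_size // lex1.
case: (ex_minnP ex) => -[|n] h1 h2.
  move: h1; rewrite word_chain0 lex0 => /eqP e.
  by have := rank_atom i; rewrite e rank_bot.
have hn : (n < size u)%N.
  rewrite ltnNge; apply/negP => /(word_chain_size bu) e.
  by have := h2 n; rewrite e lex1 ltnn => /(_ isT).
exists (nth i u n); rewrite index_uniq ?basis_seq_uniq // mem_nth //; split=> //.
by apply/negP => /h2; rewrite ltnn.
Qed.

Lemma word_chain_inj_index u b c : basis_seq u -> b \in u -> c \in u ->
  index b u = index c u -> b = c.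
Proof. by move=> bu hb hc e; rewrite -(nth_index b hb) e nth_index. Qed.

(** From [b] on the letters rise until the chain meets a member of [G], which is then above [b] but
    not above [c]. *)
Lemma ascent_or_separated (G : {set L}) u b c :
  basis_seq u -> passes G u -> ascends_at (fun n => word_chain a u n \notin G) u ->
  b \in u -> c \in u -> (index b u < index c u)%N ->
  (b < c)%N \/ exists2 g, g \in G & (a b <= g) && ~~ (a c <= g).
Proof.
move=> bu pu asc hb hc; move e : (index c u - index b u)%N => k.
elim: k b hb e => [|k IH] b hb e lt.
  by move/eqP: e; rewrite subn_eq0 leqNgt lt.
have hn : ((index b u).+1 < size u)%N by apply: leq_ltn_trans lt _; rewrite index_mem.
set d := nth b u (index b u).+1.
have hd : d \in u by apply: mem_nth.
have id : index d u = (index b u).+1 by rewrite index_uniq ?basis_seq_uniq.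
have [Gn|Gn] := boolP (word_chain a u (index d u) \in G).
  right; exists (word_chain a u (index d u)) => //.
  by rewrite !le_word_chain // id leqnn /= -leqNgt.
have bd := asc b d hb hd id Gn.
case: (ltngtP (index d u) (index c u)) => [dc|dc|dc]; first last.
- by rewrite -(word_chain_inj_index bu hd hc dc); left.
- by move: dc; rewrite id ltnS leqNgt lt.
have ek : (index c u - index d u)%N = k by rewrite id subnS e.
case: (IH d hd ek dc) => [dc'|[g gG /andP[h1 h2]]]; first by left; apply: ltn_trans dc'.
right; exists g => //; rewrite h2 andbT; have [n eg] := pu g gG.
move: h1; rewrite eg !le_word_chain // id; exact: ltnW.
Qed.

(* At the smallest difference of the letter sets, the canonical word has the
   smaller letter. *)
Lemma canonical_exchange (G : {set L}) u v c :
  canonical G u -> basis_seq v -> passes G v -> c \in v -> c \notin u ->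
  (forall i, (i < c)%N -> i \in u -> i \in v) -> False.
Proof.
move=> [bu mu pu asc] bv pv cv cu low.
(* [d] is the letter with which [u] first spans [c]; minimality of the labels gives [d < c]. *)
have [d [du h1 h2]] := introduces c bu; set t := index d u in h1 h2.
have dc : (d < c)%N.
  rewrite ltn_neqAle (mu d c du h1 h2) andbT; apply: contra cu => /eqP e.
  by rewrite -(val_inj e).
(* These letters of [v] span all of [u] up to [d], hence [c]: a letter not after [d] is smaller than
   [c] and so in [v], or it is below a member of [G] that both chains pass. As [c] is not among
   them, [v] would be dependent. *)
pose Y := [seq b : 'I_l <- v | (b < c)%N || (a b <= word_chain a u t)].
have /(le_trans h1) : word_chain a u t.+1 <= joins Y.
  rewrite /word_chain; apply/joins_seqP => b; case: (boolP (b \in u)) => [bu' | bu' /mem_take]; last first.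
    by rewrite (negbTE bu').
  rewrite in_take // ltnS leq_eqVlt => bt.
  have [bc|[g gG /andP[g1 g2]]] : (b < c)%N \/ exists2 g, g \in G & (a b <= g) && ~~ (a d <= g).
    case/orP: bt => [/eqP bt|bt]; first by rewrite (word_chain_inj_index bu bu' du bt); left.
    case: (ascent_or_separated bu pu asc bu' du bt) => [bd|]; last by right.
    by left; apply: ltn_trans dc.
  - by apply: le_joins; rewrite mem_filter bc low.
  - have gt : g <= word_chain a u t.
      have [n en] := pu g gG; move: g2; rewrite en le_word_chain // -leqNgt.
      exact: word_chain_le.
    apply: (le_trans g1); have [n en] := pv g gG; rewrite en.
    apply: joins_subset => e he; rewrite mem_filter (mem_take he) andbT.
    apply/orP; right; apply: le_trans gt; rewrite en; exact: le_joins.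
case/andP: (bv) => iv _ /(indep_mem iv cv); rewrite mem_filter ltnn /= (negbTE h2) => h.
by suff: false by []; apply: h => e; rewrite mem_filter => /andP[].
Qed.

(** When [w] is the label of c_i^j, these are the labels of the chains in C_i^j. *)
Definition agrees (S : pred nat) w u := perm_eq u w /\
  forall n, (n <= size w)%N -> ~~ S n -> word_chain a u n = word_chain a w n.

Definition descends_at (D : pred nat) u := forall b c, b \in u -> c \in u ->
  index c u = (index b u).+1 -> D (index c u) -> (c < b)%N.

(** If [y < x], then [x] is too large for the rest of its block in [w'], and another letter [g]
    takes its place among the first [n1]. The ascents of [u] make [g] larger than [x], the descents
    of [w'] make it at most [y]. *)
Lemma canonical_first_difference (G : {set L}) (S : pred nat) u u' w w' (p s s' : seq 'I_l) (x y : 'I_l) :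
  canonical G u -> basis_seq u' -> passes G u' -> agrees S w u -> agrees S w' u' ->
  descends_at S w' -> perm_eq w w' -> ~~ S (size w) ->
  w = p ++ x :: s -> w' = p ++ y :: s' -> x != y -> (x < y)%N.
Proof.
move=> [bu _ pu asc] bu' pu' [pw aw] [pw' aw'] dw' pww' Sr ew ew' xy.
have bw : basis_seq w by apply: basis_seq_perm bu.
have bw' : basis_seq w' by apply: basis_seq_perm bu'.
rewrite ltnNge leq_eqVlt eq_sym (inj_eq val_inj) (negbTE xy) /=; apply/negP => yx.
set n := size p.
have sw : (n < size w)%N by rewrite ew size_cat /= addnS ltnS leq_addr.
(* [n1] is the end of the block of the first difference. At this rank [u] has the same flat as [w],
   and [u'] the same as [w']. *)
have [n1 [nn1 n1r n1S n1m]] : exists n1, [/\ (n < n1)%N, (n1 <= size w)%N, ~~ S n1 &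
    forall m, (n < m)%N -> (m < n1)%N -> S m].
  have ex : exists m, [&& (n < m)%N, (m <= size w)%N & ~~ S m].
    by exists (size w); rewrite sw leqnn Sr.
  case: (ex_minnP ex) => m /and3P[m1 m2 m3] m4; exists m; split=> // k k1 k2.
  apply/negPn/negP => k3; have := m4 k; rewrite k1 k3 (ltnW (leq_trans k2 m2)) => /(_ isT).
  by rewrite leqNgt k2.
have ssw : size w' = size w by rewrite (perm_size pww').
have cw : word_chain a u n1 = word_chain a w n1 by apply: aw.
have cw' : word_chain a u' n1 = word_chain a w' n1 by apply: aw'; rewrite ?ssw.
have iw : uniq w by apply: basis_seq_uniq.
have iw' : uniq w' by apply: basis_seq_uniq.
have xw : x \in w by rewrite ew mem_cat mem_head orbT.
have xw' : x \in w' by rewrite -(perm_mem pww').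
have ix : index x w = n.
  rewrite ew index_cat /= eqxx addn0; move: iw; rewrite ew cat_uniq.
  by case/and3P => _ /hasPn/(_ x (mem_head _ _)) /negbTE ->.
have iy : index y w' = n.
  rewrite ew' index_cat /= eqxx addn0; move: iw'; rewrite ew' cat_uniq.
  by case/and3P => _ /hasPn/(_ y (mem_head _ _)) /negbTE ->.
have yw' : y \in w' by rewrite ew' mem_cat mem_head orbT.
have blk b : b \in w' -> (n <= index b w')%N -> (index b w' < n1)%N -> (b <= y)%N.
  move e : (index b w' - n)%N => k; elim: k b e => [|k IH] b e bw'' h1 h2.
    have -> // : b = y; apply: (word_chain_inj_index bw') => //.
    by apply/eqP; rewrite eqn_leq iy h1 -subn_eq0 e.
  have ib : (0 < index b w')%N by apply: leq_trans (leq_subr n _); rewrite e.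
  pose c := nth b w' (index b w').-1.
  have hc : ((index b w').-1 < size w')%N by rewrite prednK // ltnW // index_mem.
  have cw'' : c \in w' by apply: mem_nth.
  have ic : index c w' = (index b w').-1 by rewrite index_uniq.
  have nb : (n < index b w')%N by rewrite -subn_gt0 e.
  apply: leq_trans (IH c _ cw'' _ _).
  - apply: ltnW; apply: (dw' c b) => //; first by rewrite ic prednK.
    exact: n1m.
  - by rewrite ic -subn1 subnAC e subn1.
  - by rewrite ic -ltnS prednK.
  - by rewrite ic; apply: leq_ltn_trans (leq_pred _) h2.
have xn1 : ~~ (index x w' < n1)%N.
  apply/negP => h; have [h3|h3] := leqP n (index x w').
    by have := blk x xw' h3 h; rewrite leqNgt yx.
  have : x \in p.
    by move: h3; rewrite -in_take // ew' take_size_cat.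
  move: iw; rewrite ew cat_uniq => /and3P[_ /hasPn/(_ x (mem_head _ _))] h4 _.
  by rewrite (negbTE h4).
(* The two flats of rank [n1] differ, as only one of them is above [x]; having equal rank, the one
   of [w'] is not below the other. *)
have [g [gw' gn1 gnw]] : exists c, [/\ c \in w', (index c w' < n1)%N & ~~ (a c <= word_chain a w n1)].
  have [/allP h|/allPn[c c1 c2]] := boolP (all (fun c => a c <= word_chain a w n1) (take n1 w')).
    have e : word_chain a w' n1 = word_chain a w n1.
      apply: eq_rank; first by rewrite [X in X <= _]/word_chain; apply/joins_seqP => c /h.
      by rewrite !rank_word_chain ?ssw.
    by case/negP: xn1; rewrite -le_word_chain // e le_word_chain // ix.
  by exists c; split=> //; have := mem_take c1 => // cc; rewrite -in_take.
have gu : g \in u by rewrite (perm_mem pw) (perm_mem pww').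
have xu : x \in u by rewrite (perm_mem pw).
have xg : (index x u < index g u)%N.
  apply: (@leq_trans n1); first by rewrite -le_word_chain // cw le_word_chain // ix.
  by rewrite leqNgt -le_word_chain // cw.
(* In [u] the letter [x] precedes [g], but in [u'] it follows [g]. So no member of [G] is above [x]
   without being above [g], and only the ascent remains. *)
have gx : (x < g)%N.
  case: (ascent_or_separated bu pu asc xu gu xg) => // -[h hG /andP[h1 h2]].
  have [m em] := pu' h hG; have [m1|m1] := leqP m n1.
    case/negP: xn1; rewrite -le_word_chain // -cw'.
    by apply: (le_trans h1); rewrite em; apply: word_chain_le.
  case/negP: h2; rewrite em; apply: le_trans (word_chain_le _ (ltnW m1)).
  by rewrite cw' le_word_chain.
have [h3|h3] := leqP n (index g w').
  by have := leq_trans gx (ltnW (leq_ltn_trans (blk g gw' h3 gn1) yx)); rewrite ltnn.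
case/negP: gnw; rewrite le_word_chain // ?(perm_mem pww') //.
have gp : g \in p by move: h3; rewrite -in_take // ew' take_size_cat.
by rewrite ew index_cat gp; apply: ltn_trans nn1; rewrite index_mem.
Qed.

Section CanonicalWord.
Variable G : {set L}.
Hypothesis chainG : {in G &, forall x y, x >=< y}.

(** The first member of the chain [G] that is not below [x]; the empty meet makes it the top when
    there is none. *)
Let target x : L := \meet_(g in G | ~~ (g <= x)) g.

Let target_le x g : g \in G -> ~~ (g <= x) -> target x <= g.
Proof. by move=> gG h; apply: meets_inf; rewrite gG. Qed.

Let target_ge x y : (forall g, g \in G -> ~~ (g <= x) -> y <= g) -> y <= target x.
Proof. by move=> h; apply/meetsP => g /andP[]; apply: h. Qed.

Let targetP x : target x = \top \/ target x \in G /\ ~~ (target x <= x).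
Proof.
have [/pred0P h|/pred0Pn[g0 h0]] := boolP (pred0b (fun g => (g \in G) && ~~ (g <= x))).
  by left; rewrite /target big_pred0.
right; case: (@arg_minnP _ g0 (fun g => (g \in G) && ~~ (g <= x)) (@rank _ L) h0) => g /andP[gG gx] hg.
suff -> : target x = g by [].
apply/eqP; rewrite eq_le target_le //=; apply: target_ge => h hG hx.
by apply: comparable_rank_le; [apply: chainG|apply: hg; rewrite hG].
Qed.

(** The last clause hands the greedy choice on to the next step: unless a member of [G] has just
    been reached, the next atom was already available, so the labels rise. *)
Let partial u :=
  [/\ indep_seq u,
      forall g, g \in G -> if g <= joins u then exists2 m, (m <= size u)%N & g = word_chain a u m
                           else joins u <= g,
      min_labeled u, ascends_at (fun n => word_chain a u n \notin G) u &
      forall b, b \in u -> (index b u).+1 = size u -> joins u \notin G ->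
        forall i, a i <= target (joins u) -> ~~ (a i <= joins u) -> (b <= i)%N].

Let partial_ex n : (n <= rank (\top : L))%N -> exists2 u, size u = n & partial u.
Proof.
elim: n => [_|n IH hn].
  exists [::] => //; split=> //; first by rewrite /indep_seq /joins big_nil rank_bot.
  move=> g gG; rewrite /joins big_nil; case: ifP; last by rewrite le0x.
  by rewrite lex0 => /eqP ->; exists 0%N => //; rewrite word_chain0.
have [u su [iu passu mu au lu]] := IH (ltnW hn); set x := joins u in lu passu.
have xT : x != \top.
  by apply/eqP => e; have := eqP iu; rewrite -/x e su => e2; rewrite e2 ltnn in hn.
have tx : ~~ (target x <= x).
  by case: (targetP x) => [->|[]//]; rewrite le1x.
have xt : x <= target x.
  by apply: target_ge => g gG /negbTE h; have := passu g gG; rewrite h.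
have [i0 h0 h0'] := atom_separates tx.
have P0 : (a i0 <= target x) && ~~ (a i0 <= x) by rewrite h0.
case: (@arg_minnP _ i0 (fun i => (a i <= target x) && ~~ (a i <= x)) (fun i : 'I_l => i : nat) P0) => i /andP[it ix] imin.
have iu' : i \notin u by apply: contra ix; exact: le_joins.
pose v := rcons u i.
have jv : joins v = x `|` a i by rewrite /v joins_rcons.
have vt : joins v <= target x by rewrite jv leUx xt.
have sv : size v = n.+1 by rewrite size_rcons su.
have tkv m : (m <= n)%N -> word_chain a v m = word_chain a u m.
  by rewrite -su => hm; rewrite /word_chain /v -cats1 takel_cat.
have wvn : word_chain a v n = x by rewrite tkv // /word_chain -su take_size.
have wvS : word_chain a v n.+1 = joins v by rewrite /word_chain -sv take_size.
have ixu b : b \in u -> index b v = index b u by move=> bu; rewrite /v -cats1 index_cat bu.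
have ixi : index i v = n by rewrite /v -cats1 index_cat (negbTE iu') /= eqxx addn0.
have ltu b : b \in u -> (index b u < n)%N by rewrite -su index_mem.
have memv b : b \in v = (b == i) || (b \in u) by rewrite mem_rcons inE.
have xv : x <= joins v by rewrite jv leUl.
exists v => //; split.
- by rewrite /indep_seq jv rank_join_atom // (eqP iu) sv su.
- move=> g gG; have := passu g gG; case: (boolP (g <= x)) => gx.
    rewrite (le_trans gx xv) => -[m hm ->]; exists m; first by rewrite sv -su leqW.
    by rewrite tkv // -su.
  move=> _; have vg : joins v <= g by apply: le_trans vt _; apply: target_le.
  case: ifP => // gv; exists n.+1; first by rewrite sv.
  by rewrite wvS; apply/eqP; rewrite eq_le gv.
- move=> b j; rewrite memv => /predU1P[->|bu]; last first.
    rewrite ixu // !tkv ?ltu // ?(ltnW (ltu b bu)) //; exact: mu.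
  rewrite ixi wvS wvn => h1 h2; apply: imin; rewrite h2 andbT.
  exact: le_trans vt.
- move=> b c; rewrite !memv => /predU1P[->|bu] /predU1P[->|cu].
  + by move/eqP; rewrite eqn_leq ltnn andbF.
  + by rewrite ixi ixu // => h; have := ltu c cu; rewrite h ltnNge leqnSn.
  + rewrite ixi ixu // wvn => h nG.
    rewrite ltn_neqAle (lu b bu) ?su // andbT.
    by apply: contra iu' => /eqP/val_inj <-.
  + rewrite !ixu // => h; rewrite tkv ?(ltnW (ltu c cu)) //; exact: au.
(* Since the new join is not in [G], the old target has not been reached. An atom available next is
   below it too and was therefore a candidate for [i]. *)
- move=> b bv; rewrite sv => -[] hb vG j h1 h2.
  have -> : b = i.
    move: bv; rewrite memv => /predU1P[//|bu].
    by have := ltu b bu; rewrite -(ixu b bu) hb ltnn.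
  apply: imin; rewrite (contra _ h2) ?andbT => [|h]; last exact: le_trans xv.
  apply: (le_trans h1).
  case: (targetP x) => [->|[tG _]]; first exact: lex1.
  apply: target_le => //; apply: contra vG => h.
  suff -> : joins v = target x by [].
  by apply/eqP; rewrite eq_le vt.
Qed.

Lemma canonical_exists : exists u, canonical G u.
Proof.
have [u su [iu pu mu au _]] := partial_ex (leqnn _).
have bu : basis_seq u by rewrite /basis_seq iu su eqxx.
exists u; split=> // g gG; have := pu g gG.
by rewrite (joins_basis_seq bu) lex1 => -[m _]; exists m.
Qed.

End CanonicalWord.

(** * Bases, broken circuits and block sorting *)

Lemma independentE (A : {set 'I_l}) : independent a A = indep_seq (enum A).
Proof. by rewrite /independent /matroid_rank joins_enum /indep_seq cardE. Qed.

Lemma perm_enum_set u : uniq u -> perm_eq u (enum [set i in u]).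
Proof.
move=> h; apply: uniq_perm => //; first exact: enum_uniq.
by move=> i; rewrite mem_enum inE.
Qed.

Lemma basis_basis_seq (B : {set 'I_l}) : basis a B -> basis_seq (enum B).
Proof.
case/maxsetP; rewrite independentE => iB hB; rewrite /basis_seq iB eqn_leq.
rewrite -{1}(eqP iB) rank_le ?lex1 //= leqNgt; apply/negP => lt.
have hT : ~~ (\top <= joins (enum B)).
  by apply/negP => /rank_le; rewrite (eqP iB) leqNgt lt.
have [i _ hi] := atom_separates hT.
have iB' : i \notin B by apply: contra hi => h; apply: le_joins; rewrite mem_enum.
have : independent a (i |: B).
  rewrite independentE /indep_seq -cardE cardsU1 iB' cardE add1n -(eqP iB).
  have -> : joins (enum (i |: B)) = joins (i :: enum B).
    by apply: eq_joins => j; rewrite !(inE, mem_enum).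
  by rewrite joins_cons joinC rank_join_atom.
move/hB => /(_ (subsetUr _ _)) e; case/negP: iB'; rewrite -e; exact: setU11.
Qed.

Lemma basis_seq_basis u : basis_seq u -> basis a [set i in u].
Proof.
move=> bu; have pu := perm_enum_set (basis_seq_uniq bu).
apply/maxsetP; rewrite independentE -(indep_perm pu); split; first by case/andP: bu.
move=> B iB sB; apply/esym/eqP; rewrite eqEcard sB /= -(eqP iB).
rewrite cardE -(perm_size pu) (basis_seq_size bu); exact: rank_le (lex1 _).
Qed.

(** Let [u] contain a circuit [C] without its least element [i]. The letter [b] with which [i]
    becomes spanned is at most [i], and by [indep_meet] it lies in [C :\ i], against the choice of
    [i]. *)
Lemma min_labeled_nbc u : basis_seq u -> min_labeled u -> nbc_basis a [set i in u].
Proof.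
move=> bu mu; rewrite /nbc_basis basis_seq_basis //=; apply/existsPn => A.
apply/negP => /andP[/existsP[C /existsP[i /and4P[cC iC /forall_inP minC /eqP ->]]] sCu].
have Cu : {subset enum (C :\ i) <= u}.
  by move=> c; rewrite mem_enum => /(subsetP sCu); rewrite inE.
have hi : a i <= joins (enum (C :\ i)).
  case/minsetP: cC => nC mC; apply/negPn/negP => h.
  have : independent a (C :\ i).
    apply/negPn/negP => h2; have := mC _ h2 (subD1set _ _).
    by move/setP/(_ i); rewrite !inE eqxx iC.
  rewrite independentE => /eqP e; case/negP: nC; rewrite independentE /indep_seq.
  have -> : joins (enum C) = joins (i :: enum (C :\ i)).
    apply: eq_joins => j; rewrite !(inE, mem_enum).
    by case: eqP => // ->; rewrite iC.
  rewrite joins_cons joinC rank_join_atom // e -!cardE (cardsD1 i C) iC.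
  by [].
have [b [bu' h1 h2]] := introduces i bu.
have bi := mu b i bu' h1 h2.
have bC : b \in C :\ i.
  apply/negPn/negP => bC; case/negP: h2.
  case/andP: (bu) => iu _.
  have := indep_meet iu Cu (fun j => @mem_take _ _ _ _) hi h1.
  move/le_trans; apply; apply: joins_subset => c; rewrite mem_filter mem_enum => /andP[c1 c2].
  have cu : c \in u := mem_take c1.
  move: c1; rewrite !in_take // ltnS leq_eqVlt => /predU1P[e|//].
  by move: bC; rewrite -(word_chain_inj_index bu cu bu' e) c2.
move: bC; rewrite !inE => /andP[nbi bC].
have := minC b bC; rewrite leq_eqVlt ltnNge bi orbF => /eqP/val_inj e.
by rewrite e eqxx in nbi.
Qed.

Lemma eq_word_chain_take u v n : basis_seq u -> perm_eq u v ->
  word_chain a u n = word_chain a v n -> take n u =i take n v.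
Proof.
move=> bu p e b; have bv := basis_seq_perm p bu.
case: (boolP (b \in u)) => ub.
  have vb : b \in v by rewrite -(perm_mem p).
  by rewrite !in_take // -(le_word_chain n bu ub) -(le_word_chain n bv vb) e.
by apply/idP/idP => /mem_take; rewrite -?(perm_mem p) (negbTE ub).
Qed.

Lemma agrees_take (S : pred nat) w u n : basis_seq u -> agrees S w u ->
  (n <= size w)%N -> ~~ S n -> take n u =i take n w.
Proof. by move=> bu [p h] hn Sn; apply: eq_word_chain_take => //; apply: h. Qed.

(** Sorting each block decreasingly makes every position in [S] a descent. The ascents at block ends
    survive, as the last letter of a block can only decrease and the first letter of the next can
    only increase. *)
Lemma block_sort (S : pred nat) u : basis_seq u -> ascends_at (predC S) u ->
  exists w, [/\ agrees S w u, descends_at S w & ascends_at (predC S) w].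
Proof.
move=> bu au; have uu := basis_seq_uniq bu.
pose k b := block_index S (index b u).
pose leT : rel 'I_l := fun b c => (k b < k c)%N || ((k b == k c) && (c <= b)%N).
have leT_trans : transitive leT.
  move=> c b d /orP[h1|/andP[/eqP e1 h1]] /orP[h2|/andP[/eqP e2 h2]]; rewrite /leT.
  - by rewrite (ltn_trans h1 h2).
  - by rewrite -e2 h1.
  - by rewrite e1 h2.
  - by rewrite e1 e2 eqxx (leq_trans h2 h1) orbT.
have leT_total : total leT.
  move=> b c; rewrite /leT; case: (ltngtP (k b) (k c)) => //= _; exact: leq_total.
pose w := sort leT u.
have pw : perm_eq u w by rewrite perm_sym perm_sort.
have sw : sorted leT w by apply: sort_sorted.
have uw : uniq w by rewrite sort_uniq.
have memw b : b \in w = (b \in u) by rewrite mem_sort.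
have szw : size w = size u by rewrite size_sort.
have tk n : (n <= size w)%N -> ~~ S n -> take n u =i take n w.
  move=> hn Sn; have := @take_pairwise _ (mem (take n u)) w.
  have -> : count (mem (take n u)) w = n.
    by rewrite -(seq.permP pw) count_mem_takel // -szw.
  move=> ->.
    by move=> b; rewrite mem_filter memw /=; case: (boolP (b \in take n u)) => // /mem_take ->.
  apply: (sorted_pairwise_closed leT_trans sw) => b c; rewrite !memw => ub uc cb /=.
  rewrite !in_take // => bn; rewrite ltnNge; apply/negP => cn.
  have kk : (k b < k c)%N by apply: block_index_lt cn.
  by move: cb; rewrite /leT ltnNge (ltnW kk) /= (gtn_eqF kk).
have lew b c : b \in w -> c \in w -> (index b w < index c w)%N -> leT b c.
  move=> wb wc h; have := sorted_ltn_nth leT_trans b sw.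
  by move=> /(_ (index b w) (index c w)); rewrite !inE !index_mem !nth_index //; apply.
exists w; split.
- split=> // n hn Sn; apply: eq_joins; exact: tk.
- move=> b c wb wc e Sc; have := lew b c wb wc; rewrite e => /(_ (leqnn _)).
  case/orP => [/block_index_ltP[j [j1 j2 j3]]|/andP[_ cb]]; last first.
    rewrite ltn_neqAle cb andbT; apply/eqP => /val_inj e2.
    by move: e; rewrite e2 => /eqP; rewrite eqn_leq ltnn andbF.
  have jw : (j <= size w)%N.
    by rewrite szw; apply: leq_trans j3 _; rewrite ltnW // index_mem -memw.
  have hb : (index b w < j)%N by rewrite -in_take // -tk // in_take -?memw.
  have hc : ~~ (index c w < j)%N by rewrite -in_take // -tk // in_take -?memw // -leqNgt.
  have ej : j = index c w by apply/eqP; rewrite eqn_leq e hb andbT -e leqNgt.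
  by move: j1; rewrite ej Sc.
- move=> b c wb wc e /= Sc; set p := index c w in e Sc.
  have pw' : (p < size w)%N by rewrite index_mem.
  have tp := tk p (ltnW pw') Sc.
  have p1 : (p.-1 < size u)%N by rewrite -szw e /=; apply: ltnW; rewrite -e.
  pose b' := nth b u p.-1; pose c' := nth b u p.
  have ub' : b' \in u by apply: mem_nth.
  have uc' : c' \in u by apply: mem_nth; rewrite -szw.
  have ib' : index b' u = index b w by rewrite index_uniq // e.
  have ic' : index c' u = p by rewrite index_uniq // -szw.
  have bc' : (b' < c')%N by apply: au; rewrite // ?ic' ?ib'.
  have bt : (index b u < p)%N by rewrite -in_take -?memw // tp in_take // e.
  have ct : (p <= index c u)%N by rewrite leqNgt -in_take -?memw // tp in_take // ltnn.
  have bb : (b <= b')%N.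
    have : (index b' w < p)%N by rewrite -in_take ?memw // -tp in_take // ib' e.
    rewrite e ltnS leq_eqVlt => /predU1P[eq|lt].
      by rewrite -(nth_index b wb) -eq nth_index ?memw.
    have wb' : b' \in w by rewrite memw.
    case/orP: (lew b' b wb' wb lt) => [/block_index_ltP[j [j1 j2 j3]]|/andP[]//].
    rewrite ib' -e in j2.
    by have := leq_ltn_trans (leq_trans j2 j3) bt; rewrite ltnn.
  have cc : (c' <= c)%N.
    have : (p <= index c' w)%N by rewrite leqNgt -in_take ?memw // -tp in_take // ic' ltnn.
    rewrite leq_eqVlt => /predU1P[eq|lt].
      by rewrite -(nth_index b wc) -/p eq nth_index ?memw.
    have wc' : c' \in w by rewrite memw.
    case/orP: (lew c c' wc wc' lt) => [/block_index_ltP[j [j1 j2 j3]]|/andP[]//].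
    rewrite ic' in j3.
    by have := leq_trans j2 (leq_trans j3 ct); rewrite ltnn.
  exact: leq_ltn_trans bb (leq_trans bc' cc).
Qed.

(** * Maximal chains of the posets L_i^j *)

Variable S : {fset nat}.
Hypothesis S_ranks : forall n : nat, n \in S -> (0 < n <= (rank (\top : L)).-1)%N.
Let inS := fun n => n \in S.

Lemma mem_S_lt n : n \in S -> (n < rank (\top : L))%N.
Proof. by move/S_ranks/andP => []; case: (rank _) => [|m]; [case: n|]. Qed.

Lemma mem_S_gt0 n : n \in S -> (0 < n)%N.
Proof. by move/S_ranks/andP => []. Qed.

Lemma rank_top_notin_S : rank (\top : L) \notin S.
Proof. by apply/negP => /mem_S_lt; rewrite ltnn. Qed.

Lemma basis_wordP (B : {set 'I_l}) w :
  (exists s : {perm 'I_#|B|}, w = basis_word s) <-> perm_eq w (enum B).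
Proof.
have e (s : {perm 'I_#|B|}) :
    basis_word s = [tuple tnth (enum_tuple B) (s p) | p < #|B|].
  rewrite /basis_word /=; apply: eq_map => p; rewrite /enum_val.
  by rewrite (tnth_nth (enum_default (s p))).
split=> [[s ->]|h].
  by rewrite e; apply/tuple_permP; exists s.
by have /tuple_permP[s es] : perm_eq w (enum_tuple B) by []; exists s; rewrite e es.
Qed.

Lemma descent_setP w : basis_seq w ->
  (descent_set w == S) <-> descends_at inS w /\ ascends_at (predC inS) w.
Proof.
move=> bw; have uw := basis_seq_uniq bw; have sw := basis_seq_size bw.
have hd b c : b \in w -> c \in w -> index c w = (index b w).+1 ->
    (index c w \in descent_set w) = (c < b)%N.
  move=> wb wc e; rewrite !inE mem_filter mem_iota /= e.
  have h : ((index b w).+1 < size w)%N by rewrite -e index_mem.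
  have -> : ((index b w).+1 < 1 + (size w).-1)%N by rewrite add1n prednK // (leq_ltn_trans _ h).
  by rewrite andbT ltn0Sn andbT -{1}e /= !(nth_map b) ?index_mem // !nth_index.
have hin n : n \in descent_set w -> (0 < n < size w)%N.
  rewrite !inE mem_filter mem_iota => /and3P[_ n0 h].
  by rewrite n0; case: (size w) h => [|m]; rewrite ?add1n //= ltnS leqNgt n0.
split.
  move/eqP => eS; split=> b c wb wc e /=; rewrite /inS -eS (hd b c) // -leqNgt leq_eqVlt.
  case/predU1P => [/val_inj ebc|//].
  by move: e; rewrite ebc => /eqP; rewrite eqn_leq ltnn andbF.
case=> dw aw; apply/eqP/fsetP => n.
have [hn|hn] := boolP (0 < n < size w)%N; last first.
  rewrite (contraNF (@hin n)) //; apply/esym/negbTE; apply: contra hn => nS.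
  by rewrite mem_S_gt0 // sw mem_S_lt.
have w0 : 'I_l by move: hn; case: (w) => [|x _ _]; [rewrite andbC|exact: x].
case/andP: hn => n0 nw.
have nw' : (n.-1 < size w)%N by rewrite prednK // ltnW.
pose b := nth w0 w n.-1; pose c := nth w0 w n.
have ib : index b w = n.-1 by rewrite index_uniq.
have ic : index c w = n by rewrite index_uniq.
have wb : b \in w by apply: mem_nth.
have wc : c \in w by apply: mem_nth.
have e : index c w = (index b w).+1 by rewrite ib ic prednK.
rewrite -ic (hd b c) //.
have [cS|cS] := boolP (index c w \in S); first exact: (dw b c).
by have := aw b c wb wc e cS; rewrite ltnNge => h; apply/negbTE; rewrite -leqNgt ltnW // ltnNge.
Qed.

Lemma descent_words_uniq (B : {set 'I_l}) : uniq (descent_words S B).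
Proof.
rewrite sort_uniq filter_uniq // map_inj_uniq ?enum_uniq // => s t e.
apply/perm.permP => p; apply: enum_val_inj.
have := congr1 (fun w => nth (enum_val p) w p) e; rewrite /basis_word.
by rewrite !(nth_map p) -?enumT ?size_enum_ord // !nth_ord_enum.
Qed.

Lemma descent_wordsP (B : {set 'I_l}) w :
  reflect (perm_eq w (enum B) /\ descent_set w == S) (w \in descent_words S B).
Proof.
rewrite mem_sort mem_filter; apply: (iffP andP) => -[h1 h2].
  by split=> //; apply/basis_wordP; move/mapP: h2 => [s _ ->]; exists s.
split=> //; have /basis_wordP[s ->] := h1; apply: map_f; exact: mem_enum.
Qed.

Lemma ear_posetP (B : {set 'I_l}) w z : perm_eq w (enum B) ->
  z \in ear_poset_of a S B w <-> rank z \in S /\ exists2 u, agrees inS w u &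
    exists2 n, (n <= size w)%N & z = word_chain a u n.
Proof.
move=> pw; have sB : size w = #|B| by rewrite (perm_size pw) cardE.
rewrite !inE; split=> [/andP[zS /exists_inP[s]]|[zS [u [pu au] [n nw ez]]]].
  rewrite inE => /forallP h /existsP[n /eqP ez]; split=> //.
  exists (basis_word s); last by exists n => //; rewrite sB -ltnS.
  have ps : perm_eq (basis_word s) (enum B) by apply/basis_wordP; exists s.
  split; first by rewrite (perm_trans ps) // perm_sym.
  move=> m hm mS; have hm' : (m < #|B|.+1)%N by rewrite ltnS -sB.
  by have /implyP/(_ mS)/eqP := h (Ordinal hm').
rewrite zS ez /=; have /basis_wordP[s es] := perm_trans pu pw.
apply/exists_inP; exists s.
  rewrite inE; apply/forallP => m; apply/implyP => mS; apply/eqP; rewrite -es; apply: au => //.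
  by rewrite sB -ltnS.
have hn : (n < #|B|.+1)%N by rewrite ltnS -sB.
by apply/existsP; exists (Ordinal hn); rewrite -es.
Qed.

Definition flag u : {set L} :=
  [set z | (rank z \in S) && [exists n : 'I_(rank (\top : L)).+1, z == word_chain a u n]].

Lemma flagP u z : basis_seq u ->
  reflect (exists2 n, n \in S & z = word_chain a u n) (z \in flag u).
Proof.
move=> bu; rewrite inE; apply: (iffP andP) => [[zS /existsP[n /eqP ez]]|[n nS ->]].
  exists (n : nat) => //; move: zS; rewrite ez rank_word_chain //.
  by rewrite (basis_seq_size bu) -ltnS.
have hn := mem_S_lt nS; rewrite rank_word_chain //; last by rewrite (basis_seq_size bu) ltnW.
by split=> //; apply/existsP; exists (Ordinal (leqW hn)).
Qed.

Lemma rank_word_chain_S u n : basis_seq u -> n \in S -> rank (word_chain a u n) = n.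
Proof. by move=> bu nS; rewrite rank_word_chain // (basis_seq_size bu) ltnW // mem_S_lt. Qed.

Lemma flag_passes u : basis_seq u -> passes (flag u) u.
Proof. by move=> bu g /(flagP _ bu)[n _ ->]; exists n. Qed.

Lemma flag_eq u v : basis_seq u -> basis_seq v ->
  (forall n, n \in S -> word_chain a u n = word_chain a v n) -> flag u = flag v.
Proof.
move=> bu bv h; apply/setP => z; apply/(flagP _ bu)/(flagP _ bv) => -[n nS ->];
by exists n; rewrite ?h.
Qed.

Lemma word_chain_flag u v n : basis_seq u -> basis_seq v -> flag u \subset flag v ->
  n \in S -> word_chain a u n = word_chain a v n.
Proof.
move=> bu bv h nS; have /(subsetP h)/(flagP _ bv)[m mS e] : word_chain a u n \in flag u.
  by apply/flagP => //; exists n.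
have := congr1 (@rank _ L) e; rewrite !rank_word_chain_S // => enm.
by rewrite e enm.
Qed.

Lemma card_flag u : basis_seq u -> #|flag u| = #|` S|.
Proof.
move=> bu; have -> : flag u = [set z in [seq word_chain a u n | n <- S]].
  apply/setP => z; rewrite inE; apply/(flagP _ bu)/mapP => -[n]; first by exists n.
  by exists n.
have -> : #|[set z in [seq word_chain a u n | n <- S]]| = size [seq word_chain a u n | n <- S].
  rewrite cardsE; apply/card_uniqP; rewrite map_inj_in_uniq ?fset_uniq // => n m nS mS e.
  by have := congr1 (@rank _ L) e; rewrite !rank_word_chain_S.
by rewrite size_map.
Qed.

Lemma flag_order_complex u : basis_seq u -> flag u \in order_complex (rank_selection L S).
Proof.
move=> bu; apply/order_complexP; split; first by apply/subsetP => z; rewrite !inE => /andP[].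
move=> x y /(flagP _ bu)[n _ ->] /(flagP _ bu)[m _ ->].
by case/orP: (leq_total n m) => /(word_chain_le u) h; rewrite /Order.comparable h ?orbT.
Qed.

Section EarPoset.
Variables (B : {set 'I_l}) (w : seq 'I_l).
Hypothesis pw : perm_eq w (enum B).
Hypothesis bw : basis_seq w.
Let X := ear_poset_of a S B w.

Lemma agrees_basis_seq u : agrees inS w u -> basis_seq u.
Proof. by case=> p _; apply: basis_seq_perm bw; rewrite perm_sym. Qed.

Lemma flag_sub_poset u : agrees inS w u -> flag u \subset X.
Proof.
move=> au; have bu := agrees_basis_seq au.
apply/subsetP => z /(flagP _ bu)[n nS ->]; apply/(ear_posetP _ pw).
have hn : (n <= size w)%N by rewrite (basis_seq_size bw) ltnW // mem_S_lt.
split; first by rewrite rank_word_chain // (perm_size au.1).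
by exists u => //; exists n.
Qed.

Lemma poset_joins z : z \in X -> z = joins [seq b <- w | a b <= z].
Proof.
case/(ear_posetP _ pw) => _ [u au [n nw ->]]; have bu := agrees_basis_seq au.
apply: eq_joins => b; rewrite mem_filter -(perm_mem au.1).
case: (boolP (b \in u)) => ub; first by rewrite andbT le_word_chain // in_take.
by rewrite andbF; apply: contraNF ub; apply: mem_take.
Qed.

(** Sorting the letters by the number of members of [G] not above them, with ties as in [w], makes
    every member of [G] a prefix. The prefix sets at block ends do not change, because every element
    of [X] respects the order of the blocks. *)
Lemma chain_sub_flag G : G \in order_complex X -> exists2 u, agrees inS w u & G \subset flag u.
Proof.
case/order_complexP => GX chG.
pose cnt b := #|[set z in G | ~~ (a b <= z)]|.
pose leT : rel 'I_l := fun b c =>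
  (cnt b < cnt c)%N || ((cnt b == cnt c) && (index b w <= index c w)%N).
have leT_trans : transitive leT.
  move=> c b d /orP[h1|/andP[/eqP e1 h1]] /orP[h2|/andP[/eqP e2 h2]]; rewrite /leT.
  - by rewrite (ltn_trans h1 h2).
  - by rewrite -e2 h1.
  - by rewrite e1 h2.
  - by rewrite e1 e2 eqxx (leq_trans h1 h2) orbT.
have leT_total : total leT.
  move=> b c; rewrite /leT; case: (ltngtP (cnt b) (cnt c)) => //= _; exact: leq_total.
pose u := sort leT w.
have pu : perm_eq u w by rewrite perm_sort.
have su : sorted leT u by apply: sort_sorted.
have prefix (P : pred 'I_l) : (forall b c, b \in w -> c \in w -> leT c b -> P b -> P c) ->
    take (count P w) u =i [seq b <- w | P b].
  move=> h b; rewrite -(seq.permP pu) take_pairwise ?mem_filter ?(perm_mem pu) //.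
  by apply: (sorted_pairwise_closed leT_trans su) => c d; rewrite !(perm_mem pu); apply: h.
have bu : basis_seq u by apply: basis_seq_perm bw; rewrite perm_sym.
have au : agrees inS w u.
  split=> // n nw nS; apply: eq_joins => b.
  have e : n = count (mem (take n w)) w by rewrite count_mem_takel // basis_seq_uniq.
  rewrite {1}e prefix ?mem_filter /=.
    by case: (boolP (b \in take n w)) => // /mem_take ->.
  move=> {}b c wb wc cb; rewrite !in_take // => bn; rewrite ltnNge; apply/negP => cn.
  have bc : (index b w < index c w)%N by apply: leq_trans cn.
  suff le : (cnt b <= cnt c)%N.
    by move: cb; rewrite /leT ltnNge le /= leqNgt bc andbF.
  apply/subset_leq_card/subsetP => g; rewrite !inE => /andP[gG gb]; rewrite gG /=.
  apply: contra gb => gc.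
  have /(ear_posetP _ pw)[_ [v av [k kw ek]]] := subsetP GX g gG.
  have bv := agrees_basis_seq av.
  move: gc; rewrite ek !le_word_chain ?(perm_mem av.1) // => ck.
  have : b \in take n v by rewrite (agrees_take bv av nw nS) in_take.
  rewrite in_take ?(perm_mem av.1) // => /leq_trans; apply.
  apply: leq_trans (ltnW ck); rewrite leqNgt -in_take ?(perm_mem av.1) //.
  by rewrite (agrees_take bv av nw nS) in_take // -leqNgt.
exists u => //; apply/subsetP => z zG; have zX := subsetP GX z zG.
have ez : z = word_chain a u (count (fun b => a b <= z) w).
  rewrite {1}(poset_joins zX); apply: eq_joins => b; rewrite prefix //.
  move=> {}b c wb wc cb bz; apply/negPn/negP => cz.
  suff lt : (cnt b < cnt c)%N by move: cb; rewrite /leT ltnNge (ltnW lt) /= (gtn_eqF lt).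
  apply: proper_card; apply/properP; split.
    apply/subsetP => g; rewrite !inE => /andP[gG gb]; rewrite gG /=.
    case/orP: (chG g z gG zG) => [gz|zg].
      by apply: contra cz => h; apply: le_trans gz.
    by case/negP: gb; apply: le_trans zg.
  by exists z; rewrite !inE zG ?bz.
have /(ear_posetP _ pw)[zS _] := zX.
apply/flagP => //; exists (count (fun b => a b <= z) w) => //.
by move: zS; rewrite {1}ez rank_word_chain // (perm_size pu) count_size.
Qed.

Lemma maximal_chainsP F :
  F \in maximal_chains X <-> exists2 u, agrees inS w u & F = flag u.
Proof.
have fX u : agrees inS w u -> flag u \in order_complex X.
  move=> au; apply/order_complexP; split; first exact: flag_sub_poset.
  by have /order_complexP[_] := flag_order_complex (agrees_basis_seq au).
rewrite inE; split=> [/maxsetP[/chain_sub_flag[u au Fu] hF]|[u au ->]].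
  by exists u => //; apply/esym/hF => //; apply: fX.
apply/maxsetP; split; first exact: fX.
move=> G GX uG; have [v av Gv] := chain_sub_flag GX.
apply/eqP; rewrite eqEsubset uG andbT.
have [bu bv] := (agrees_basis_seq au, agrees_basis_seq av).
rewrite (_ : flag u = flag v) //; apply: flag_eq => // n nS.
by apply: word_chain_flag => //; apply: subset_trans Gv.
Qed.

End EarPoset.

(** * New facets *)

(** By [good_canonical] and [canonical_good] these are the words that are canonical for their own
    flag. *)
Definition good u := [/\ basis_seq u, min_labeled u & ascends_at (predC inS) u].

Definition ear_word (i j : nat) : seq 'I_l := nth [::] (descent_words S (nbcB a i)) j.

Definition ear_index (i j : nat) := (i < size (nbc_bases a))%N && (j < nchains a S i)%N.

Definition precedes (p q : nat * nat) :=
  (p.1 < q.1)%N || ((p.1 == q.1) && (p.2 < q.2)%N).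

Lemma mem_nbc_bases B : (B \in nbc_bases a) = nbc_basis a B.
Proof. by rewrite mem_sort mem_filter mem_enum andbT. Qed.

Lemma ear_word_perm (i j : nat) : ear_index i j -> perm_eq (ear_word i j) (enum (nbcB a i)).
Proof. by case/andP => _ /(mem_nth [::])/descent_wordsP[]. Qed.

Lemma ear_word_basis_seq (i j : nat) : ear_index i j -> basis_seq (ear_word i j).
Proof.
move=> v; apply: (@basis_seq_perm (enum (nbcB a i))).
  by rewrite perm_sym; apply: ear_word_perm.
apply: basis_basis_seq; case/andP: v => /(mem_nth finset.set0) + _.
by rewrite -/(nbcB a i) mem_nbc_bases => /andP[].
Qed.

Lemma ear_word_descends (i j : nat) : ear_index i j -> descends_at inS (ear_word i j).
Proof.
move=> v; have bw := ear_word_basis_seq v.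
by case/andP: v => _ /(mem_nth [::])/descent_wordsP[_ /(descent_setP bw)[]].
Qed.

Lemma good_location u : good u ->
  exists i j : nat, ear_index i j /\ agrees inS (ear_word i j) u.
Proof.
case=> bu mu au; have [w [aw dw sw]] := block_sort bu au.
have bw : basis_seq w by apply: basis_seq_perm bu; case: aw.
have wS : descent_set w == S by apply/descent_setP.
pose B := [set i in u]; have nB : B \in nbc_bases a by rewrite mem_nbc_bases min_labeled_nbc.
have eB : nbcB a (index B (nbc_bases a)) = B by rewrite /nbcB nth_index.
have wB : w \in descent_words S B.
  apply/descent_wordsP; split=> //.
  by apply: perm_trans (perm_enum_set (basis_seq_uniq bu)); case: aw; rewrite perm_sym.
exists (index B (nbc_bases a)), (index w (descent_words S B)).
by rewrite /ear_index /nchains /ear_word eB !index_mem nB wB nth_index.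
Qed.

Lemma precedes_total (p q : nat * nat) : p != q -> precedes p q || precedes q p.
Proof.
case: p q => [i j] [n m]; rewrite xpair_eqE negb_and /precedes /=.
by case: (ltngtP i n) => //= _; case: (ltngtP j m).
Qed.

(** [canonical_exchange] compares the bases and, for equal bases, [canonical_first_difference]
    compares the words. *)
Lemma canonical_precedes (G : {set L}) (i j n m : nat) u v :
  ear_index i j -> ear_index n m -> canonical G u -> agrees inS (ear_word i j) u ->
  agrees inS (ear_word n m) v -> passes G v -> ~~ precedes (n, m) (i, j).
Proof.
move=> vij vnm cu au av pv; have [bu _ _ _] := cu.
have bv : basis_seq v by apply: agrees_basis_seq av; apply: ear_word_basis_seq.
have mB b : (b \in nbcB a i) = (b \in u).
  by rewrite -mem_enum -(perm_mem (ear_word_perm vij)) (perm_mem au.1).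
have mC b : (b \in nbcB a n) = (b \in v).
  by rewrite -mem_enum -(perm_mem (ear_word_perm vnm)) (perm_mem av.1).
have cB : #|nbcB a i| = size u.
  by rewrite cardE -(perm_size (ear_word_perm vij)) (perm_size au.1).
have cC : #|nbcB a n| = size v.
  by rewrite cardE -(perm_size (ear_word_perm vnm)) (perm_size av.1).
have hin : (i <= n)%N.
  apply: (@sorted_lexle_index _ _ (fun B : {set 'I_l} => enum B) finset.set0 (nbc_bases a)).
  - by move=> B C _ _ e; apply/setP => b; rewrite -mem_enum e mem_enum.
  - by rewrite sort_uniq filter_uniq // enum_uniq.
  - by apply: sort_sorted => B C; apply: lexle_total.
  - by case/andP: vij.
  - by case/andP: vnm.
  apply: lexle_enum; first by rewrite cB cC !basis_seq_size.
  move=> c; rewrite mB mC => cv cu' h; apply: (canonical_exchange cu bv pv cv cu').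
  by move=> b bc; have := h b bc; rewrite mB mC.
rewrite /precedes /= negb_or -leqNgt hin /= negb_and -leqNgt.
case: (eqVneq n i) => //= ni; subst n.
apply: (@sorted_lexle_index _ _ id [::] (descent_words S (nbcB a i))) => //.
- exact: descent_words_uniq.
- by apply: sort_sorted => s t; apply: lexle_total.
- by case/andP: vij.
- by case/andP: vnm.
have pww : perm_eq (ear_word i j) (ear_word i m).
  by rewrite (perm_trans (ear_word_perm vij)) // perm_sym ear_word_perm.
apply: lexle_first_difference; first exact: perm_size.
move=> p x y s t ew ew' xy.
apply: (canonical_first_difference cu bv pv au av _ pww _ ew ew' xy).
  exact: ear_word_descends.
by rewrite (basis_seq_size (ear_word_basis_seq vij)); apply: rank_top_notin_S.
Qed.

Lemma good_canonical u : good u -> canonical (flag u) u.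
Proof.
case=> bu mu au; split=> //; first exact: flag_passes.
move=> b c ub uc e h; apply: au => //=; apply: contra h => h.
by apply/flagP => //; exists (index c u).
Qed.

Lemma passes_flag (G : {set L}) u : basis_seq u -> passes G u -> G \subset rank_selection L S ->
  G \subset flag u.
Proof.
move=> bu pu GS; apply/subsetP => g gG; have [n en] := pu g gG.
have := subsetP GS g gG; rewrite inE => gS.
have [h|h] := leqP n (size u); last first.
  move: gS; rewrite en word_chain_size ?(ltnW h) // => /(negP rank_top_notin_S) //.
by apply/flagP => //; exists n => //; move: gS; rewrite en rank_word_chain.
Qed.

Lemma flag_sub_passes (G : {set L}) u : basis_seq u -> G \subset flag u -> passes G u.
Proof. by move=> bu Gu g /(subsetP Gu) /(flag_passes bu). Qed.

Lemma canonical_good (G : {set L}) u : G \subset rank_selection L S -> canonical G u -> good u.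
Proof.
move=> GS [bu mu pu au]; split=> // b c ub uc e h; apply: au => //.
have hn : (index c u <= size u)%N by rewrite ltnW // index_mem.
by apply: contra h => /(subsetP GS); rewrite inE rank_word_chain.
Qed.

(** Words of one class share the flats of ranks outside [S], and the flag supplies the others, so
    all prefix sets coincide. *)
Lemma eq_agrees w u v : basis_seq w -> agrees inS w u -> agrees inS w v ->
  flag u = flag v -> u = v.
Proof.
move=> bw au av e; have [bu bv] := (agrees_basis_seq bw au, agrees_basis_seq bw av).
have puv : perm_eq u v by rewrite (perm_trans au.1) // perm_sym; case: av.
apply: eq_mem_take_inj; rewrite ?basis_seq_uniq ?(perm_size puv) // => n b.
have h : word_chain a u n = word_chain a v n.
  have [nS|nS] := boolP (n \in S); first by apply: word_chain_flag; rewrite ?e.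
  have [nw|nw] := leqP n (size w); first by rewrite au.2 // av.2.
  by rewrite !word_chain_size // ltnW // ?(perm_size au.1) ?(perm_size av.1).
exact: eq_word_chain_take.
Qed.

(** The canonical word of [F] is located at the first pair that has [F] as a maximal chain, so
    newness at [(i, j)] means that this location is [(i, j)]. Good words are canonical for their
    flags. *)
Lemma ear_facetsP (i j : nat) F : ear_index i j ->
  F \in ear_facets a S i j <-> exists u, [/\ agrees inS (ear_word i j) u, good u & F = flag u].
Proof.
move=> vij; have bw := ear_word_basis_seq vij; have pw := ear_word_perm vij.
have before (n m : nat) : ear_index n m -> precedes (n, m) (i, j) -> F \in ear_facets a S i j ->
    F \notin maximal_chains (ear_poset a S n m).
  move=> vnm /orP[/= ni|/andP[/eqP /= -> mj]]; rewrite inE => /and3P[_ /forallP h1 /forallP h2].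
    by case/andP: vnm => _ hm; have /forallP/(_ (Ordinal hm)) := h2 (Ordinal ni).
  exact: h1 (Ordinal mj).
split=> [Fij|[u [au gu ->]]]; last first.
  have cu := good_canonical gu; have [bu _ _] := gu.
  have later (n m : nat) : ear_index n m -> precedes (n, m) (i, j) ->
      flag u \notin maximal_chains (ear_poset a S n m).
    move=> vnm; apply: contraL => /(maximal_chainsP (ear_word_perm vnm) (ear_word_basis_seq vnm))[v av e].
    apply: (canonical_precedes vij vnm cu au av).
    by apply: flag_sub_passes; rewrite ?e //; apply: agrees_basis_seq av; apply: ear_word_basis_seq.
  rewrite inE; apply/and3P; split.
  - by apply/(maximal_chainsP pw bw); exists u.
  - apply/forallP => n; apply: later; last by rewrite /precedes /= eqxx ltn_ord orbT.
    by case/andP: vij => v1 v2; rewrite /ear_index v1 (ltn_trans (ltn_ord n)).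
  - apply/forallP => n; apply/forallP => m; apply: later; last by rewrite /precedes /= ltn_ord.
    by case/andP: vij => v1 _; rewrite /ear_index (ltn_trans (ltn_ord n)) /=.
have : F \in maximal_chains (ear_poset a S i j) by move: Fij; rewrite inE => /and3P[].
case/(maximal_chainsP pw bw) => v av eF; have bv := agrees_basis_seq bw av.
have /order_complexP[FS chF] : F \in order_complex (rank_selection L S).
  by rewrite eF; apply: flag_order_complex.
have [u cu] := canonical_exists chF; have [bu _ pu _] := cu.
have gu := canonical_good FS cu; have [n [m [vnm au]]] := good_location gu.
have pv : passes F v by rewrite eF; apply: flag_passes.
have Fu : F = flag u.
  by apply/eqP; rewrite eqEcard (passes_flag bu pu FS) eF !card_flag /=.
have nle := canonical_precedes vnm vij cu au av pv.
case: (eqVneq (n, m) (i, j)) => [[en em]|nij].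
  by subst n m; exists u.
have := precedes_total nij; rewrite (negbTE nle) orbF => /(before _ _ vnm)/(_ Fij)/negP[].
by apply/(maximal_chainsP (ear_word_perm vnm) (ear_word_basis_seq vnm)); exists u.
Qed.

Lemma earP (i j : nat) G : ear_index i j ->
  G \in ear a S i j <-> exists u, [/\ agrees inS (ear_word i j) u, good u & G \subset flag u].
Proof.
move=> vij; rewrite inE; split.
  by case/exists_inP => F /(ear_facetsP _ vij)[u [au gu ->]] Gu; exists u.
case=> u [au gu Gu]; apply/exists_inP; exists (flag u) => //.
by apply/ear_facetsP => //; exists u.
Qed.

Lemma ear_sub_order_complex (i j : nat) G : ear_index i j -> G \in ear a S i j ->
  G \in order_complex (rank_selection L S).
Proof.
move=> vij /(earP _ vij)[u [_ [bu _ _] Gu]].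
have /order_complexP[h1 h2] := flag_order_complex bu; apply/order_complexP; split.
  exact: subset_trans Gu h1.
by move=> x y /(subsetP Gu) hx /(subsetP Gu); apply: h2.
Qed.

Lemma canonical_ear (G : {set L}) : G \in order_complex (rank_selection L S) ->
  exists (i j : nat) u, [/\ ear_index i j, agrees inS (ear_word i j) u, canonical G u, good u & G \in ear a S i j].
Proof.
case/order_complexP => GS chG; have [u cu] := canonical_exists chG.
have gu := canonical_good GS cu; have [i [j [vij au]]] := good_location gu.
exists i, j, u; split=> //; apply/earP => //; exists u; split=> //.
by have [bu _ pu _] := cu; apply: passes_flag.
Qed.

Lemma canonical_not_before (G : {set L}) (i j n m : nat) u :
  ear_index i j -> ear_index n m -> canonical G u -> agrees inS (ear_word i j) u ->
  G \in ear a S n m -> ~~ precedes (n, m) (i, j).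
Proof.
move=> vij vnm cu au /(earP _ vnm)[v [av [bv _ _] Gv]].
by apply: (canonical_precedes vij vnm cu au av); apply: flag_sub_passes.
Qed.

Lemma index_lt_of_block w u b c : basis_seq w -> agrees inS w u -> b \in w -> c \in w ->
  (block_index inS (index b w) < block_index inS (index c w))%N -> (index b u < index c u)%N.
Proof.
move=> bw au wb wc /block_index_ltP[j [jS bj jc]].
have bu := agrees_basis_seq bw au.
have jw : (j <= size w)%N by apply: leq_trans jc _; rewrite ltnW // index_mem.
have tj := agrees_take bu au jw jS.
apply: (@leq_trans j); first by rewrite -in_take ?(perm_mem au.1) // tj in_take.
by rewrite leqNgt -in_take ?(perm_mem au.1) // tj in_take // -leqNgt.
Qed.

(** Suppose that [v] introduces [i] with a letter [b > i], and let [c] introduce [i] in [u], so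
    [c < b]. By [indep_meet], [b] precedes [c] in [u] but not in [v], so a decreasing pair would be
    lost. *)
Lemma good_closed w u v : basis_seq w -> agrees inS w u -> agrees inS w v -> good u ->
  (forall b c, b \in w -> c \in w -> (c < b)%N ->
     block_index inS (index b w) = block_index inS (index c w) ->
     (index b u < index c u)%N -> (index b v < index c v)%N) -> good v.
Proof.
move=> bw au av [bu mu cu] inv; have bv := agrees_basis_seq bw av.
have mwu b : (b \in u) = (b \in w) by apply: perm_mem au.1 b.
have mwv b : (b \in v) = (b \in w) by apply: perm_mem av.1 b.
have inv' b c : b \in w -> c \in w -> (c < b)%N -> (index b u < index c u)%N ->
    (index b v < index c v)%N.
  move=> wb wc cb h.
  case: (ltngtP (block_index inS (index b w)) (block_index inS (index c w))) => e.
  - exact: index_lt_of_block av wb wc e.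
  - by have := ltn_trans h (index_lt_of_block bw au wc wb e); rewrite ltnn.
  - exact: inv.
split=> //.
  move=> b i vb h1 h2; rewrite leqNgt; apply/negP => ib.
  have [c [uc h3 h4]] := introduces i bu.
  have ci := mu c i uc h3 h4.
  have cb : (c < b)%N by apply: leq_ltn_trans ib.
  have wb : b \in w by rewrite -mwv.
  have wc : c \in w by rewrite -mwu.
  have [iw _] := andP bw.
  have sub s n : basis_seq s -> perm_eq s w -> {subset take n s <= w}.
    by move=> _ p d /mem_take; rewrite (perm_mem p).
  have m1 := indep_meet iw (sub _ _ bv av.1) (sub _ _ bu au.1) h1 h3.
  have bc : (index b u <= index c u)%N.
    rewrite leqNgt; apply/negP => cbu; case/negP: h2; apply: le_trans m1 _.
    apply: joins_subset => d; rewrite mem_filter => /andP[du dv].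
    have vd := mem_take dv; have ud := mem_take du.
    move: du dv; rewrite !in_take // !ltnS => du; rewrite leq_eqVlt => /predU1P[e|//].
    by move: cbu; rewrite ltnNge -(word_chain_inj_index bv vd vb e) du.
  have cbv : (index c v <= index b v)%N.
    rewrite leqNgt; apply/negP => cbu; case/negP: h4; apply: le_trans m1 _.
    apply: joins_subset => d; rewrite mem_filter => /andP[du dv].
    have vd := mem_take dv; have ud := mem_take du.
    move: du dv; rewrite !in_take // !ltnS leq_eqVlt => /predU1P[e dv|//].
    by move: cbu; rewrite ltnNge -(word_chain_inj_index bu ud uc e) dv.
  move: bc; rewrite leq_eqVlt => /predU1P[e|bc].
    have ub : b \in u by rewrite mwu.
    by move: cb; rewrite (word_chain_inj_index bu ub uc e) ltnn.
  by have := inv' b c wb wc cb bc; rewrite ltnNge cbv.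
move=> b c vb vc e /= cS; set t := index c v in e cS.
have wb : b \in w by rewrite -mwv.
have wc : c \in w by rewrite -mwv.
have tw : (t < size w)%N by rewrite -(perm_size av.1) index_mem.
have tu : (t < size u)%N by rewrite (perm_size au.1).
have tt d : d \in w -> (index d u < t)%N = (index d v < t)%N.
  move=> wd; rewrite -!in_take ?mwu ?mwv //.
  by rewrite (agrees_take bu au (ltnW tw) cS) (agrees_take bv av (ltnW tw) cS).
have t1 : (t.-1 < size u)%N by apply: leq_ltn_trans (leq_pred _) tu.
pose b' := nth b u t.-1; pose c' := nth b u t.
have ub' : b' \in u by apply: mem_nth.
have uc' : c' \in u by apply: mem_nth.
have ib' : index b' u = t.-1 by rewrite index_uniq // basis_seq_uniq.
have ic' : index c' u = t by rewrite index_uniq // basis_seq_uniq.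
have bc' : (b' < c')%N.
  by apply: (cu b' c' ub' uc'); rewrite ?ic' ?ib' //= e.
(* If the last letter [b] of the block of [v] exceeded the last letter [b'] of [u], it would precede
   [b'] in [u] and hence in [v]. *)
have bb : (b <= b')%N.
  rewrite leqNgt; apply/negP => lt.
  have h1 : (index b u < t)%N by rewrite tt // e.
  have h2 : (index b u < index b' u)%N.
    rewrite ltn_neqAle [X in _ && X](_ : _ = true); last by rewrite ib' -ltnS (ltn_predK h1).
    rewrite andbT; apply/eqP => e2.
    have ub : b \in u by rewrite mwu.
    by move: lt; rewrite (word_chain_inj_index bu ub ub' e2) ltnn.
  have := inv' b b' wb _ lt h2; rewrite -mwu => /(_ ub').
  have : (index b' v < t)%N by rewrite -tt -?mwu // ib' e.
  by rewrite e ltnS ltnNge => ->.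
have cc : (c' <= c)%N.
  rewrite leqNgt; apply/negP => lt.
  have h1 : (t <= index c u)%N by rewrite leqNgt tt // ltnn.
  have h2 : (index c' u < index c u)%N.
    rewrite ltn_neqAle ic' h1 andbT -ic'; apply/eqP => e2.
    have uc : c \in u by rewrite mwu.
    by move: lt; rewrite (word_chain_inj_index bu uc' uc e2) ltnn.
  have := inv' c' c _ wc lt h2; rewrite -mwu => /(_ uc').
  have : (t <= index c' v)%N by rewrite leqNgt -tt -?mwu // ic' ltnn.
  by rewrite -/t ltnNge => ->.
exact: leq_ltn_trans bb (leq_trans bc' cc).
Qed.

(** * Boundaries of the ears *)

Definition swapped w u (t : nat) v :=
  [/\ agrees inS w v, forall n : nat, n != t -> word_chain a v n = word_chain a u n,
      word_chain a v t <> word_chain a u t &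
      forall u', agrees inS w u' ->
        (forall n : nat, n \in S -> n != t -> word_chain a u' n = word_chain a u n) ->
        flag u' = flag u \/ flag u' = flag v].

(** Exchanging the letters on both sides of rank [t] changes a single flat. The flats of ranks
    [t.-1] and [t.+1] leave two choices for the letter between them, so only two flags of the class
    share the remaining ranks. *)
Lemma swap_word w u (t : nat) : basis_seq w -> agrees inS w u -> t \in S ->
  exists2 v, swapped w u t v &
    forall b c, b \in u -> c \in u -> index c u = t -> (index b u).+1 = t ->
      (c < b)%N -> lexle v u /\ v != u.
Proof.
move=> bw au tS; have bu := agrees_basis_seq bw au; have uu := basis_seq_uniq bu.
have t0 := mem_S_gt0 tS; have := mem_S_lt tS; rewrite -(basis_seq_size bu) => tr.
have w0 : 'I_l by case: (u) tr => [|x _ _]; [|exact: x].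
have t1 : (t.-1 < size u)%N by apply: leq_ltn_trans (leq_pred _) tr.
pose b := nth w0 u t.-1; pose c := nth w0 u t.
pose s1 := take t.-1 u; pose s2 := drop t.+1 u.
have ss1 : size s1 = t.-1 by rewrite size_takel // ltnW.
have eu : u = s1 ++ b :: c :: s2.
  by rewrite -[LHS](cat_take_drop t.-1) (drop_nth w0) // prednK // (drop_nth w0).
pose v := s1 ++ c :: b :: s2.
have puv : perm_eq v u.
  by rewrite eu perm_cat2l -[c :: _](cat1s c) -[b :: c :: _](cat1s b) -[b :: s2]cat1s -[c :: s2]cat1s perm_catCA.
have ch n : n != t -> word_chain a v n = word_chain a u n.
  move=> nt; apply: eq_joins => x; rewrite eu !take_cat ss1.
  case: ltnP => // hn; have [k ek] : exists k, n = (t.-1 + k)%N by exists (n - t.-1)%N; rewrite subnKC.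
  subst n; rewrite addKn; case: k nt {hn} => [_|[|k _]] /=.
  - by [].
  - by rewrite addn1 prednK ?eqxx.
  - by rewrite !mem_cat !inE (orbCA (x == c)).
have bv : basis_seq v by apply: basis_seq_perm bu; rewrite perm_sym.
have av : agrees inS w v.
  split; first by rewrite (perm_trans puv) //; case: au.
  move=> n nw nS; rewrite ch ?au.2 //; apply: contra nS => /eqP -> //.
have vt : word_chain a v t = joins s1 `|` a c.
  rewrite /word_chain -joins_rcons; congr joins; rewrite take_cat ss1.
  by rewrite ltnNge leq_pred /= -{1}(prednK t0) subSnn /= ?take0 cats1.
have ut : word_chain a u t = joins s1 `|` a b.
  rewrite /word_chain -joins_rcons; congr joins; rewrite eu take_cat ss1.
  by rewrite ltnNge leq_pred /= -{1}(prednK t0) subSnn /= ?take0 cats1.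
have uc : c \in u by rewrite mem_nth.
have ub : b \in u by rewrite mem_nth.
have ic : index c u = t by rewrite index_uniq.
have ib : index b u = t.-1 by rewrite index_uniq.
exists v; last first.
  move=> b' c' ub' uc' ic' ib' cb'.
  have ec : c' = c by apply: (word_chain_inj_index bu) => //; rewrite ic ic'.
  have eb : b' = b by apply: (word_chain_inj_index bu) => //; rewrite ib -ib'.
  rewrite ec eb in cb'; rewrite eu lexle_cat //; split=> //.
  rewrite eqseq_cat // eqxx /= eqseq_cons negb_and.
  by apply/orP; left; apply/eqP => e; rewrite e ltnn in cb'.
split=> //.
  move=> e; have : a c <= word_chain a u t by rewrite -e vt leUr.
  by rewrite le_word_chain // ic ltnn.
move=> u' au' hu'; have bu' := agrees_basis_seq bw au'.
have pu : perm_eq u' u by rewrite (perm_trans au'.1) // perm_sym; case: au.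
have su : size u' = size u by apply: perm_size.
have hu n : (n <= size w)%N -> n != t -> word_chain a u' n = word_chain a u n.
  move=> nw nt; have [nS|nS] := boolP (n \in S); first exact: hu'.
  by rewrite au'.2 // au.2.
have sw : size w = size u by rewrite (perm_size au.1).
have e1 : take t.-1 u' =i s1.
  apply: eq_word_chain_take => //; apply: hu; first by rewrite sw ltnW.
  by rewrite neq_ltn prednK // leqnn.
have e2 : take t.+1 u' =i take t.+1 u.
  by apply: eq_word_chain_take => //; apply: hu; rewrite ?sw // neq_ltn leqnn orbT.
pose x := nth w0 u' t.-1.
have tk' : take t u' = rcons (take t.-1 u') x.
  by rewrite -{1}(prednK t0) (take_nth w0) // su.
have ut' : word_chain a u' t = joins s1 `|` a x.
  rewrite /word_chain tk' -/(joins _) joins_rcons (eq_joins e1) //.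
have xu : x \in u' by rewrite mem_nth // su.
have ix : index x u' = t.-1 by rewrite index_uniq ?su // basis_seq_uniq.
have xbc : x = b \/ x = c.
  have xu2 : x \in u by rewrite -(perm_mem pu).
  have : x \in take t.+1 u by rewrite -e2 in_take // ix ltnS leq_pred.
  have : x \notin s1 by rewrite -e1 in_take // ix ltnn.
  rewrite !in_take // -leqNgt ltnS leq_eqVlt => /predU1P[h _|h].
    by left; apply: (word_chain_inj_index bu) => //; rewrite ib.
  move: h; rewrite (ltn_predK (m := 0)) // => h1 h2.
  by right; apply: (word_chain_inj_index bu) => //; rewrite ic; apply/eqP; rewrite eqn_leq h2.
case: xbc => ex; [left|right]; apply: flag_eq => // n nS;
  (case: (eqVneq n t) => [->|nt]; first by rewrite ut' ex ?vt ?ut).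
- exact: hu'.
- by rewrite ch // hu'.
Qed.

(** Descents outside of [G] are swapped as long as the word stays good. Each swap is a lexicographic
    decrease, so this ends at a canonical word for [G] or at a swap that leaves the ear. *)
Lemma boundary_or_canonical w u (G : {set L}) :
  basis_seq w -> agrees inS w u -> good u -> G \subset flag u ->
  (exists2 u0, agrees inS w u0 & canonical G u0) \/
  exists u0 v (t : nat), [/\ agrees inS w u0, good u0, G \subset flag u0, swapped w u0 t v & ~ good v]
    /\ t \in S /\ word_chain a u0 t \notin G.
Proof.
move=> bw; pose mu (s : seq 'I_l) := index s (sort (@lexle l) (permutations w)).
move e : (mu u) => k; elim/ltn_ind: k u e => k IH u e au gu Gu.
have bu := agrees_basis_seq bw au; have [_ mlu asu] := gu.
have [h|h] := boolP [exists b, exists c,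
    [&& b \in u, c \in u, index c u == (index b u).+1,
        word_chain a u (index c u) \notin G & ~~ (b < c)%N]]; last first.
  left; exists u => //; split=> //; first exact: flag_sub_passes.
  move=> b c ub uc ec hG; apply/negPn/negP => bc.
  case/negP: h; apply/existsP; exists b; apply/existsP; exists c.
  by apply/and5P; split=> //; apply/eqP.
case/existsP: h => b /existsP[c /and5P[ub uc /eqP ec hG bc]].
have cb : (c < b)%N.
  rewrite ltn_neqAle leqNgt bc andbT; apply/eqP => /val_inj ebc.
  by move/eqP: ec; rewrite ebc eqn_leq ltnn andbF.
have tS : index c u \in S.
  by apply: contraNT bc => h; apply: asu.
have [v sv lv] := swap_word bw au tS.
have [lvu vu] := lv b c ub uc (erefl _) (esym ec) cb.
case: (boolp.pselect (good v)) => [gv|ngv]; last first.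
  by right; exists u, v, (index c u).
have [av chv _ _] := sv.
apply: (IH (mu v) _ v (erefl _) av gv).
  have mem_sorted s : agrees inS w s -> s \in sort (@lexle l) (permutations w).
    by case=> p _; rewrite mem_sort mem_permutations.
  have us : uniq (sort (@lexle l) (permutations w)).
    by rewrite sort_uniq permutations_uniq.
  have iv := mem_sorted v av; have iu := mem_sorted u au.
  rewrite -e ltn_neqAle; apply/andP; split.
    apply: contra vu => /eqP e2; rewrite -(nth_index u iv) -/(mu v) e2.
    by rewrite /mu nth_index.
  apply: (@sorted_lexle_index _ _ id [::] (sort (@lexle l) (permutations w))) => //.
  - by apply: sort_sorted => s t; apply: lexle_total.
  - by rewrite index_mem.
  - by rewrite index_mem.
  - by rewrite !nth_index.
have bv := agrees_basis_seq bw av.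
apply/subsetP => g gG; have /(flagP _ bu)[n nS eg] := subsetP Gu g gG.
apply/flagP => //; exists n => //; rewrite eg chv //.
by apply: contra hG => /eqP <-; rewrite -eg.
Qed.

Lemma generated_down (E : {set {set L}}) (F G : {set L}) :
  F \in generated_complex E -> G \subset F -> G \in generated_complex E.
Proof.
rewrite !inE => /exists_inP[H HE FH] GF; apply/exists_inP; exists H => //.
exact: subset_trans GF FH.
Qed.

Lemma card_order_complex (G : {set L}) : G \in order_complex (rank_selection L S) -> (#|G| <= #|` S|)%N.
Proof.
case/canonical_ear => i [j [u [vij au cu gu /(earP _ vij)[v [av [bv _ _] Gv]]]]].
by rewrite -(card_flag bv) subset_leq_card.
Qed.

Lemma cdim_flag (K : {set {set L}}) u : K \subset order_complex (rank_selection L S) ->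
  basis_seq u -> flag u \in K -> cdim K = #|` S|.
Proof.
move=> KD bu uK; apply/eqP; rewrite eqn_leq; apply/andP; split.
  by apply/bigmax_leqP => G /(subsetP KD); apply: card_order_complex.
rewrite -(card_flag bu); exact: (@leq_bigmax_cond _ (mem K) (fun F : {set L} => #|F|) _ uK).
Qed.

Lemma ear_flag (i j : nat) : ear_index i j -> ear a S i j != finset.set0 ->
  exists u, [/\ agrees inS (ear_word i j) u, good u & flag u \in ear a S i j].
Proof.
move=> vij /set0Pn[G /(earP _ vij)[u [au gu _]]]; exists u; split=> //.
by apply/earP => //; exists u.
Qed.

Lemma ear_subset (i j : nat) : ear_index i j -> ear a S i j \subset order_complex (rank_selection L S).
Proof. by move=> vij; apply/subsetP => G; apply: ear_sub_order_complex. Qed.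

Lemma cdim_ear (i j : nat) : ear_index i j -> ear a S i j != finset.set0 ->
  cdim (ear a S i j) = #|` S|.
Proof.
move=> vij /(ear_flag vij)[u [_ [bu _ _] uK]].
by apply: (cdim_flag _ bu uK); apply: ear_subset.
Qed.

Lemma cdim_order_complex : cdim (order_complex (rank_selection L S)) = #|` S|.
Proof.
have [|u [bu _ _ _]] := @canonical_exists finset.set0; first by move=> x y; rewrite inE.
by apply: (cdim_flag _ bu); rewrite ?flag_order_complex.
Qed.

(** If a ridge lies in one facet only, the swapped word is not good, and its flag has its canonical
    word in an earlier ear. Conversely, a face of an earlier ear has no canonical word in this
    class, so [boundary_or_canonical] finds a boundary ridge that contains it. *)
Lemma ear_boundaryP (i j : nat) (G : {set L}) : ear_index i j -> ear a S i j != finset.set0 ->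
  G \in cboundary (ear a S i j) <-> G \in ear a S i j /\
    exists n m, [/\ ear_index n m, precedes (n, m) (i, j) & G \in ear a S n m].
Proof.
move=> vij nij; have bw := ear_word_basis_seq vij; have dK := cdim_ear vij nij.
split.
  rewrite inE => /exists_inP[G']; rewrite inE => /and3P[G'K]; rewrite dK => /eqP cG' /cards1P[H0 eH0] GG'.
  split; first exact: generated_down G'K GG'.
  have /(earP _ vij)[u [au gu G'u]] := G'K; have [bu _ _] := gu.
  have [z zu zG'] : exists2 z, z \in flag u & z \notin G'.
    by apply/subsetPn; apply/negP => /subset_leq_card; rewrite card_flag // -cG' ltnn.
  have /(flagP _ bu)[t tS ez] := zu.
  have [v sv _] := swap_word bw au tS; have [av chv nev _] := sv.
  have bv := agrees_basis_seq bw av.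
  have G'v : G' \subset flag v.
    apply/subsetP => g gG'; have /(flagP _ bu)[n nS eg] := subsetP G'u g gG'.
    apply/flagP => //; exists n => //; rewrite chv //.
    by apply: contra zG' => /eqP ent; rewrite ez -ent -eg.
  have fuv : flag v != flag u.
    apply/eqP => e; apply: nev; apply: word_chain_flag => //; by rewrite e.
  have prop s : basis_seq s -> G' \subset flag s -> G' \proper flag s.
    by move=> bx h; rewrite properEcard h card_flag // -cG' leqnn.
  (* Otherwise the distinct flags of [u] and [v] would both be facets above [G']. *)
  have ngv : ~ good v.
    move=> gv; case/eqP: fuv.
    have inH s : agrees inS (ear_word i j) s -> good s -> G' \subset flag s -> flag s = H0.
      move=> ax gx h; apply/set1P; rewrite -eH0 inE prop //; last by case: gx.
      by rewrite andbT; apply/earP => //; exists s.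
    by rewrite (inH u) // (inH v).
  have [n [m [u2 [vnm au2 cu2 gu2 h2]]]] := canonical_ear (flag_order_complex bv).
  have nle := canonical_precedes vnm vij cu2 au2 av (flag_passes bv).
  exists n, m; split; [exact: vnm| |]; last first.
    by apply: (generated_down h2); apply: subset_trans GG' G'v.
  case: (eqVneq (n, m) (i, j)) => [[en em]|nij2].
    case: ngv; subst n m; suff <- : u2 = v by [].
    apply: eq_agrees bw au2 av _; apply/esym/eqP; rewrite eqEcard.
    have [bu2 _ pu2 _] := cu2.
    have /order_complexP[FS _] := flag_order_complex bv.
    by rewrite (passes_flag bu2 pu2 FS) !card_flag /=.
  by have := precedes_total nij2; rewrite (negbTE nle) orbF.
case=> /(earP _ vij)[u [au gu Gu]] [n [m [vnm lt Gnm]]].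
case: (boundary_or_canonical bw au gu Gu) => [[u0 au0 cu0]|].
  by have := canonical_not_before vij vnm cu0 au0 Gnm; rewrite lt.
move=> [u0 [v [t [[au0 gu0 Gu0 sv ngv] [tS tG]]]]]; have [bu0 _ _] := gu0.
have [av chv nev dich] := sv; have bv := agrees_basis_seq bw av.
pose G' := flag u0 :\ word_chain a u0 t.
have tu0 : word_chain a u0 t \in flag u0 by apply/flagP => //; exists t.
have cG' : #|G'|.+1 = #|` S| by rewrite -(card_flag bu0) [RHS](cardsD1 (word_chain a u0 t)) tu0.
have u0K : flag u0 \in ear a S i j by apply/earP => //; exists u0.
rewrite inE; apply/exists_inP; exists G'; last first.
  apply/subsetP => g gG; rewrite in_setD1 (subsetP Gu0 _ gG) andbT.
  by apply: contra tG => /eqP <-.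
rewrite inE dK cG' eqxx /= (generated_down u0K) ?subsetDl //=; apply/cards1P.
exists (flag u0); apply/setP => H; rewrite [LHS]inE in_set1; apply/andP/eqP; last first.
  by move=> ->; split=> //; rewrite properEcard subsetDl card_flag // -cG' ltnSn.
case=> HK pH; have /(earP _ vij)[u1 [au1 gu1 Hu1]] := HK; have [bu1 _ _] := gu1.
have eH : H = flag u1.
  apply/eqP; rewrite eqEcard Hu1 card_flag // -cG'; exact: proper_card.
have hk k : k \in S -> k != t -> word_chain a u1 k = word_chain a u0 k.
  move=> kS kt; have /(flagP _ bu1)[k' k'S ek] : word_chain a u0 k \in flag u1.
    rewrite -eH; apply: (subsetP (proper_sub pH)); rewrite in_setD1.
    have -> : word_chain a u0 k \in flag u0 by apply/flagP => //; exists k.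
    rewrite andbT; apply: contra kt => /eqP/(congr1 (@rank _ L)).
    by rewrite !rank_word_chain_S // => ->.
  by have := congr1 (@rank _ L) ek; rewrite !rank_word_chain_S // ek => ->.
case: (dich u1 au1 hk) => e; first by rewrite eH.
case: ngv; suff <- : u1 = v by [].
exact: eq_agrees bw au1 av e.
Qed.

(** A good word without descents is canonical for the empty chain. That chain is a face of every
    nonempty ear, so no earlier ear could be nonempty. *)
Lemma ear_has_descent (i j n m : nat) u : ear_index i j -> ear_index n m ->
  precedes (n, m) (i, j) -> ear a S n m != finset.set0 ->
  agrees inS (ear_word i j) u -> good u ->
  exists b c, [/\ b \in u, c \in u, index c u = (index b u).+1, index c u \in S & (c < b)%N].
Proof.
move=> vij vnm lt ne au gu; have [bu mlu asu] := gu.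
have [h|h] := boolP [exists b, exists c,
    [&& b \in u, c \in u, index c u == (index b u).+1 & ~~ (b < c)%N]].
  case/existsP: h => b /existsP[c /and4P[ub uc /eqP ec bc]].
  exists b, c; split=> //; first by apply: contraNT bc => h; apply: asu.
  rewrite ltn_neqAle leqNgt bc andbT; apply/eqP => /val_inj ebc.
  by move/eqP: ec; rewrite ebc eqn_leq ltnn andbF.
have cu : canonical finset.set0 u.
  split=> // [g|b c ub uc ec _]; first by rewrite inE.
  apply/negPn/negP => bc; case/negP: h; apply/existsP; exists b; apply/existsP; exists c.
  by apply/and4P; split=> //; apply/eqP.
case/set0Pn: ne => G GK.
have := canonical_not_before vij vnm cu au (generated_down GK (sub0set G)).
by rewrite lt.
Qed.

(** The canonical word of the empty chain is increasing. It has no decreasing pair to preserve, so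
    by [good_closed] its whole class is good and the ear is the full sphere. *)
Lemma first_ear : exists i j : nat, [/\ ear_index i j,
  ear a S i j = order_complex (ear_poset a S i j) &
  forall n m : nat, ear_index n m -> ear a S n m != finset.set0 -> ~~ precedes (n, m) (i, j)].
Proof.
have h0 : finset.set0 \in order_complex (rank_selection L S).
  by apply/order_complexP; split; [exact: sub0set|move=> x y; rewrite inE].
have [i [j [u [vij au cu gu Kij]]]] := canonical_ear h0.
exists i, j; split=> //; last first.
  move=> n m vnm /set0Pn[G GK].
  by apply: (canonical_not_before vij vnm cu au); apply: generated_down (sub0set G).
have bw := ear_word_basis_seq vij; have pw := ear_word_perm vij.
apply/setP => G; apply/idP/idP.
  case/(earP _ vij) => v [av [bv _ _] Gv].
  have /order_complexP[_ chv] := flag_order_complex bv.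
  apply/order_complexP; split; first exact: subset_trans Gv (flag_sub_poset pw bw av).
  by move=> x y /(subsetP Gv) hx /(subsetP Gv); apply: chv.
case/(chain_sub_flag pw bw) => v av Gv; apply/earP => //; exists v; split=> //.
apply: (good_closed bw au av gu) => b c wb wc cb _ h.
have [bu _ pu asu] := cu; have ub : b \in u by rewrite (perm_mem au.1).
have uc : c \in u by rewrite (perm_mem au.1).
case: (ascent_or_separated bu pu asu ub uc h) => [h2|[g]]; last by rewrite inE.
by have := ltn_trans cb h2; rewrite ltnn.
Qed.

(** * The block model of an ear *)

(* The positions of the word of the ear carry the block model.  As the word is
   decreasing inside each block, the inversions of another word are the pairs of
   positions that it keeps in their natural order. *)
Section EarModel.
Variables i0 j0 : nat.
Hypothesis vij : ear_index i0 j0.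
Let w := ear_word i0 j0.
Let X := ear_poset a S i0 j0.
Let bw : basis_seq w := ear_word_basis_seq vij.
Let pw : perm_eq w (enum (nbcB a i0)) := ear_word_perm vij.
Implicit Types p q : 'I_(size w).

Definition letter p : 'I_l := tnth (in_tuple w) p.

Definition ear_block p := block_index inS p.

Definition ear_support (z : L) : {set 'I_(size w)} := [set p | a (letter p) <= z].

Lemma mem_letter p : letter p \in w.
Proof. exact: mem_tnth. Qed.

Lemma index_letter p : index (letter p) w = p.
Proof. by rewrite /letter (tnth_nth (letter p)) index_uniq // basis_seq_uniq. Qed.

Lemma letter_ex b : b \in w -> exists2 p, letter p = b & index b w = p.
Proof.
move=> wb; have h : (index b w < size w)%N by rewrite index_mem.
exists (Ordinal h); rewrite -?index_letter // /letter (tnth_nth b) /= nth_index //.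
Qed.

(** Words of the class permute the letters inside the blocks, and a rank in [S] is not a block
    end. *)
Lemma same_block u b c : agrees inS w u -> b \in u -> c \in u ->
  index c u = (index b u).+1 -> index c u \in S ->
  block_index inS (index b w) = block_index inS (index c w).
Proof.
move=> au ub uc e cS; have bu := agrees_basis_seq bw au.
have wb : b \in w by rewrite -(perm_mem au.1).
have wc : c \in w by rewrite -(perm_mem au.1).
case: (ltngtP (block_index inS (index b w)) (block_index inS (index c w))) => //.
  case/block_index_ltP => k [kS bk kc].
  have kw : (k <= size w)%N by apply: leq_trans kc _; rewrite ltnW // index_mem.
  have tk := agrees_take bu au kw kS.
  have h1 : (index b u < k)%N by rewrite -in_take // tk in_take.
  have h2 : (k <= index c u)%N by rewrite leqNgt -in_take // tk in_take // -leqNgt.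
  by case/negP: kS; rewrite /inS (_ : k = index c u) //; apply/eqP; rewrite eqn_leq h2 e h1.
move/(index_lt_of_block bw au wc wb); rewrite e ltnNge => /negP[].
exact: leqnSn.
Qed.

Lemma block_descends b c : b \in w -> c \in w -> (index b w < index c w)%N ->
  block_index inS (index b w) = block_index inS (index c w) -> (c < b)%N.
Proof.
move=> wb wc; move e : (index c w - index b w)%N => k.
elim: k c wc e => [|k IH] c wc e bc bb.
  by move/eqP: e; rewrite subn_eq0 leqNgt bc.
have nS m : (index b w < m)%N -> (m <= index c w)%N -> m \in S.
  move=> h1 h2; apply/negPn/negP => mS.
  by have := @block_index_lt inS _ m _ mS h1 h2; rewrite bb ltnn.
have c1 : ((index c w).-1 < size w)%N by apply: leq_ltn_trans (leq_pred _) _; rewrite index_mem.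
pose d := nth b w (index c w).-1.
have wd : d \in w by apply: mem_nth.
have id : index d w = (index c w).-1 by rewrite index_uniq // basis_seq_uniq.
have cd : (c < d)%N.
  apply: (ear_word_descends vij) => //; first by rewrite id (ltn_predK bc).
  by apply: nS.
have bd : (index b w <= index d w)%N by rewrite id -ltnS (ltn_predK bc).
move: bd; rewrite leq_eqVlt => /predU1P[bd|bd].
  by rewrite (word_chain_inj_index bw wb wd bd).
apply: ltn_trans cd _; apply: IH => //; first by rewrite id -subn1 subnAC e subn1.
apply/eqP; rewrite eqn_leq block_index_le ?(ltnW bd) //= bb block_index_le // id.
exact: leq_pred.
Qed.

Lemma ear_support_word u n p : agrees inS w u ->
  (p \in ear_support (word_chain a u n)) = (index (letter p) u < n)%N.
Proof.
move=> au; rewrite inE le_word_chain //; first exact: agrees_basis_seq au.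
by rewrite (perm_mem au.1) mem_letter.
Qed.

Lemma ear_posetE z : z \in X -> exists u n, [/\ agrees inS w u, n \in S & z = word_chain a u n].
Proof.
case/(ear_posetP _ pw) => zS [u au [n nw ez]]; exists u, n; split=> //.
have bu := agrees_basis_seq bw au.
by move: zS; rewrite ez rank_word_chain // (perm_size au.1).
Qed.

Lemma ear_support_admissible z : z \in X -> admissible ear_block (ear_support z).
Proof.
case/ear_posetE => u [n [au nS ->]]; have bu := agrees_basis_seq bw au.
have nu : (n < size u)%N by rewrite (basis_seq_size bu) mem_S_lt.
have n1 : (n.-1 < size u)%N by apply: leq_ltn_trans (leq_pred _) nu.
have w0 : 'I_l by case: (u) nu => [|x _ _]; [|exact: x].
pose b := nth w0 u n.-1; pose c := nth w0 u n.
have ub : b \in u by apply: mem_nth.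
have uc : c \in u by apply: mem_nth.
have ib : index b u = n.-1 by rewrite index_uniq // basis_seq_uniq.
have ic : index c u = n by rewrite index_uniq // basis_seq_uniq.
have e : index c u = (index b u).+1 by rewrite ib ic prednK // mem_S_gt0.
have [|p ep ip] := @letter_ex b; first by rewrite -(perm_mem au.1).
have [|q eq iq] := @letter_ex c; first by rewrite -(perm_mem au.1).
apply/andP; split.
  apply/set0Pn; exists (p, q); rewrite cutP !ear_support_word // ep eq ib ic ltnn andbT.
  rewrite prednK ?mem_S_gt0 // leqnn andbT /ear_block -ip -iq.
  by apply/eqP; apply: same_block au ub uc e _; rewrite ic.
apply/forall_inP => p1; rewrite ear_support_word // => h1.
apply/forallP => q1; apply/implyP => h2; rewrite ear_support_word //.
apply: ltn_trans h1; apply: index_lt_of_block bw au (mem_letter _) (mem_letter _) _.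
by rewrite !index_letter.
Qed.

Lemma ear_support_le z z' : z \in X -> (ear_support z \subset ear_support z') = (z <= z').
Proof.
move=> zX; apply/fintype.subsetP/idP => h.
  rewrite (poset_joins pw bw zX); apply/joins_seqP => b; rewrite mem_filter => /andP[bz wb].
  have [p ep _] := letter_ex wb; have := h p; rewrite !inE ep; exact.
by move=> p; rewrite !inE => /le_trans; apply.
Qed.

Lemma ear_support_inj : {in X &, injective ear_support}.
Proof.
move=> z z' zX zX' e; apply/eqP.
by rewrite eq_le -!ear_support_le // e subxx.
Qed.

(** Listing the letters of [A] first, otherwise in the order of [w], makes [A] a prefix. Its length
    lies in [S], because a prefix whose length is outside [S] is a union of blocks and is not
    cut. *)
Lemma ear_support_surj (A : {set 'I_(size w)}) : admissible ear_block A ->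
  exists2 z, z \in X & ear_support z = A.
Proof.
case/andP => /set0Pn[[p0 q0]]; rewrite cutP => /and3P[/eqP b0 p0A q0A] /forall_inP down.
pose inA b := [exists p in A, letter p == b].
have inAE p : inA (letter p) = (p \in A).
  apply/exists_inP/idP => [[q qA /eqP e]|pA]; last by exists p.
  by rewrite -(_ : q = p) //; apply/val_inj; rewrite /= -!index_letter e.
pose u := [seq b <- w | inA b] ++ [seq b <- w | ~~ inA b].
pose n := count inA w.
have pu : perm_eq u w by rewrite perm_filterC.
have bu : basis_seq u by apply: basis_seq_perm bw; rewrite perm_sym.
have tu : take n u = [seq b <- w | inA b] by rewrite take_size_cat // size_filter.
have au : agrees inS w u.
  split=> // m mw mS; apply: eq_joins.
  (* At a block end [m], either [A] reaches past [m] and contains the first [m] positions, or it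
     lies among them. In both cases the first [m] letters form the same set. *)
  have [/exists_inP[p pA mp]|h] := boolP [exists p in A, (m <= p)%N].
    have all1 : all inA (take m w).
      apply/allP => b bm; have wb := mem_take bm.
      have [q eq iq] := letter_ex wb; rewrite -eq inAE.
      have /forallP/(_ q)/implyP := down p pA; apply.
      by apply: (block_index_lt mS) => //; rewrite -iq -in_take.
    move=> b; rewrite /u -{1}(cat_take_drop m w) filter_cat -catA.
    by move/all_filterP: all1 => ->; rewrite take_size_cat // size_takel.
  have no2 : all (predC inA) (drop m w).
    apply/allP => b bm /=; apply/exists_inP => -[p pA /eqP ep].
    move/exists_inPn: h => /(_ p pA); rewrite -ltnNge -index_letter ep => h.
    have := basis_seq_uniq bw; rewrite -{1}(cat_take_drop m w) cat_uniq.
    by case/and3P => _ /hasPn/(_ b bm) + _; rewrite /= in_take ?h // (mem_drop bm).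
  move=> b; rewrite /u -{1 2}(cat_take_drop m w) !filter_cat.
  have -> : [seq b <- drop m w | inA b] = [::].
    by apply/eqP; rewrite -[_ == _]negbK -has_filter -all_predC.
  have e : size ([seq b <- take m w | inA b] ++ [seq b <- take m w | ~~ inA b]) = m.
    by rewrite (perm_size (permEl (perm_filterC _ _))) size_takel.
  rewrite cats0 catA take_cat e ltnn subnn take0 cats0.
  by rewrite (perm_mem (permEl (perm_filterC _ _))).
have nw : (n <= size w)%N by apply: count_size.
have nS : n \in S.
  apply/negPn/negP => nS; have tk := agrees_take bu au nw nS.
  have mA p : (p \in A) = (p < n)%N.
    rewrite -[X in (X < _)%N]index_letter -in_take ?mem_letter // -tk tu.
    by rewrite mem_filter inAE mem_letter andbT.
  have := @block_index_lt inS p0 n q0 nS; rewrite -mA p0A leqNgt -mA q0A.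
  by move=> /(_ isT isT); rewrite -/(ear_block p0) -/(ear_block q0) b0 ltnn.
exists (word_chain a u n).
  apply/(ear_posetP _ pw); split; first by rewrite rank_word_chain_S.
  by exists u => //; exists n.
apply/setP => p; rewrite ear_support_word // -in_take ?tu ?mem_filter ?inAE ?mem_letter ?andbT //.
by rewrite (perm_mem pu) mem_letter.
Qed.

Lemma supp_chain_order_complex G : supp_chain ear_support X G = (G \in order_complex X).
Proof.
apply/supp_chainP/order_complexP => -[GX h]; split=> // z z' zG zG'.
  have zX := fintype.subsetP GX z zG; have zX' := fintype.subsetP GX z' zG'.
  by have := h z z' zG zG'; rewrite !ear_support_le.
have zX := fintype.subsetP GX z zG; have zX' := fintype.subsetP GX z' zG'.
by rewrite !ear_support_le //; apply: h.
Qed.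

Lemma card_nonlast_ear : #|nonlast ear_block| = #|` S|.
Proof.
(* Positions count from 0 and ranks from 1: the break after position [p] has rank [p.+1] and ends a
   block exactly when that rank is outside [S]. *)
have nl p : (p \in nonlast ear_block) = (p.+1 \in S).
  rewrite inE; apply/existsP/idP => [[q /andP[/eqP bq pq]]|pS].
    apply/negPn/negP => pS; have := @block_index_lt inS p p.+1 q pS (leqnn _) pq.
    by rewrite -/(ear_block p) -bq ltnn.
  have h : (p.+1 < size w)%N by have := mem_S_lt pS; rewrite -(basis_seq_size bw).
  exists (Ordinal h); rewrite /= leqnn andbT /ear_block /= block_indexS.
  by rewrite /inS pS addn0.
rewrite cardE -(size_map (fun p : 'I_(size w) => p.+1)).
apply/perm_size/uniq_perm; last 1 first.
- move=> n; apply/mapP/idP => [[p]|nS]; first by rewrite mem_enum nl => pS ->.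
  have n1 : (n.-1 < size w)%N.
    by rewrite (basis_seq_size bw); apply: leq_ltn_trans (leq_pred _) (mem_S_lt nS).
  by exists (Ordinal n1); rewrite ?mem_enum ?nl /= prednK // mem_S_gt0.
- by rewrite map_inj_uniq ?enum_uniq // => p q [] /val_inj.
- exact: fset_uniq.
Qed.

Lemma separates_flag u p q : agrees inS w u -> ear_block p = ear_block q ->
  separates ear_support (flag u) p q = (index (letter p) u < index (letter q) u)%N.
Proof.
move=> au bpq; have bu := agrees_basis_seq bw au.
have mu (s : 'I_(size w)) : letter s \in u by rewrite (perm_mem au.1) mem_letter.
apply/separatesP/idP => [[z /(flagP _ bu)[n nS ->]]|h].
  by rewrite !ear_support_word // -leqNgt => /andP[]; apply: leq_trans.
exists (word_chain a u (index (letter q) u)); last first.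
  by rewrite !ear_support_word // h ltnn.
apply/flagP => //; exists (index (letter q) u) => //; apply/negPn/negP => nS.
have nw : (index (letter q) u <= size w)%N by rewrite -(perm_size au.1) ltnW // index_mem.
have tk := agrees_take bu au nw nS.
have h1 : (p < index (letter q) u)%N.
  by rewrite -[X in (X < _)%N]index_letter -in_take ?mem_letter // -tk in_take.
have h2 : (index (letter q) u <= q)%N.
  by rewrite leqNgt -[X in (X < _)%N]index_letter -in_take ?mem_letter // -tk in_take // ltnn.
by have := @block_index_lt inS _ _ _ nS h1 h2; rewrite -/(ear_block p) bpq ltnn.
Qed.

Lemma ear_facets_chain F : F \in ear_facets a S i0 j0 -> supp_chain ear_support X F.
Proof.
case/(ear_facetsP _ vij) => u [au [bu _ _] ->]; rewrite supp_chain_order_complex.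
have /order_complexP[_ ch] := flag_order_complex bu.
by apply/order_complexP; split=> //; apply: flag_sub_poset.
Qed.

Lemma block_order b c : b \in w -> c \in w -> (c < b)%N ->
  block_index inS (index b w) = block_index inS (index c w) -> (index b w < index c w)%N.
Proof.
move=> wb wc cb e; case: (ltngtP (index b w) (index c w)) => // h.
  by have := block_descends wc wb h (esym e); rewrite ltnNge ltnW.
by move: cb; rewrite (word_chain_inj_index bw wb wc h) ltnn.
Qed.

(** By maximality [F'] is the flag of a word of the class, and the kept pairs of positions become
    the kept decreasing pairs of letters in [good_closed]. *)
Lemma ear_facets_closed F F' : F \in ear_facets a S i0 j0 -> supp_chain ear_support X F' ->
  (forall z, z \in X -> supp_chain ear_support X (z |: F') -> z \in F') ->
  (forall p q, (p < q)%N -> ear_block p = ear_block q ->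
     separates ear_support F p q -> separates ear_support F' p q) ->
  F' \in ear_facets a S i0 j0.
Proof.
case/(ear_facetsP _ vij) => u [au gu ->] cF' mF' sep.
have /(maximal_chainsP pw bw)[v av eF'] : F' \in maximal_chains X.
  rewrite inE; apply/maxsetP; split; first by rewrite -supp_chain_order_complex.
  move=> D DX F'D; apply/eqP; rewrite eqEsubset F'D andbT.
  apply/fintype.subsetP => z zD; have /order_complexP[DX' _] := DX.
  apply: mF'; first exact: (fintype.subsetP DX').
  apply: (supp_chain_sub (G := D)); last by rewrite supp_chain_order_complex.
  by rewrite subUset sub1set zD.
apply/(ear_facetsP _ vij); exists v; split=> //.
apply: (good_closed bw au av gu) => b c wb wc cb bb h.
have [p ep ip] := letter_ex wb; have [q eq iq] := letter_ex wc.
have bpq : ear_block p = ear_block q by rewrite /ear_block -ip -iq.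
rewrite -ep -eq -(separates_flag av bpq) -eF'; apply: sep => //.
  by rewrite -ip -iq; apply: block_order.
by rewrite separates_flag // ep eq.
Qed.

Lemma ear_facets_pairs n m F : ear_index n m -> precedes (n, m) (i0, j0) ->
  ear a S n m != finset.set0 -> F \in ear_facets a S i0 j0 ->
  ordered_pairs ear_block ear_support F != finset.set0.
Proof.
move=> vnm lt ne /(ear_facetsP _ vij)[u [au gu ->]].
have [b [c [ub uc e cS cb]]] := ear_has_descent vij vnm lt ne au gu.
have wb : b \in w by rewrite -(perm_mem au.1).
have wc : c \in w by rewrite -(perm_mem au.1).
have bb := same_block au ub uc e cS.
have [p ep ip] := letter_ex wb; have [q eq iq] := letter_ex wc.
have bpq : ear_block p = ear_block q by rewrite /ear_block -ip -iq.
apply/set0Pn; exists (p, q); rewrite ordered_pairsP bpq eqxx /=.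
by rewrite separates_flag // ep eq e leqnn andbT -ip -iq block_order.
Qed.

Variable R : realType.

Let f := vertex ear_block ear_support R.

Let f_inj : {in X &, injective f}.
Proof. exact: vertex_inj ear_support_admissible ear_support_inj _. Qed.

Let f_complex : complex_image f (order_complex X) = boundary_complex (polytope (blk := ear_block) ear_support X (R := R)).
Proof.
rewrite -(complex_image_chains ear_support_admissible ear_support_inj ear_support_surj).
by congr complex_image; apply/setP => G; rewrite [RHS]inE supp_chain_order_complex.
Qed.

Lemma cover_order_complex (K : {set {set L}}) : K \subset order_complex X -> cover K \subset X.
Proof.
move=> /fintype.subsetP KX; apply/bigcupsP => G /KX /order_complexP[] //.
Qed.

Lemma order_complex_boundary : is_polytope_boundary R #|` S| (order_complex X).
Proof.
rewrite -card_nonlast_ear; exists (polytope (blk := ear_block) ear_support X (R := R)), f; split=> //.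
  exact: simplicial_polytope_polytope ear_support_admissible ear_support_inj ear_support_surj R.
move=> z z' /(fintype.subsetP (cover_order_complex (subxx _))) zX.
move/(fintype.subsetP (cover_order_complex (subxx _))); exact: f_inj.
Qed.

Lemma proper_order_complex_boundary (K : {set {set L}}) : K \proper order_complex X ->
  is_proper_sub_polytope_boundary R #|` S| K.
Proof.
case/properP => sK [G GX GK].
rewrite -card_nonlast_ear; exists (polytope (blk := ear_block) ear_support X (R := R)), f; split=> //.
- exact: simplicial_polytope_polytope ear_support_admissible ear_support_inj ear_support_surj R.
- move=> z z' /(fintype.subsetP (cover_order_complex sK)) zX.
  move/(fintype.subsetP (cover_order_complex sK)); exact: f_inj.
- by rewrite -f_complex => A [F FK ->]; exists F => //; apply: (fintype.subsetP sK).
rewrite -f_complex => e.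
have : complex_image f K (classical_sets.image (classical_sets.mkset (fun x => x \in G)) f) by rewrite e; exists G.
case=> F FK eFG; case/negP: GK; suff -> : G = F by [].
have /order_complexP[GX' _] := GX.
have /order_complexP[FX' _] := fintype.subsetP sK F FK.
have memi (H : {set L}) z : H \subset X -> z \in X ->
    classical_sets.image (classical_sets.mkset (fun x => x \in H)) f (f z) -> z \in H.
  move=> HX zX [z' /= z'H e']; rewrite -(f_inj _ zX e') //; exact: (fintype.subsetP HX).
apply/setP => z; apply/idP/idP => zH.
  apply: memi => //; first exact: (fintype.subsetP GX').
  by rewrite -eFG; exists z.
apply: memi => //; first exact: (fintype.subsetP FX').
by rewrite eFG; exists z.
Qed.

Lemma ear_sub_poset_complex : ear a S i0 j0 \subset order_complex X.
Proof.
apply/fintype.subsetP => G; rewrite inE => /exists_inP[F /ear_facets_chain].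
rewrite supp_chain_order_complex => /order_complexP[FX ch] GF; apply/order_complexP; split.
  exact: fintype.subset_trans FX.
by move=> z z' /(fintype.subsetP GF) zF /(fintype.subsetP GF); apply: ch.
Qed.

(** For properness, [boundary_or_canonical] is applied to the empty chain. An earlier ear contains
    it, so its canonical word is not in this class; hence some word of the class is not good, and
    its flag is missing from the ear. *)
Lemma later_ear n m : ear_index n m -> precedes (n, m) (i0, j0) ->
  ear a S n m != finset.set0 -> ear a S i0 j0 != finset.set0 ->
  is_proper_sub_polytope_boundary R #|` S| (ear a S i0 j0) /\
  simplicial_ball R (ear a S i0 j0).
Proof.
move=> vnm lt ne ne0; split.
  apply: proper_order_complex_boundary; rewrite properEneq ear_sub_poset_complex andbT.
  apply/eqP => e; have [u [au gu _]] := ear_flag vij ne0.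
  case: (boundary_or_canonical bw au gu (sub0set _)) => [[u0 au0 cu0]|].
    case/set0Pn: ne => G GK; have G0 := generated_down GK (sub0set G).
    by have := canonical_not_before vij vnm cu0 au0 G0; rewrite lt.
  move=> [u0 [v [t [[_ _ _ [av _ _ _] ngv] _]]]]; apply: ngv.
  have bv := agrees_basis_seq bw av.
  have : flag v \in ear a S i0 j0.
    rewrite e; apply/order_complexP; split; first exact: flag_sub_poset.
    by have /order_complexP[] := flag_order_complex bv.
  case/(earP _ vij) => v' [av' gv' sv]; suff -> : v = v' by [].
  have bv' := agrees_basis_seq bw av'.
  by apply: eq_agrees bw av av' _; apply/eqP; rewrite eqEcard sv !card_flag //=.
apply: (simplicial_ball_ideal ear_support_admissible ear_support_inj ear_support_surj).
- exact: ear_facets_chain.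
- exact: ear_facets_closed.
- by case/set0Pn: ne0 => G; rewrite inE => /exists_inP[F FE _]; apply/set0Pn; exists F.
- by move=> F; apply: ear_facets_pairs lt ne.
- by rewrite card_nonlast_ear; apply: cdim_ear.
Qed.

End EarModel.

(** * The sequence of nonempty ears *)

Definition ear_indices : seq (nat * nat) :=
  [seq (n, m) | n <- iota 0 (size (nbc_bases a)), m <- iota 0 (nchains a S n)].

Lemma mem_ear_indices n m : ((n, m) \in ear_indices) = ear_index n m.
Proof.
apply/allpairsPdep/andP => [[n' [m' [hn hm [-> ->]]]]|[hn hm]].
  by move: hn hm; rewrite !mem_iota.
by exists n, m; rewrite !mem_iota.
Qed.

Lemma ears_indices : ears a S = [seq ear a S p.1 p.2 | p <- ear_indices].
Proof.
rewrite /ears /ear_indices map_flatten -map_comp; congr flatten.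
by apply: eq_map => n /=; rewrite -map_comp.
Qed.

Lemma pairwise_allpairs (s : seq nat) (k : nat -> nat) : pairwise ltn s ->
  pairwise precedes [seq (n, m) | n <- s, m <- iota 0 (k n)].
Proof.
elim: s => [|n s IH] //= /andP[ns /IH ps]; rewrite pairwise_cat ps andbT; apply/andP; split.
  apply/allrelP => _ [n' m'] /mapP[m _ ->] /allpairsPdep[n1 [m1 [hn1 _ [-> _]]]].
  by rewrite /precedes; have /= -> := allP ns n1 hn1.
rewrite pairwise_map; have := iota_ltn_sorted 0 (k n).
rewrite sorted_pairwise; last exact: ltn_trans.
by apply: sub_pairwise => x y h; rewrite /precedes /= ltnn eqxx.
Qed.

Lemma precedes_trans : transitive precedes.
Proof.
move=> [n m] [i j] [i' j'] /orP[/= h1|/= /andP[/eqP <- h1]] /orP[/= h2|/= /andP[/eqP <- h2]];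
rewrite /precedes /=.
- by rewrite (ltn_trans h1 h2).
- by rewrite h1.
- by rewrite h2.
- by rewrite eqxx (ltn_trans h1 h2) orbT.
Qed.

Lemma precedes_irr (p : nat * nat) : precedes p p = false.
Proof. by rewrite /precedes !ltnn andbF. Qed.

Let Q := [seq p <- ear_indices | ear a S p.1 p.2 != finset.set0].
Let K n := nth finset.set0 (nonempty_ears a S) n.

Let nonempty_earsE : nonempty_ears a S = [seq ear a S p.1 p.2 | p <- Q].
Proof. by rewrite /nonempty_ears ears_indices filter_map. Qed.

Let size_Q : size (nonempty_ears a S) = size Q.
Proof. by rewrite nonempty_earsE size_map. Qed.

Let q0 : nat * nat := (0%N, 0%N).

Let KE n : (n < size Q)%N -> K n = ear a S (nth q0 Q n).1 (nth q0 Q n).2.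
Proof. by move=> h; rewrite /K nonempty_earsE (nth_map q0). Qed.

Let Q_sorted : pairwise precedes Q.
Proof. by apply: pairwise_filter; apply: pairwise_allpairs; rewrite -sorted_pairwise ?iota_ltn_sorted //; apply: ltn_trans. Qed.

Let mem_Q (n m : nat) : ((n, m) \in Q) = (ear a S n m != finset.set0) && ear_index n m.
Proof. by rewrite mem_filter mem_ear_indices. Qed.

Let Q_nth n : (n < size Q)%N -> ear_index (nth q0 Q n).1 (nth q0 Q n).2 /\
  ear a S (nth q0 Q n).1 (nth q0 Q n).2 != finset.set0.
Proof.
move=> h; have := mem_nth q0 h; case: (nth q0 Q n) => n' m'.
by rewrite mem_Q => /andP[].
Qed.

Let Q_lt n m : (n < size Q)%N -> (m < size Q)%N -> precedes (nth q0 Q n) (nth q0 Q m) = (n < m)%N.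
Proof.
have pr n' m' : (n' < m')%N -> (m' < size Q)%N -> precedes (nth q0 Q n') (nth q0 Q m').
  move=> h hm; have /pairwiseP := Q_sorted; move/(_ q0 n' m'); apply=> //.
  exact: ltn_trans h hm.
move=> hn hm; case: (ltngtP n m) => [h|h|->].
- exact: pr.
- by apply/negP => h2; have := precedes_trans h2 (pr _ _ h hn); rewrite precedes_irr.
- exact: precedes_irr.
Qed.

Let previousP n (G : {set L}) : (n <= size Q)%N ->
  G \in \big[@finset.setU _/finset.set0]_(m < n) K m <->
  exists m, [/\ (m < n)%N & G \in K m].
Proof.
move=> hn; split=> [/bigcupP[m _ Gm]|[m [mn Gm]]]; first by exists (m : nat).
by apply/bigcupP; exists (Ordinal mn).
Qed.

(** Empty ears have no faces, so the nonempty ears before position [n] cover the same faces as all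
    ears at preceding pairs. *)
Let earlier_ears n (G : {set L}) : (n < size Q)%N ->
  G \in \big[@finset.setU _/finset.set0]_(m < n) K m <->
  exists n' m', [/\ ear_index n' m', precedes (n', m') (nth q0 Q n) & G \in ear a S n' m'].
Proof.
move=> hn; split=> [/(previousP _ (ltnW hn))[m [mn Gm]]|[n' [m' [vnm lt Gnm]]]].
  have hm := ltn_trans mn hn; have [v _] := Q_nth hm.
  move: Gm; rewrite KE // => Gm; exists (nth q0 Q m).1, (nth q0 Q m).2; split=> //.
  by rewrite -surjective_pairing Q_lt.
have qQ : (n', m') \in Q by rewrite mem_Q vnm andbT; apply/set0Pn; exists G.
have hi : (index (n', m') Q < size Q)%N by rewrite index_mem.
apply/(previousP _ (ltnW hn)); exists (index (n', m') Q).
by rewrite -(Q_lt hi hn) (KE hi) (nth_index q0 qQ); split; [exact: lt|exact: Gnm].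
Qed.

Lemma nonempty_ears_decomposition (R : realType) :
  convex_ear_decomposition R (order_complex (rank_selection L S)) (nonempty_ears a S).
Proof.
have [i [j [vij eij fij]]] := first_ear.
have neij : ear a S i j != finset.set0.
  by rewrite eij; apply/set0Pn; exists finset.set0; apply/order_complexP; split;
    [exact: sub0set|move=> x y; rewrite inE].
have ijQ : (i, j) \in Q by rewrite mem_Q neij.
have Q0 : (0 < size Q)%N by case: (Q) ijQ.
(* The list is sorted by [precedes] and no nonempty ear precedes the one from [first_ear]. *)
have e0 : nth q0 Q 0 = (i, j).
  apply/eqP/negPn/negP => /precedes_total/orP[h|h].
    have [v0 ne0] := Q_nth Q0; have := fij _ _ v0 ne0; rewrite -surjective_pairing h //.
  have hi : (index (i, j) Q < size Q)%N by rewrite index_mem.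
  by have := Q_lt hi Q0; rewrite nth_index // h ltn0.
rewrite /convex_ear_decomposition size_Q cdim_order_complex -/K; split.
- move=> n hn; rewrite -/(K n) KE //; have [v ne] := Q_nth hn; split; last exact: ear_subset.
  by move=> F G FK GF; apply: generated_down GF.
- apply/setP => G; apply/idP/idP.
    move/(previousP _ (leqnn _)) => [m [hm]]; rewrite KE //.
    by apply: ear_sub_order_complex; have [] := Q_nth hm.
  case/canonical_ear => n' [m' [_ [vnm _ _ _ GK]]].
  have qQ : (n', m') \in Q by rewrite mem_Q vnm andbT; apply/set0Pn; exists G.
  have hi : (index (n', m') Q < size Q)%N by rewrite index_mem.
  apply/(previousP _ (leqnn _)); exists (index (n', m') Q).
  by rewrite (KE hi) (nth_index q0 qQ); split; [exact: hi|exact: GK].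
- split.
    by rewrite -/(K 0%N) KE // e0 /= eij; apply: order_complex_boundary vij R.
  move=> n /andP[n0 hn]; rewrite -/(K n) KE //; have [v ne] := Q_nth hn.
  split; first exact: cdim_ear.
  have lt : precedes (i, j) ((nth q0 Q n).1, (nth q0 Q n).2) by rewrite -surjective_pairing -e0 Q_lt.
  by have [] := later_ear v R vij lt neij ne.
- move=> n /andP[n0 hn]; rewrite -/(K n) KE //; have [v ne] := Q_nth hn.
  have lt : precedes (i, j) ((nth q0 Q n).1, (nth q0 Q n).2) by rewrite -surjective_pairing -e0 Q_lt.
  by have [] := later_ear v R vij lt neij ne.
- move=> n /andP[n0 hn]; have [v ne] := Q_nth hn.
  apply/setP => G; rewrite -/(K n) in_setI KE //.
  apply/andP/idP => [[/(earlier_ears _ hn)[n' [m' [vnm lt GK]]] Gn]|].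
    apply/(ear_boundaryP _ v ne); split=> //; exists n', m'; split=> //.
  case/(ear_boundaryP _ v ne) => Gn [n' [m' [vnm lt GK]]]; split; last exact: Gn.
  by apply/(earlier_ears _ hn); exists n', m'; split; [exact: vnm|exact: lt|exact: GK].

Qed.

End Atoms.

Theorem theorem7p2 (R : realType) (disp : Order.disp_t) (L : finTBLatticeType disp)
    (r l : nat) (a : 'I_l -> L) (S : {fset nat}) :
  geometric_lattice L ->
  rank (\top%O : L) = r ->
  injective a ->
  (forall x : L, atom x <-> exists i, a i = x) ->
  (forall n : nat, n \in S -> 0 < n <= r.-1) ->
  convex_ear_decomposition R (order_complex (rank_selection L S)) (nonempty_ears a S).
Proof.
move=> geomL <- _ atomP hS; exact: nonempty_ears_decomposition.
Qed.
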